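(* Let $\Omega\subset\mathbb{R}^N$ be an open and bounded Lipschitz set. For every $0<s<1$ we have $$\lim_{p\to 1^+} \lambda^s_{1,p}(\Omega)=h_s(\Omega).$$
   Context: For $1\le p<\infty$ and a measurable function $u$, $[u]_{W^{s,p}(\mathbb{R}^N)}=\left(\int_{\mathbb{R}^N}\int_{\mathbb{R}^N} \frac{|u(x)-u(y)|^p}{|x-y|^{N+s\,p}} \, dx\,dy\right)^{1/p}$. $\widetilde W^{s,p}_0(\Omega)$ is the closure of $C^\infty_0(\Omega)$ with respect to the norm $u\mapsto [u]_{W^{s,p}(\mathbb{R}^N)}+\|u\|_{L^p(\Omega)}$ (functions extended by $0$ outside $\Omega$). For $p>1$, $$\lambda^s_{1,p}(\Omega)=\min_{u\in\widetilde W^{s,p}_0(\Omega)} \left\{[u]^p_{W^{s,p}(\mathbb{R}^N)}\, :\,\|u\|_{L^p(\Omega)}=1,\ u\ge 0\right\}.$$ The $s$-perimeter of a Borel set $E$ is $P_s(E)=[1_E]_{W^{s,1}(\mathbb{R}^N)}$ and the $s$-Cheeger constant of $\Omega$ is $h_s(\Omega)=\inf_{E\subset\Omega}\frac{P_s(E)}{|E|}$ (infimum over subsets of positive Lebesgue measure). *)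

(* Defs.v *)
From HB Require Import structures.
From mathcomp Require Import all_boot all_order all_algebra.
From mathcomp Require Import all_classical all_reals all_analysis.
From mathcomp Require Import measurable_realfun.
Set Implicit Arguments.
Unset Strict Implicit.
Unset Printing Implicit Defensive.
Import Order.TTheory GRing.Theory Num.Theory.
Import numFieldNormedType.Exports.
Local Open Scope classical_set_scope.
Local Open Scope ring_scope.

(* R^N is the type 'rV[R]_N. The library's norm on 'rV[R]_N is the sup norm
   (the topology is the usual one); the Euclidean norm is [enorm] below. *)

(* Borel sigma-algebra of R^N *)
HB.instance Definition _ (R : realType) (N : nat) :=
  @isMeasurable.Build (sigma_display (@open 'rV[R]_N)) 'rV[R]_N
    <<s @open 'rV[R]_N >>
    (@sigma_algebra0 _ setT (@open 'rV[R]_N))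
    (@sigma_algebraC _ (@open 'rV[R]_N))
    (@sigma_algebra_bigcup _ setT (@open 'rV[R]_N)).

Lemma sigma_finite_pushforward (d1 d2 : measure_display)
    (T1 : measurableType d1) (T2 : measurableType d2) (R : realType)
    (mu : set T1 -> \bar R) (f : T1 -> T2) (g : T2 -> T1) :
  sigma_finite setT mu -> measurable_fun setT g -> cancel f g ->
  sigma_finite setT (pushforward mu f).
Proof.
move=> [F TF Foo] mg fK.
exists (fun k => g @^-1` F k) => [|k].
  by rewrite -preimage_bigcup -TF preimage_setT.
have [mF Fk] := Foo k; split.
  by rewrite -[X in measurable X]setTI; exact: mg.
rewrite /pushforward -comp_preimage.
by rewrite (_ : g \o f = id) //; apply/funext => x /=; rewrite fK.
Qed.

(* The library's canonical sigma-finite structure on [m1 \x m2] is only found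
   for subprobabilities. *)
Lemma sigma_finite_product (d1 d2 : measure_display)
    (T1 : measurableType d1) (T2 : measurableType d2) (R : realType)
    (m1 : {sigma_finite_measure set T1 -> \bar R})
    (m2 : {sigma_finite_measure set T2 -> \bar R}) :
  sigma_finite setT (m1 \x m2)%E.
Proof.
have /sigma_finiteP[F [TF ndF Foo]] := sigma_finiteT m1.
have /sigma_finiteP[G [TG ndG Goo]] := sigma_finiteT m2.
exists (fun n => F n `*` G n).
  rewrite -setXTT TF TG predeqE => -[x y]; split.
    move=> [/= [n _ Fnx] [k _ Gky]]; exists (maxn n k) => //; split.
    - by move: x Fnx; exact/subsetPset/ndF/leq_maxl.
    - by move: y Gky; exact/subsetPset/ndG/leq_maxr.
  by move=> [n _ []/= ? ?]; split; exists n.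
move=> k; have [? ?] := Foo k; have [? ?] := Goo k.
split; first exact: measurableX.
by rewrite product_measure1E// lte_mul_pinfty// ge0_fin_numE.
Qed.

Section lebesgue_tuple.
Variable R : realType.
Local Notation mR := (measurableTypeR R).

Section cons.
Variables (n : nat) (m : {sigma_finite_measure set (n.-tuple mR) -> \bar R}).

Definition tcons (x : mR * n.-tuple mR) : n.+1.-tuple mR :=
  [the n.+1.-tuple mR of x.1 :: x.2].

Definition tuncons (t : n.+1.-tuple mR) : mR * n.-tuple mR :=
  (tnth t ord0, [tuple of behead t]).

Lemma measurable_tcons : measurable_fun setT tcons.
Proof. exact: measurable_cons. Qed.

Lemma measurable_tuncons : measurable_fun setT tuncons.
Proof.
apply: measurable_fun_pair; first exact: measurable_tnth.
exact: measurable_behead.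
Qed.

Lemma tconsK : cancel tcons tuncons.
Proof.
by move=> [x t]; congr pair; apply/val_inj.
Qed.

Definition mcons := pushforward ((@lebesgue_measure R \x m)%E) tcons.

HB.instance Definition _ := Measure.copy mcons
  (measure_function_pushforward__canonical__measure_function_Measure
    ((@lebesgue_measure R \x m)%E) measurable_tcons).

HB.instance Definition _ := Measure_isSigmaFinite.Build _ _ _ mcons
  (sigma_finite_pushforward (sigma_finite_product (@lebesgue_measure R) m)
    measurable_tuncons tconsK).
End cons.

Fixpoint lebesgue_tuple (n : nat) :
    {sigma_finite_measure set (n.-tuple mR) -> \bar R} :=
  match n with
  | 0 => [the {sigma_finite_measure set _ -> \bar R} of
           @dirac _ (0.-tuple mR) [tuple] R]
  | n'.+1 => mcons (lebesgue_tuple n')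
  end.

End lebesgue_tuple.

Section borel_rV.
Variables (R : realType) (N : nat).
Local Notation mR := (measurableTypeR R).

Definition rV_of_tuple (t : N.-tuple mR) : 'rV[R]_N := \row_i tnth t i.

Definition tuple_of_rV (x : 'rV[R]_N) : N.-tuple mR := [tuple x ord0 i | i < N].

Lemma rV_of_tupleK : cancel rV_of_tuple tuple_of_rV.
Proof. by move=> t; apply/eq_from_tnth => i; rewrite tnth_mktuple mxE. Qed.

Lemma rV_continuous_measurable (f : 'rV[R]_N -> R) :
  continuous f -> measurable_fun setT f.
Proof.
move=> /continuousP cf.
apply: (measurability _ (RGenOpens.measurableE R)).
move=> _ [_ [a [b ->] <-]]; apply: sub_sigma_algebra; rewrite setTI.
exact/cf/interval_open.
Qed.

Lemma measurable_tuple_of_rV : measurable_fun setT tuple_of_rV.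
Proof.
apply/measurable_fun_tnthP => i.
rewrite (_ : _ \o _ = fun x : 'rV[R]_N => x ord0 i); last first.
  by apply/funext => x /=; rewrite tnth_mktuple.
by apply: rV_continuous_measurable; exact: coord_continuous.
Qed.

Let rball (q : 'rV[rat]_N * rat) : set 'rV[R]_N :=
  ball (map_mx ratr q.1 : 'rV[R]_N) (ratr q.2 : R).

Lemma open_rV_bigcup (U : set 'rV[R]_N) : open U ->
  U = \bigcup_(q in [set q | rball q `<=` U]) rball q.
Proof.
move=> oU; apply/seteqP; split => [x Ux|x [q /= qU qx]]; last exact: qU.
have /nbhs_ballP[e /= e0 eU] := open_nbhs_nbhs (conj oU Ux).
have [r] : exists r : rat, 0 < (ratr r : R) < e / 2.
  have /rat_in_itvoo[r] : 0 < e / 2 by rewrite divr_gt0.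
  by rewrite in_itv/= => re; exists r.
move=> /andP[r0 re].
have aux i : exists q : rat, `|x ord0 i - ratr q| < ratr r.
  have /rat_in_itvoo[q] : x ord0 i - ratr r < x ord0 i + ratr r.
    by rewrite ltrBlDr -addrA ltrDl addr_gt0.
  rewrite in_itv/= => qx; exists q.
  by rewrite ltr_distlC.
have /choice[q qx] := aux.
have qbx : rball (\row_i q i, r) x.
  split => //= i j; rewrite (ord1 i) !mxE /ball /= distrC; exact: qx.
exists (\row_i q i, r) => //= y qy; apply: eU.
rewrite (splitr e); apply: (@ball_triangle R _ (map_mx ratr (\row_i q i) : 'rV[R]_N)).
  by apply: ball_sym; apply: le_ball qbx; exact: ltW.
by apply: le_ball qy; exact: ltW.
Qed.

Lemma measurable_rV_of_tuple : measurable_fun setT rV_of_tuple.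
Proof.
apply: (measurability (@open 'rV[R]_N)) => //.
move=> _ [U oU <-]; rewrite setTI (open_rV_bigcup oU) preimage_bigcup.
rewrite bigcup_mkcond.
apply: countable_bigcupT_measurable; first exact: countableP.
move=> [q r]; case: ifPn => // _; rewrite /rball /=.
have [r0|r0] := ltP 0 (ratr r : R); last first.
  by rewrite (_ : _ @^-1` _ = set0)//; apply/seteqP; split => // t /= [];
    rewrite ltNge r0.
rewrite (_ : _ @^-1` _ =
    \big[setI/setT]_(i < N)
      ((fun t : N.-tuple mR => tnth t i) @^-1` ball (ratr (q ord0 i) : R) (ratr r))).
  apply: bigsetI_measurable => i _.
  rewrite -[X in measurable X]setTI; apply: measurable_tnth => //.
  exact: measurable_ball.
rewrite -bigcap_seq; apply/seteqP; split => t /=.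
  by move=> [_ H] i _; have := H ord0 i; rewrite !mxE.
move=> H; split => // i j; rewrite (ord1 i) !mxE; apply: H => /=.
by rewrite mem_index_enum.
Qed.

Definition lebesgue_rV := pushforward (lebesgue_tuple R N) rV_of_tuple.

HB.instance Definition _ := Measure.copy lebesgue_rV
  (measure_function_pushforward__canonical__measure_function_Measure
    (lebesgue_tuple R N) measurable_rV_of_tuple).

HB.instance Definition _ := Measure_isSigmaFinite.Build _ _ _ lebesgue_rV
  (sigma_finite_pushforward (sigma_finiteT (lebesgue_tuple R N))
    measurable_tuple_of_rV rV_of_tupleK).
End borel_rV.

Lemma lebesgue_tuple_box (R : realType) (n : nat)
    (A : 'I_n -> set (measurableTypeR R)) :
  (forall i, measurable (A i)) ->
  lebesgue_tuple R n [set t | forall i, A i (tnth t i)] =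
  (\prod_(i < n) lebesgue_measure (A i))%E.
Proof.
elim: n A => [|n IHn] A mA /=.
  rewrite big_ord0 diracE mem_set//=; first by case.
rewrite /mcons /pushforward big_ord_recl -IHn; last by move=> i; exact: mA.
rewrite -product_measure1E//; last first.
  rewrite (_ : mkset _ = \bigcap_(i in [set: 'I_n])
      ((fun t : n.-tuple (measurableTypeR R) => tnth t i) @^-1`
        A (lift ord0 i))); last by apply/seteqP; split => t /= H i; [move=> _|]; exact: H.
  apply: fin_bigcap_measurable => // i _.
  by rewrite -[X in measurable X]setTI; exact: measurable_tnth.
congr product_measure1; apply/seteqP; split => -[x t] /=.
  move=> H; split => [|i]; first exact: (H ord0).
  by have := H (lift ord0 i); rewrite tnthS.
move=> [Ax At] i; case: (unliftP ord0 i) => [j ->|->]; last by rewrite tnth0.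
by rewrite tnthS; exact: At.
Qed.

(* [lebesgue_rV R N] is the product Lebesgue measure *)
Lemma lebesgue_rV_box (R : realType) (N : nat)
    (A : 'I_N -> set (measurableTypeR R)) :
  (forall i, measurable (A i)) ->
  lebesgue_rV [set x : 'rV[R]_N | forall i, A i (x ord0 i)] =
  (\prod_(i < N) lebesgue_measure (A i))%E.
Proof.
move=> mA; rewrite -lebesgue_tuple_box// /lebesgue_rV /pushforward.
congr (lebesgue_tuple R N _); apply/seteqP.
by split => t /= H i; have := H i; rewrite /rV_of_tuple mxE.
Qed.

Section fractional.
Variables (R : realType) (N : nat).
Implicit Types (Omega E : set 'rV[R]_N) (u f : 'rV[R]_N -> R) (s p : R).

Local Notation mu := (@lebesgue_rV R N).

Definition enorm (x : 'rV[R]_N) : R := Num.sqrt (\sum_i x ord0 i ^+ 2).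

(* On the null set x = y the integrand is 0. *)
Definition gagliardo s p u : \bar R :=
  ((\int[mu]_y \int[mu]_x
     (`|u x - u y| `^ p / enorm (x - y) `^ (N%:R + s * p))%:E) `^ p^-1)%E.

Definition Lp_norm Omega p u : \bar R := 'N[mu]_p%:E[EFin \o (u \_ Omega)]%E.

Definition iter_partial (l : seq 'I_N) f : 'rV[R]_N -> R :=
  foldr (fun i g => 'D_(delta_mx ord0 i) g) f l.

Definition smooth f := forall l : seq 'I_N,
  continuous (iter_partial l f) /\
  forall x i, derivable (iter_partial l f) x (delta_mx ord0 i).

Definition supp f : set 'rV[R]_N := closure [set x | f x != 0].

Definition test_function Omega f :=
  [/\ smooth f, compact (supp f) & supp f `<=` Omega].

(* Closure of the test functions, as a set of Borel functions on R^N (equal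
   a.e. functions are not identified). *)
Definition W0 Omega s p : set ('rV[R]_N -> R) :=
  [set u : 'rV[R]_N -> R | [/\ measurable_fun setT u,
    forall x, ~ Omega x -> u x = 0 &
    forall e : R, 0 < e -> exists2 phi, test_function Omega phi &
      (gagliardo s p (u \- phi)%R + Lp_norm Omega p (u \- phi)%R < e%:E)%E]].

(* The minimum, taken as an infimum in the extended reals. *)
Definition lambda1 Omega s p : \bar R :=
  ereal_inf [set (gagliardo s p u `^ p)%E | u in
    [set u | [/\ W0 Omega s p u, Lp_norm Omega p u = 1%E &
                 {ae mu, forall x, 0 <= u x}]]].

Definition s_perimeter s E : \bar R := gagliardo s 1 \1_E.

Definition cheeger Omega s : \bar R :=
  ereal_inf [set (s_perimeter s E / mu E)%E | E in
    [set E | [/\ measurable E, E `<=` Omega & (0 < mu E)%E]]].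
End fractional.

(* Near every boundary point, in some orthonormal coordinates z, Omega is the
   strict epigraph of a Lipschitz function of the first n coordinates. *)
Definition lipschitz_boundary (R : realType) (n : nat)
    (Omega : set 'rV[R]_n.+1) :=
  forall x0, (closure Omega `\` interior Omega) x0 ->
  exists (Q : 'M[R]_n.+1) (gamma : 'rV[R]_n -> R),
    [/\ Q *m Q^T = 1%:M, lipschitz gamma &
      \forall x \near x0, Omega x <->
        gamma (col' ord_max (x *m Q)) < (x *m Q) ord0 ord_max].

(* Main.v *)
Require Import Defs.
From mathcomp Require Import all_boot all_order all_algebra.
From mathcomp Require Import all_classical all_reals all_analysis.
From mathcomp Require Import measurable_realfun ring lra.

(** For a kernel K >= 0 let [energy K f] be the integral over k of
    K(k) ||f(. + k) - f||_1, and let k_p(z) = |z|^-(N + s p).  The s-perimeter of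
    a set E is the energy of its indicator for k_1.  By the coarea formula
    ([coarea]), an inequality M |E| <= energy K 1_E valid for all E inside Omega
    gives M ||v||_1 <= energy K v for all v >= 0 vanishing outside Omega.  The
    limit is the conjunction of two bounds.

    Lower bound.  The kernels K_p = k_p^(1/p) min(1, k_p)^(1 - 1/p)
    ([trunc_kernel]) are designed so that the inequality of Young yields
    energy K_p |u|^p <= [u]^p + 2 (p - 1) ||u||_p^p int min(1, k_p)
    ([energy_powR_le]), where the last integral is bounded uniformly in p.
    Hence lambda_p >= M - C (p - 1) as soon as M |E| <= energy K_p 1_E for all E
    inside Omega ([lambda1_ge]).  It remains to see that for M < h_s(Omega) this
    holds when p is close to 1 ([trunc_cheeger]).  Suppose not: for some p_j
    decreasing to 1 there are sets E_j inside Omega with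
    energy K_{p_j} 1_{E_j} < M |E_j|.  As the kernels are singular enough at 0,
    |E_j| >= c > 0 for a constant c ([mu_isoperimetric]).  The functions
    0 <= f <= 1 vanishing outside Omega with energy K_{p_j} f <= M int f and
    int f >= c then form nonempty convex sets, closed in L^1, and decreasing in j
    because K_p increases as p decreases to 1.  The parallelogram identity makes
    almost minimisers of the L^2 norm converge to a common element f
    ([nested_convex]); this takes the place of a compact embedding.  As K_p
    increases to k_1, monotone convergence gives energy k_1 f <= M int f, which
    is impossible for M < h_s(Omega) by the coarea formula.

    Upper bound.  A nonnegative test function phi is Hoelder continuous of
    exponent s, with some constant B, so [phi]^p <= B^(p - 1) energy k_1 phi,
    while int phi^p >= int phi - (p - 1) |Omega|; hence
    limsup lambda_p <= energy k_1 phi / int phi ([lambda1_upper]).  It remains to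
    find, for E inside Omega of finite s-perimeter, test functions with the
    integral of 1_E and an energy exceeding that of 1_E by arbitrarily little
    ([test_approx]).  This uses the Lipschitz boundary: locally Omega is mapped
    into itself by arbitrarily short translations, by a whole ball of them
    ([inward_closure]).  Let eta_i be a Lipschitz partition of unity
    subordinate to such pieces, rho_i a mollifier concentrated near a short
    inward vector, f the indicator of E, and let phi be the sum of the
    convolutions of eta_i f with rho_i.  Its integral is that of f.  Its
    increment of step k exceeds that of f only through the commutators
    f (eta_i(. + k) - eta_i), whose sum over i vanishes, so only their
    oscillation at the small scale of the mollifiers counts
    ([mollified_increment_le]); that one is small by the estimate
    ||f(. + h) - f||_1 <= C |h|^s energy k_1 f ([increment_holder]). *)

Set Implicit Arguments.
Unset Strict Implicit.
Unset Printing Implicit Defensive.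
Import Order.TTheory GRing.Theory Num.Theory.
Import numFieldNormedType.Exports.
Local Open Scope classical_set_scope.
Local Open Scope ring_scope.

(** * Invariance of Lebesgue measure under translations and reflections *)

Section translation1.
Variable R : realType.
Local Notation mR := (measurableTypeR R).
Local Notation leb := (@lebesgue_measure R).

Lemma measurable_addr (h : R) : measurable_fun setT (fun x : mR => x + h : mR).
Proof. exact: (@measurable_funD _ R mR). Qed.

(** A translation maps half-open intervals to intervals of the same length, and
    Lebesgue measure is determined by these. *)
Lemma lebesgue_measure_addr (h : R) (A : set mR) : measurable A ->
  pushforward leb (fun x : mR => x + h : mR) A = leb A.
Proof.
have mh := measurable_addr h.
pose nu := measure_function_pushforward__canonical__measure_function_Measure leb mh.
move=> mA; apply/esym/(@lebesgue_measure_unique R nu) => //= _ [[a b]] _ <-.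
rewrite /pushforward.
rewrite (_ : _ @^-1` _ = [set` `]a - h, b - h]]); last first.
  by apply/seteqP; split => x /=; rewrite !in_itv/= ltrBlDr lerBrDr.
by rewrite /= !lebesgue_measure_itv/= !lte_fin ltrD2r !EFinB /= -!EFinB opprB addrA subrK.
Qed.

Lemma integral_addr (f : mR -> \bar R) (h : R) : measurable_fun setT f ->
  (forall x, 0 <= f x)%E ->
  (\int[leb]_x f (x + h)%R = \int[leb]_x f x)%E.
Proof.
move=> mf f0.
rewrite -[LHS](@ge0_integral_pushforward _ _ mR mR R _ (measurable_addr h) leb setT f) //.
apply: eq_measure_integral => [|mh A mA _]; first exact: measurable_addr.
exact: lebesgue_measure_addr.
Qed.

Lemma measurable_oppr : measurable_fun setT (-%R : mR -> mR).
Proof. exact: (@measurableT_comp _ _ _ _ _ _ (-%R : R -> R) _ id). Qed.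

Lemma integral_oppr (f : mR -> \bar R) : measurable_fun setT f ->
  (forall x, 0 <= f x)%E ->
  (\int[leb]_x f (- x)%R = \int[leb]_x f x)%E.
Proof.
move=> mf f0.
rewrite -[LHS](@ge0_integral_pushforward _ _ mR mR R _ measurable_oppr leb setT f) //.
apply: eq_measure_integral => A mA _; exact: lebesgue_measureN.
Qed.
End translation1.

Section translation_tuple.
Variable R : realType.
Local Notation mR := (measurableTypeR R).

Lemma integral_mcons (n : nat) (m : {sigma_finite_measure set (n.-tuple mR) -> \bar R})
  (f : n.+1.-tuple mR -> \bar R) : measurable_fun setT f -> (forall x, 0 <= f x)%E ->
  (\int[mcons m]_t f t = \int[@lebesgue_measure R]_x \int[m]_t f (tcons (x, t)))%E.
Proof.
move=> mf f0.
rewrite [LHS](@ge0_integral_pushforward _ _ _ _ R _ (@measurable_tcons R n) _ setT f) //.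
rewrite (@fubini_tonelli1 _ _ _ _ R (@lebesgue_measure R) m (f \o @tcons R n)) //.
  by apply: measurableT_comp => //; exact: measurable_tcons.
by move=> x; exact: f0.
Qed.

(** Translations and the reflection of the line are handled together: all that
    matters is the invariance of nonnegative integrals, which then passes to
    coordinatewise maps of R^N. *)
Definition integral_preserving (phi : mR -> mR) :=
  measurable_fun setT phi /\
  forall f : mR -> \bar R, measurable_fun setT f -> (forall x, 0 <= f x)%E ->
    (\int[@lebesgue_measure R]_x f (phi x) = \int[@lebesgue_measure R]_x f x)%E.

Definition tmap (n : nat) (phi : 'I_n -> mR -> mR) (t : n.-tuple mR) : n.-tuple mR :=
  [tuple phi i (tnth t i) | i < n].

Lemma measurable_tmap n (phi : 'I_n -> mR -> mR) :
  (forall i, integral_preserving (phi i)) -> measurable_fun setT (tmap phi).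
Proof.
move=> mphi; apply/measurable_fun_tnthP => i.
rewrite (_ : _ \o _ = phi i \o (fun t : n.-tuple mR => tnth t i)).
  apply: measurableT_comp; first by have [] := mphi i.
  exact: measurable_tnth.
by apply/funext => x /=; rewrite tnth_mktuple.
Qed.

(** Induction on the dimension: Tonelli peels off one coordinate. *)
Lemma integral_tmap n (phi : 'I_n -> mR -> mR) (f : n.-tuple mR -> \bar R) :
  (forall i, integral_preserving (phi i)) ->
  measurable_fun setT f -> (forall x, 0 <= f x)%E ->
  (\int[lebesgue_tuple R n]_t f (tmap phi t) = \int[lebesgue_tuple R n]_t f t)%E.
Proof.
elim: n phi f => [|n IHn] phi f pphi mf f0.
  by apply: eq_integral => t _; congr f; rewrite [LHS]tuple0 [RHS]tuple0.
rewrite /= !integral_mcons//; last first.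
  by apply: measurableT_comp => //; exact: measurable_tmap.
have mfc : measurable_fun setT (f \o @tcons R n).
  by apply: measurableT_comp => //; exact: measurable_tcons.
pose F (x : mR) := (\int[lebesgue_tuple R n]_t f (tcons (x, t)))%E.
transitivity (\int[@lebesgue_measure R]_x F (phi ord0 x))%E; last first.
  have [_ ->]// := pphi ord0.
    apply: (@measurable_fun_fubini_tonelli_F _ _ _ _ R (lebesgue_tuple R n) (f \o @tcons R n)) => //.
    by move=> x; exact: f0.
  by move=> x; apply: integral_ge0.
apply: eq_integral => x _.
rewrite /F -(IHn (fun i => phi (lift ord0 i)) (fun t => f (tcons (phi ord0 x, t)))) //.
  apply: eq_integral => t _; congr f; apply/eq_from_tnth => i.
  rewrite tnth_mktuple; case: (unliftP ord0 i) => [j ->|->]; rewrite ?tnth0 ?tnthS//.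
  by rewrite tnth_mktuple.
apply: (@measurableT_comp _ _ _ _ _ _ (f \o @tcons R n) _ (fun t : n.-tuple mR => (phi ord0 x : mR, t))) => //.
exact: pair1_measurable.
Qed.
End translation_tuple.

Section rV.
Variables (R : realType) (N : nat).
Local Notation mR := (measurableTypeR R).
Local Notation mu := (@lebesgue_rV R N).
Local Notation V := 'rV[R]_N.

Lemma ge0_integral_rV (f : V -> \bar R) : measurable_fun setT f -> (forall x, 0 <= f x)%E ->
  (\int[mu]_x f x = \int[lebesgue_tuple R N]_t f (rV_of_tuple t))%E.
Proof.
move=> mf f0.
by rewrite [LHS](@ge0_integral_pushforward _ _ _ _ R _ (@measurable_rV_of_tuple R N) _ setT f).
Qed.

Lemma measurable_coord i : measurable_fun setT (fun x : V => x ord0 i).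
Proof. by apply: rV_continuous_measurable; exact: coord_continuous. Qed.

Lemma measurable_fun_rVP d (T : measurableType d) (f : T -> V) :
  (forall i, measurable_fun setT (fun t => f t ord0 i)) <-> measurable_fun setT f.
Proof.
split=> [mf|mf i]; last exact: (measurableT_comp (measurable_coord i) mf).
rewrite (_ : f = @rV_of_tuple R N \o (@tuple_of_rV R N \o f)).
  apply: measurableT_comp; first exact: measurable_rV_of_tuple.
  apply/measurable_fun_tnthP => i; apply: (eq_measurable_fun (fun t => f t ord0 i)) => //.
  by move=> t _; rewrite /= tnth_mktuple.
by apply/funext => t /=; apply/rowP => i; rewrite mxE tnth_mktuple.
Qed.

Lemma measurable_rV_add d (T : measurableType d) (f g : T -> V) :
  measurable_fun setT f -> measurable_fun setT g ->
  measurable_fun setT (fun t => f t + g t).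
Proof.
move=> /measurable_fun_rVP mf /measurable_fun_rVP mg; apply/measurable_fun_rVP => i.
rewrite (_ : (fun _ => _) = (fun t => f t ord0 i) \+ (fun t => g t ord0 i)).
  exact: (measurable_funD (mf i) (mg i)).
by apply/funext => t; rewrite mxE.
Qed.

Lemma measurable_rV_opp d (T : measurableType d) (f : T -> V) :
  measurable_fun setT f -> measurable_fun setT (fun t => - f t).
Proof.
move=> /measurable_fun_rVP mf; apply/measurable_fun_rVP => i.
rewrite (_ : (fun _ => _) = (-%R : R -> R) \o (fun t => f t ord0 i)).
  exact: measurableT_comp.
by apply/funext => t /=; rewrite mxE.
Qed.

Lemma ge0_integral_coordwise (phi : 'I_N -> mR -> mR) (Phi : V -> V) (f : V -> \bar R) :
  (forall i, integral_preserving (phi i)) ->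
  (forall x i, Phi x ord0 i = phi i (x ord0 i)) -> measurable_fun setT Phi ->
  measurable_fun setT f -> (forall x, 0 <= f x)%E ->
  (\int[mu]_x f (Phi x) = \int[mu]_x f x)%E.
Proof.
move=> pphi PhiE mPhi mf f0.
rewrite !ge0_integral_rV//; last exact: (measurableT_comp mf mPhi).
rewrite -(integral_tmap (f := f \o @rV_of_tuple R N) pphi) //; last first.
- by move=> t; exact: f0.
- exact: (measurableT_comp mf (@measurable_rV_of_tuple R N)).
apply: eq_integral => t _; congr f; apply/rowP => i.
by rewrite PhiE !mxE tnth_mktuple.
Qed.

Lemma ge0_integral_shift (h : V) (f : V -> \bar R) :
  measurable_fun setT f -> (forall x, 0 <= f x)%E ->
  (\int[mu]_x f (x + h)%R = \int[mu]_x f x)%E.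
Proof.
apply: (ge0_integral_coordwise (phi := fun i x => x + h ord0 i)) => [i|x i|].
- by split; [exact: measurable_addr|move=> g mg g0; exact: integral_addr].
- by rewrite mxE.
- exact: measurable_rV_add.
Qed.

Lemma ge0_integral_reflect (h : V) (f : V -> \bar R) :
  measurable_fun setT f -> (forall x, 0 <= f x)%E ->
  (\int[mu]_x f (h - x)%R = \int[mu]_x f x)%E.
Proof.
move=> mf f0; rewrite -[RHS](ge0_integral_shift h)//.
rewrite -[RHS](ge0_integral_coordwise (phi := fun=> -%R) (Phi := -%R))//.
- by apply: eq_integral => x _; rewrite addrC.
- by move=> i; split; [exact: measurable_oppr|move=> g mg g0; exact: integral_oppr].
- by move=> x i; rewrite mxE.
- exact: measurable_rV_opp.
- by apply: (measurableT_comp mf); exact: measurable_rV_add.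
Qed.
End rV.

Section le_int.
Context d (T : measurableType d) (R : realType) (m : {measure set T -> \bar R}).
Import HBNNSimple.

(** The integral of a nonnegative function is a supremum over the simple functions
    below it, which is monotone for arbitrary functions. *)
Lemma le_int (f g : T -> \bar R) : (forall x, 0 <= f x)%E -> (forall x, f x <= g x)%E ->
  (\int[m]_x f x <= \int[m]_x g x)%E.
Proof.
move=> f0 fg; rewrite !ge0_integralTE//; last by move=> x; exact: le_trans (fg x).
apply: ereal_sup_le => _ [h hf <-].
by exists h => // x; exact: le_trans (fg x).
Qed.
End le_int.

(** * Energies and the coarea formula *)

Section energy.
Variables (R : realType) (N : nat).
Local Notation mR := (measurableTypeR R).
Local Notation mu := (@lebesgue_rV R N).
Local Notation V := 'rV[R]_N.
Implicit Types (u v f : V -> R) (K : V -> R).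
Local Open Scope ereal_scope.

(** The change of variable x = y + k in a double integral; it turns the
    Gagliardo double integrals into integrals over the step k of increments. *)
Lemma integral_doubleE (G : V * V -> \bar R) :
  measurable_fun setT G -> (forall z, 0 <= G z) ->
  \int[mu]_y \int[mu]_x G (x, y) = \int[mu]_k \int[mu]_y G ((y + k)%R, y).
Proof.
move=> mG G0.
have mS : measurable_fun setT (fun z : V * V => ((z.1 + z.2)%R, z.1)).
  by apply: measurable_fun_pair => //; apply: measurable_rV_add.
rewrite -(fubini_tonelli (fun z : V * V => G ((z.1 + z.2)%R, z.1))) //=; last first.
  exact: (measurableT_comp mG mS).
apply: eq_integral => y _.
rewrite -(ge0_integral_shift y (f := fun x => G (x, y)))//.
  by apply: eq_integral => x _; rewrite addrC.
exact: (measurableT_comp mG (measurable_fun_pair (@measurable_id _ _ _) (measurable_cst _))).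
Qed.

Definition increment f (k : V) : \bar R := \int[mu]_y (`|f (y + k) - f y|)%:E.

Definition energy K f : \bar R := \int[mu]_k ((K k)%:E * increment f k).

Lemma increment_ge0 f k : 0 <= increment f k.
Proof. by apply: integral_ge0 => y _; rewrite lee_fin. Qed.

Lemma measurable_translate d (T : measurableType d) f (g h : T -> V) :
  measurable_fun setT f -> measurable_fun setT g -> measurable_fun setT h ->
  measurable_fun setT (fun t => f (g t + h t)%R).
Proof. by move=> mf mg mh; exact: (measurableT_comp mf (measurable_rV_add mg mh)). Qed.

Lemma measurable_increment f : measurable_fun setT f ->
  measurable_fun setT (increment f).
Proof.
move=> mf.
apply: (@measurable_fun_fubini_tonelli_F _ _ _ _ R mu
  (fun z : V * V => (`|f (z.2 + z.1) - f z.2|)%:E)) => [|z]; last by rewrite lee_fin.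
apply/measurable_EFinP; apply: measurableT_comp => //.
apply: measurable_funB; first exact: measurable_translate.
exact: (measurableT_comp mf).
Qed.

Lemma energy_ge0 K f : (forall k, (0 <= K k)%R) -> 0 <= energy K f.
Proof.
move=> K0; apply: integral_ge0 => k _; apply: mule_ge0; first by rewrite lee_fin.
exact: increment_ge0.
Qed.

Lemma le_energy K K' f : (forall k, (0 <= K k)%R) -> (forall k, (K k <= K' k)%R) ->
  energy K f <= energy K' f.
Proof.
move=> K0 KK'; apply: le_int => k; first by rewrite mule_ge0 ?lee_fin ?increment_ge0.
by rewrite lee_wpmul2r ?increment_ge0 ?lee_fin.
Qed.

(** The indicator of the levels 0 <= t < a; its integral over t is a, and that
    of |layer a t - layer b t| is |a - b|. *)
Let layer (a t : R) : R := \1_(`[0%R, a[%classic) t.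

Lemma integral_layer (a : R) : (0 <= a)%R ->
  \int[@lebesgue_measure R]_t (layer a t)%:E = a%:E.
Proof.
move=> a0; rewrite /layer integral_indic// setIT.
have := lebesgue_measure_itv `[0%R, a[; rewrite /= lte_fin => ->.
by case: ltP => [|a0']; rewrite ?oppr0 ?adde0//; apply/eqP; rewrite eqe eq_le a0 a0'.
Qed.

Lemma integral_layerB (a b : R) : (0 <= a)%R -> (0 <= b)%R ->
  \int[@lebesgue_measure R]_t (`|layer a t - layer b t|)%:E = (`|a - b|)%:E.
Proof.
wlog ab : a b / (b <= a)%R => [hw|] a0 b0.
  have [ba|/ltW ab] := leP b a; first exact: hw.
  by rewrite distrC -hw//; apply: eq_integral => t _; rewrite distrC.
transitivity (\int[@lebesgue_measure R]_t (\1_(`[b, a[%classic) t)%:E).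
  apply: eq_integral => t _; congr EFin; rewrite /layer !indicE.
  rewrite !mem_setE !in_itv/=.
  have [t0|t0] := leP 0%R t; have [tb|tb] := ltP t b; have [ta|ta] := ltP t a;
    rewrite /= ?subrr ?subr0 ?normr0 ?normr1//.
  - by have := lt_le_trans tb ab; rewrite ltNge ta.
  - by have := lt_le_trans t0 (le_trans b0 tb); rewrite ltxx.
rewrite integral_indic// setIT ger0_norm ?subr_ge0//.
have := lebesgue_measure_itv `[b, a[; rewrite /= lte_fin => ->.
case: ltP => [_|ba]; first by rewrite EFinB.
by apply/eqP; rewrite eqe; apply/eqP; lra.
Qed.

Lemma measurable_layer v : measurable_fun setT v ->
  measurable_fun setT (fun z : mR * V => layer (v z.2) z.1).
Proof.
move=> mv.
rewrite (_ : (fun _ => _) = \1_[set z : mR * V | (0 <= z.1 :> R)%R && (z.1 < v z.2)%R]); last first.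
  by apply/funext => z; rewrite /layer !indicE !mem_setE !in_itv.
apply: measurable_indic.
rewrite [X in measurable X](_ : _ = ((fun z : mR * V => (0 <= z.1 :> R)%R) @^-1` [set true]) `&`
  ((fun z : mR * V => (z.1 < v z.2 :> R)%R) @^-1` [set true])); last first.
  by apply/seteqP; split => [z /= /andP[-> ->]|z /= [-> ->]].
have m1 : measurable_fun setT (fun z : mR * V => z.1 : R) by exact: measurable_fst.
have m2 : measurable_fun setT (fun z : mR * V => v z.2).
  exact: (measurableT_comp mv).
apply: measurableI; rewrite -[X in measurable X]setTI.
  exact: (measurable_fun_ler (measurable_cst _) m1).
exact: (measurable_fun_ltr m1 m2).
Qed.

(** Both sides are integrals over the level t of the same quantities for the
    superlevel sets of v: indeed v(y) and |v(y + k) - v(y)| are integrals of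
    layers, and Tonelli exchanges t with y and k.  Superlevel sets lie inside Om
    because v vanishes outside. *)
Lemma coarea (M : R) K v (Om : set V) : (0 <= M)%R ->
  (forall k, (0 <= K k)%R) -> measurable_fun setT K ->
  measurable_fun setT v -> (forall x, (0 <= v x)%R) -> (forall x, ~ Om x -> v x = 0%R) ->
  (forall E, measurable E -> E `<=` Om -> M%:E * mu E <= energy K \1_E) ->
  M%:E * \int[mu]_x (v x)%:E <= energy K v.
Proof.
move=> M0 K0 mK mv v0 vOm HM.
have mL := measurable_layer mv.
(* Empty for t < 0, so that the levels range over the whole line. *)
pose E (t : R) := [set y | (0 <= t < v y)%R].
have EE t : \1_(E t) = (fun y => layer (v y) t) :> (V -> R).
  by apply/funext => y; rewrite /layer !indicE !mem_setE /= in_itv.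
have mE t : measurable (E t).
  have := measurableT_comp mL (pair1_measurable (t : mR)).
  move/(_ measurableT [set 1%R]); rewrite setTI; move/(_ (measurable_set1 _)).
  congr measurable; apply/seteqP; split => y /=; rewrite /layer indicE mem_setE /= in_itv/=.
    have [//|_ /eqP] := boolP (0 <= t < v y)%R.
    by rewrite eq_sym oner_eq0.
  by rewrite /E /= => ->.
have EOm t : E t `<=` Om.
  move=> y /= /andP[t0 ty]; apply: contrapT => /vOm vy.
  by move: (le_lt_trans t0 ty); rewrite vy ltxx.
have mLd : measurable_fun setT (fun z : (mR * V) * V => (`|layer (v (z.2 + z.1.2)%R) z.1.1 - layer (v z.2) z.1.1|)%:E).
  apply/measurable_EFinP; apply: measurableT_comp => //.
  have mt : measurable_fun setT (fun z : (mR * V) * V => z.1.1).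
    exact: (measurableT_comp (@measurable_fst _ _ mR V)).
  have mk : measurable_fun setT (fun z : (mR * V) * V => z.1.2).
    exact: (measurableT_comp (@measurable_snd _ _ mR V)).
  have my : measurable_fun setT (fun z : (mR * V) * V => z.2) by exact: measurable_snd.
  apply: measurable_funB.
    exact: (measurableT_comp mL (measurable_fun_pair mt (measurable_rV_add my mk))).
  exact: (measurableT_comp mL (measurable_fun_pair mt my)).
have mI := @measurable_fun_fubini_tonelli_F _ _ _ _ R mu _ mLd (fun z => ltac:(by rewrite lee_fin)).
have -> : energy K v = \int[@lebesgue_measure R]_t energy K \1_(E t).
  rewrite /energy.
  rewrite (fubini_tonelli (fun z : mR * V => (K z.2)%:E * increment \1_(E z.1) z.2)) /=; last first.
  - by move=> z; rewrite mule_ge0 ?lee_fin ?increment_ge0.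
  - apply: emeasurable_funM.
      by apply/measurable_EFinP; exact: (measurableT_comp mK).
    apply: eq_measurable_fun mI => z _; apply: eq_integral => y _.
    by rewrite /= !EE.
  apply: eq_integral => k _.
  have mk := measurableT_comp mI (pair2_measurable (k : V)).
  have {}mk : measurable_fun setT (fun t : mR => increment \1_(E t) k).
    apply: eq_measurable_fun mk => t _; apply: eq_integral => y _.
    by rewrite /= !EE.
  rewrite ge0_integralZl//; last 2 first.
  - by move=> t _; exact: increment_ge0.
  - by rewrite lee_fin.
  congr (_ * _); rewrite /increment.
  transitivity (\int[mu]_y \int[@lebesgue_measure R]_t
      (`|layer (v (y + k)%R) t - layer (v y) t|)%:E).
    by apply: eq_integral => y _; rewrite integral_layerB.
  have mp : measurable_fun setT (fun z : mR * V => ((z.1, k), z.2)).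
    by apply: measurable_fun_pair => //; apply: measurable_fun_pair.
  rewrite -(fubini_tonelli (fun z : mR * V =>
     (`|layer (v (z.2 + k)%R) z.1 - layer (v z.2) z.1|)%:E)) /=; last first.
  - by move=> z; rewrite lee_fin.
  - exact: (measurableT_comp mLd mp).
  by apply: eq_integral => t _; apply: eq_integral => y _; rewrite !EE.
have -> : M%:E * \int[mu]_x (v x)%:E = \int[@lebesgue_measure R]_t (M%:E * mu (E t)).
  have L0 (z : mR * V) : 0 <= (layer (v z.2) z.1)%:E by rewrite lee_fin /layer indicE.
  have mLE : measurable_fun setT (fun z : mR * V => (layer (v z.2) z.1)%:E).
    exact/measurable_EFinP.
  have muE t : mu (E t) = \int[mu]_y (layer (v y) t)%:E.
    by rewrite -[E t]setIT -integral_indic// EE.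
  rewrite ge0_integralZl//.
  - congr (_ * _).
    transitivity (\int[mu]_y \int[@lebesgue_measure R]_t (layer (v y) t)%:E).
      by apply: eq_integral => y _; rewrite integral_layer.
    rewrite -(fubini_tonelli (fun z : mR * V => (layer (v z.2) z.1)%:E))//=.
    by apply: eq_integral => t _; rewrite muE.
  - under eq_fun do rewrite muE.
    exact: (@measurable_fun_fubini_tonelli_F _ _ _ _ R mu (fun z : mR * V => (layer (v z.2) z.1)%:E)).
apply: le_int => t; first by rewrite mule_ge0.
exact: HM.
Qed.
End energy.

(** * The truncated kernel *)

Section young.
Variable R : realType.
Implicit Types a b k p : R.

(** By convexity the graph of t^p lies above its tangent at a; the proof goes
    through the inequality of Young for b and a^(p-1). *)
Lemma powR_tangent a b p : 0 <= a -> 0 <= b -> 1 < p ->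
  a `^ p - b `^ p <= p * (a `^ (p - 1) * (a - b)).
Proof.
move=> a0 b0 p1.
have p0 : 0 < p by lra.
have q0 : 0 < p / (p - 1) by rewrite divr_gt0//; lra.
have pn0 : p != 0 by rewrite gt_eqF.
have p1n0 : p - 1 != 0 by rewrite subr_eq0 gt_eqF.
have := @conjugate_powR _ b (a `^ (p - 1)) p (p / (p - 1)) b0 (powR_ge0 _ _) p0 q0.
have -> : p^-1 + (p / (p - 1))^-1 = 1 by field; rewrite ?p1n0 ?pn0.
move=> /(_ erefl); rewrite -powRrM.
have -> : (p - 1) * (p / (p - 1)) = p by field; rewrite ?p1n0 ?pn0.
move=> h; have : p * (b * a `^ (p - 1)) <= p * (b `^ p / p + a `^ p / (p / (p - 1))).
  by rewrite ler_pM2l.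
have -> : p * (b `^ p / p + a `^ p / (p / (p - 1))) = b `^ p + (p - 1) * a `^ p.
  by field; rewrite ?p1n0 ?pn0.
have <- : a * a `^ (p - 1) = a `^ p by rewrite mulr_powRB1//.
move=> H; lra.
Qed.

(** The tangent inequality bounds a^p - b^p by p a^(p-1) (a - b); splitting the
    weight k^(1/p) m^(1-1/p), where m = min(1, k), between the factors a - b and
    a^(p-1), Young with exponents p and p/(p-1) separates them.  The first factor
    gets k with the constant 1, the second one gets m with the small constant
    p - 1. *)
Lemma powR_young a b k p : 0 <= a -> 0 <= b -> 0 <= k -> 1 < p ->
  k `^ p^-1 * Num.min 1 k `^ (1 - p^-1) * `|a `^ p - b `^ p| <=
  `|a - b| `^ p * k + (p - 1) * (a `^ p + b `^ p) * Num.min 1 k.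
Proof.
move=> a0 b0 k0 p1.
have p0 : 0 < p by lra.
wlog ba : a b a0 b0 / b <= a => [hw|].
  have [ba|/ltW ab] := leP b a; first exact: hw.
  by rewrite distrC (distrC a b) (addrC (a `^ p)); exact: hw.
have m0 : 0 <= Num.min 1 k by rewrite le_min ler01.
set m := Num.min 1 k in m0 *.
have q0 : 0 < p / (p - 1) by rewrite divr_gt0//; lra.
have pn0 : p != 0 by rewrite gt_eqF.
have p1n0 : p - 1 != 0 by rewrite subr_eq0 gt_eqF.
have ab0 : 0 <= a - b by rewrite subr_ge0.
rewrite (ger0_norm ab0) ger0_norm; last first.
  by rewrite subr_ge0 ge0_ler_powR// ltW.
have := @conjugate_powR _ (k `^ p^-1 * (a - b)) (m `^ (1 - p^-1) * a `^ (p - 1)) p (p / (p - 1)).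
rewrite !mulr_ge0 ?powR_ge0// => /(_ isT isT p0 q0).
have -> : p^-1 + (p / (p - 1))^-1 = 1 by field; rewrite ?p1n0 ?pn0.
move=> /(_ erefl).
rewrite !powRM ?powR_ge0// -!powRrM mulVf// powRr1//.
have -> : (1 - p^-1) * (p / (p - 1)) = 1 by field; rewrite ?p1n0 ?pn0.
have -> : (p - 1) * (p / (p - 1)) = p by field; rewrite ?p1n0 ?pn0.
rewrite powRr1// => h.
have t := powR_tangent a0 b0 p1.
have c0 : 0 <= k `^ p^-1 * m `^ (1 - p^-1) by rewrite mulr_ge0 ?powR_ge0.
have h2 := ler_wpM2l c0 t.
apply: (le_trans h2).
have h3 : p * (k `^ p^-1 * (a - b) * (m `^ (1 - p^-1) * a `^ (p - 1))) <=
  p * (k * (a - b) `^ p / p + m * a `^ p / (p / (p - 1))) by rewrite ler_pM2l.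
have E : p * (k * (a - b) `^ p / p + m * a `^ p / (p / (p - 1))) =
  k * (a - b) `^ p + (p - 1) * (m * a `^ p) by field; rewrite ?p1n0 ?pn0.
rewrite E in h3.
have bp : 0 <= (p - 1) * (b `^ p * m) by rewrite !mulr_ge0 ?powR_ge0//; lra.
lra.
Qed.
End young.

Section kernel.
Variables (R : realType) (N : nat).
Local Notation mu := (@lebesgue_rV R N).
Local Notation V := 'rV[R]_N.
Implicit Types (u v f : V -> R) (K : V -> R) (s p : R).

Definition frac_kernel s p (z : V) : R := (enorm z `^ (N%:R + s * p))^-1.

Lemma frac_kernel_ge0 s p z : 0 <= frac_kernel s p z.
Proof. by rewrite invr_ge0 powR_ge0. Qed.

Lemma measurable_enorm : measurable_fun setT (@enorm R N).
Proof.
have mq : measurable_fun setT (fun x : V => \sum_i x ord0 i ^+ 2).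
  by apply: measurable_sum => i; apply: measurable_funX; exact: measurable_coord.
apply: eq_measurable_fun (measurableT_comp (measurable_powR 2^-1) mq) => x _ /=.
by rewrite powR12_sqrt// sumr_ge0// => i _; exact: sqr_ge0.
Qed.

Lemma measurable_frac_kernel s p : measurable_fun setT (frac_kernel s p).
Proof.
rewrite /frac_kernel; under eq_fun do rewrite -powRN.
exact: (measurableT_comp (measurable_powR _) measurable_enorm).
Qed.

Definition pow_energy s p u : \bar R :=
  (\int[mu]_k \int[mu]_y (`|u (y + k)%R - u y| `^ p * frac_kernel s p k)%:E)%E.

(** The p-th power of the seminorm, with the step k = x - y as variable. *)
Lemma gagliardo_poweR s p u : 0 < p -> measurable_fun setT u ->
  (gagliardo s p u `^ p = pow_energy s p u)%E.
Proof.
move=> p0 mu_; rewrite /gagliardo -poweRrM mulVf ?gt_eqF// poweRe1; last first.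
  by apply: integral_ge0 => y _; apply: integral_ge0 => x _;
    rewrite lee_fin mulr_ge0 ?powR_ge0// invr_ge0 powR_ge0.
rewrite (@integral_doubleE R N (fun z => (`|u z.1 - u z.2| `^ p * frac_kernel s p (z.1 - z.2))%:E)) /=.
- apply: eq_integral => k _; apply: eq_integral => y _.
  by rewrite (_ : y + k - y = k)// addrAC subrr add0r.
- apply/measurable_EFinP; apply: measurable_funM.
    apply: (measurableT_comp (measurable_powR _)); apply: measurableT_comp => //.
    by apply: measurable_funB; exact: (measurableT_comp mu_).
  apply: (measurableT_comp (measurable_frac_kernel _ _)).
  by apply: measurable_rV_add => //; exact: measurable_rV_opp.
- by move=> z; rewrite lee_fin mulr_ge0 ?powR_ge0 ?frac_kernel_ge0.
Qed.

Lemma pow_energy1 s u : measurable_fun setT u -> pow_energy s 1 u = energy (frac_kernel s 1) u.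
Proof.
move=> mu_; apply: eq_integral => k _.
rewrite -ge0_integralZl//.
- by apply: eq_integral => y _; rewrite powRr1// mulrC EFinM.
- apply/measurable_EFinP; apply: measurableT_comp => //; apply: measurable_funB => //.
  exact: measurable_translate.
- by rewrite lee_fin frac_kernel_ge0.
Qed.

Lemma s_perimeterE s (E : set V) : measurable E ->
  s_perimeter s E = energy (frac_kernel s 1) \1_E.
Proof.
move=> mE; have mi : measurable_fun setT (\1_E : V -> R) by exact: measurable_indic.
rewrite -pow_energy1// -gagliardo_poweR// poweRe1//.
exact: poweR_ge0.
Qed.

(** Chosen for three properties: it is the weight in [powR_young], it is
    [frac_kernel s 1] for p = 1, and it increases as p decreases to 1. *)
Definition trunc_kernel s p (z : V) : R :=
  frac_kernel s p z `^ p^-1 * Num.min 1 (frac_kernel s p z) `^ (1 - p^-1).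

Lemma trunc_kernel_ge0 s p z : 0 <= trunc_kernel s p z.
Proof. by rewrite mulr_ge0 ?powR_ge0. Qed.

Lemma measurable_trunc_kernel s p : measurable_fun setT (trunc_kernel s p).
Proof.
apply: measurable_funM; apply: (measurableT_comp (measurable_powR _)).
  exact: measurable_frac_kernel.
by apply: measurable_minr => //; exact: measurable_frac_kernel.
Qed.

Lemma measurable_pow_integrand s p u : measurable_fun setT u ->
  measurable_fun setT (fun z : V * V => `|u (z.2 + z.1) - u z.2| `^ p * frac_kernel s p z.1).
Proof.
move=> mu_; apply: measurable_funM.
  apply: (measurableT_comp (measurable_powR _)); apply: measurableT_comp => //.
  apply: measurable_funB; last exact: (measurableT_comp mu_).
  by apply: measurable_translate.
by apply: (measurableT_comp (measurable_frac_kernel _ _)).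
Qed.

(** [powR_young] applied to |u(y + k)| and |u(y)| and integrated over y and k; by
    translation invariance the two p-th powers contribute equally. *)
Lemma energy_powR_le s p u : 1 < p -> measurable_fun setT u ->
  (energy (trunc_kernel s p) (fun x => `|u x| `^ p)%R <=
   pow_energy s p u + (2 * (p - 1))%:E * (\int[mu]_x (`|u x| `^ p)%R%:E) *
     \int[mu]_z (Num.min 1 (frac_kernel s p z))%R%:E)%E.
Proof.
move=> p1 mu_.
have p10 : 0 <= p - 1 by lra.
pose U := (\int[mu]_x (`|u x| `^ p)%R%:E)%E.
pose m (k : V) := Num.min 1 (frac_kernel s p k).
have m0 k : 0 <= m k by rewrite le_min ler01 frac_kernel_ge0.
have mm : measurable_fun setT m.
  by apply: measurable_minr => //; exact: measurable_frac_kernel.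
have U0 : (0 <= U)%E by apply: integral_ge0 => x _; rewrite lee_fin powR_ge0.
have mup : measurable_fun setT (fun x : V => `|u x| `^ p).
  by apply: (measurableT_comp (measurable_powR _)); exact: measurableT_comp.
have mD : measurable_fun setT (fun z : V * V => `|u (z.2 + z.1) - u z.2| `^ p * frac_kernel s p z.1).
  exact: measurable_pow_integrand.
have A0 (z : V * V) : (0 <= (`|u (z.2 + z.1)%R - u z.2| `^ p * frac_kernel s p z.1)%:E)%E.
  by rewrite lee_fin mulr_ge0 ?powR_ge0 ?frac_kernel_ge0.
have B k : (\int[mu]_y ((p - 1) * (`|u (y + k)%R| `^ p + `|u y| `^ p) * m k)%:E =
    (2 * (p - 1))%:E * U * (m k)%:E)%E.
  transitivity (\int[mu]_y (((p - 1) * m k)%:E * ((`|u (y + k)%R| `^ p)%:E + (`|u y| `^ p)%:E)))%E.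
    by apply: eq_integral => y _; rewrite -EFinD -EFinM; congr EFin; ring.
  have mk : measurable_fun setT (fun y : V => (`|u (y + k)| `^ p)%:E).
    by apply/measurable_EFinP; exact: (@measurable_translate R N _ _ (fun x => `|u x| `^ p)).
  have mU : measurable_fun setT (fun y : V => (`|u y| `^ p)%:E) by exact/measurable_EFinP.
  have mS : measurable_fun setT (fun y : V => (`|u (y + k)| `^ p)%:E + (`|u y| `^ p)%:E)%E.
    exact: emeasurable_funD.
  have P0 (r : R) : (0 <= (`|r| `^ p)%:E)%E by rewrite lee_fin powR_ge0.
  have c0 : (0 <= ((p - 1) * m k)%:E)%E by rewrite lee_fin mulr_ge0//; lra.
  rewrite ge0_integralZl//; last by move=> y _; rewrite adde_ge0.
  rewrite ge0_integralD//.
  rewrite (ge0_integral_shift k (f := fun y => (`|u y| `^ p)%:E))// -/U.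
  have -> : (U + U = 2%:E * U)%E by rewrite -mule2n -mule_natl.
  by rewrite muleA -EFinM muleAC -EFinM; congr (_%:E * _)%E; ring.
rewrite /pow_energy.
apply: (@le_trans _ _ (\int[mu]_k (\int[mu]_y
   ((`|u (y + k)%R - u y| `^ p * frac_kernel s p k)%:E +
   ((p - 1) * (`|u (y + k)%R| `^ p + `|u y| `^ p) * m k)%:E)))%E).
  apply: le_int => k.
    by rewrite mule_ge0 ?increment_ge0 ?lee_fin ?trunc_kernel_ge0.
  rewrite -ge0_integralZl//; last 2 first.
  - apply/measurable_EFinP; apply: measurableT_comp => //; apply: measurable_funB => //.
    exact: (@measurable_translate R N _ _ (fun x => `|u x| `^ p)).
  - by rewrite lee_fin trunc_kernel_ge0.
  apply: le_int => y; first by rewrite mule_ge0 ?lee_fin ?trunc_kernel_ge0.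
  rewrite -EFinM -EFinD lee_fin.
  apply: le_trans (powR_young (normr_ge0 _) (normr_ge0 _) (frac_kernel_ge0 _ _ _) p1) _.
  rewrite lerD2r ler_wpM2r ?frac_kernel_ge0// ge0_ler_powR ?nnegrE//; first lra.
  exact: ler_dist_dist.
have mAk k : measurable_fun setT (fun y : V => (`|u (y + k)%R - u y| `^ p * frac_kernel s p k)%:E).
  by apply/measurable_EFinP; exact: (measurableT_comp mD (pair1_measurable (k : V))).
have mBk k : measurable_fun setT (fun y : V => ((p - 1) * (`|u (y + k)%R| `^ p + `|u y| `^ p) * m k)%:E).
  apply/measurable_EFinP; apply: measurable_funM => //; apply: measurable_funM => //.
  by apply: measurable_funD => //; exact: (@measurable_translate R N _ _ (fun x => `|u x| `^ p)).
under eq_integral => k _.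
  rewrite ge0_integralD//; last 2 first.
  - by move=> y _; exact: (A0 (k, y)).
  - by move=> y _; rewrite lee_fin (mulr_ge0 (mulr_ge0 p10 (addr_ge0 (powR_ge0 _ _) (powR_ge0 _ _))) (m0 k)).
  rewrite B; over.
rewrite ge0_integralD//; last 4 first.
- by move=> k _; apply: integral_ge0 => y _; exact: (A0 (k, y)).
- apply: (@measurable_fun_fubini_tonelli_F _ _ _ _ R mu
    (fun z : V * V => (`|u (z.2 + z.1)%R - u z.2| `^ p * frac_kernel s p z.1)%:E)) => //.
  exact/measurable_EFinP.
- by move=> k _; rewrite !mule_ge0 ?lee_fin//; lra.
- by apply: emeasurable_funM => //; exact/measurable_EFinP.
rewrite leeD2l//.
rewrite ge0_integralZl//; [exact/measurable_EFinP|by move=> k _; rewrite lee_fin|].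
by rewrite mule_ge0// lee_fin; lra.
Qed.
End kernel.

(** * Integrable weights bounding the kernels *)

Section weight.
Variables (R : realType) (n : nat).
Local Notation N := n.+1.
Local Notation mu := (@lebesgue_rV R N).
Local Notation V := 'rV[R]_N.
Implicit Types (z : V) (a s p r : R).

Lemma mx_normE (m q : nat) (A : 'M[R]_(m, q)) : `|A| = \big[Num.max/0]_ij `|A ij.1 ij.2|.
Proof. exact: mx_normrE. Qed.

Lemma rV_norm_leP z r : 0 <= r -> reflect (forall i, `|z ord0 i| <= r) (`|z| <= r).
Proof.
move=> r0; rewrite (mx_normE z).
apply: (iffP idP) => [/bigmax_leP[_ h] i|h].
  exact: (h (ord0, i)).
by apply/bigmax_leP; split => // -[i j] _ /=; rewrite (ord1 i).
Qed.

Lemma le_coord_norm z i : `|z ord0 i| <= `|z|.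
Proof. by move: i; apply/rV_norm_leP. Qed.

Lemma norm_le_enorm z : `|z| <= enorm z.
Proof.
apply/rV_norm_leP => [|i]; first exact: sqrtr_ge0.
rewrite -sqrtr_sqr /enorm ler_sqrt; last by apply: sumr_ge0 => j _; exact: sqr_ge0.
by rewrite (bigD1 i)//= lerDl sumr_ge0// => j _; exact: sqr_ge0.
Qed.

Lemma enorm_le_norm z : enorm z <= N%:R * `|z|.
Proof.
have h0 : 0 <= N%:R * `|z| by rewrite mulr_ge0.
rewrite -(ger0_norm h0) -sqrtr_sqr /enorm ler_sqrt ?sqr_ge0//.
apply: (@le_trans _ _ (\sum_(i < N) `|z| ^+ 2)).
  apply: ler_sum => i _; rewrite -[z ord0 i ^+ 2]ger0_norm ?sqr_ge0// normrX.
  by rewrite lerXn2r ?nnegrE//; exact: le_coord_norm.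
rewrite sumr_const card_ord -[X in X <= _]mulr_natl exprMn ler_wpM2r ?sqr_ge0//.
by rewrite expr2 ler_peMl// ler1n.
Qed.

Lemma measurable_norm_rV : measurable_fun setT (fun z : V => `|z|).
Proof. by apply: rV_continuous_measurable; exact: norm_continuous. Qed.

Lemma measurable_norm_le r : measurable [set z : V | `|z| <= r].
Proof.
rewrite -[X in measurable X]setTI.
exact: (measurable_fun_ler measurable_norm_rV (measurable_cst r) measurableT (Y := [set true])).
Qed.

Lemma mu_norm_le r : 0 <= r -> mu [set z : V | `|z| <= r] = ((2 * r) ^+ N)%:E.
Proof.
move=> r0.
rewrite (_ : [set _ | _] = [set z : V | forall i, (fun=> `[- r, r]%classic) i (z ord0 i)]); last first.
  apply/seteqP; split => z /=.
    by move/(rV_norm_leP _ r0) => h i; rewrite in_itv/= -ler_norml.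
  by move=> h; apply/(rV_norm_leP _ r0) => i; have := h i; rewrite in_itv/= -ler_norml.
have := @lebesgue_rV_box R N (fun=> `[- r, r]%classic) (fun=> measurable_itv _).
rewrite /= => ->.
have -> : @lebesgue_measure R `[(- r)%R, r]%classic = (2 * r)%:E.
  have := lebesgue_measure_itv `[(- r)%R, r]; rewrite /= => ->.
  rewrite lte_fin; case: ltP => [_|rr]; first by rewrite -EFinB; congr EFin; ring.
  congr EFin; lra.
by rewrite prodEFin prodr_const card_ord.
Qed.

(** Expressed with the sup norm, whose balls are boxes of known measure.  For
    0 < s < a it is integrable: near 0 it is |z|^(a-s-N), far away |z|^(-N-s). *)
Definition weight a s z : R := Num.min 1 `|z| `^ a / `|z| `^ (N%:R + s).

Lemma weight_ge0 a s z : 0 <= weight a s z.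
Proof. by rewrite divr_ge0 ?powR_ge0. Qed.

Lemma measurable_weight a s : measurable_fun setT (weight a s).
Proof.
rewrite /weight; under eq_fun do rewrite -powRN.
apply: measurable_funM; apply: (measurableT_comp (measurable_powR _)).
  by apply: measurable_minr => //; exact: measurable_norm_rV.
exact: measurable_norm_rV.
Qed.

Lemma frac_kernel_le s z : 0 < s -> frac_kernel s 1 z <= (`|z| `^ (N%:R + s))^-1.
Proof.
move=> s0; rewrite /frac_kernel mulr1.
have Ns : 0 < N%:R + s by rewrite addr_gt0.
have [->|z0] := eqVneq z 0.
  have -> : @enorm R N 0 = 0.
    apply/eqP; rewrite eq_le sqrtr_ge0 andbT (le_trans (enorm_le_norm _))//.
    by rewrite normr0 mulr0.
  by rewrite normr0.
have z1 : 0 < `|z| by rewrite normr_gt0.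
rewrite lef_pV2 ?posrE ?powR_gt0//; last exact: lt_le_trans (norm_le_enorm z).
by rewrite ge0_ler_powR ?nnegrE ?norm_le_enorm ?sqrtr_ge0 ?(ltW Ns).
Qed.

(** A bound uniform in p: as soon as |z| >= 1 the kernel decreases in p, and for
    |z| <= 1 the weight is at least 1. *)
Lemma min_frac_kernel_le a s p z : 0 < s -> 1 <= p -> 0 <= a <= N%:R + s ->
  Num.min 1 (frac_kernel s p z) <= weight a s z.
Proof.
move=> s0 p1 /andP[a0 aNs].
have Ns : 0 < N%:R + s by rewrite addr_gt0.
have Nsp : 0 < N%:R + s * p by rewrite addr_gt0// mulr_gt0//; lra.
have [->|z0] := eqVneq z 0.
  rewrite /weight /frac_kernel normr0 powR0 ?gt_eqF// invr0 mulr0.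
  have -> : @enorm R N 0 = 0.
    apply/eqP; rewrite eq_le sqrtr_ge0 andbT (le_trans (enorm_le_norm _))//.
    by rewrite normr0 mulr0.
  by rewrite powR0 ?gt_eqF// invr0 ge_min lexx orbT.
have z1 : 0 < `|z| by rewrite normr_gt0.
rewrite /weight; have [zle|zge] := leP `|z| 1.
  rewrite ge_min -powRB; last by rewrite (gt_eqF z1) implybT.
  apply/orP; left; rewrite -[X in X <= _](powRr0 `|z|) ger_powR ?z1//; lra.
rewrite powR1 mul1r ge_min; apply/orP; right.
rewrite /frac_kernel lef_pV2 ?posrE ?powR_gt0//; last exact: lt_le_trans (norm_le_enorm z).
apply: (@le_trans _ _ (`|z| `^ (N%:R + s * p))).
  by rewrite ler_powR ?(ltW zge)// lerD2l ler_peMr// ltW.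
by rewrite ge0_ler_powR ?nnegrE ?norm_le_enorm ?sqrtr_ge0 ?(ltW Nsp).
Qed.

Lemma nneseries_geometric (C q : R) : 0 <= C -> 0 < q < 1 ->
  (\sum_(0 <= j <oo) (C * q ^+ j)%:E < +oo)%E.
Proof.
move=> C0 /andP[q0 q1].
apply: (@le_lt_trans _ _ (C * (1 - q)^-1)%:E); last exact: ltry.
apply: lime_le.
  by apply: is_cvg_nneseries => j _ _; rewrite lee_fin mulr_ge0// exprn_ge0// ltW.
apply: nearW => k; rewrite sumEFin lee_fin.
have := @geometric_le_lim R k C q C0 q0; rewrite (ger0_norm (ltW q0)) => /(_ q1).
by rewrite /series /=.
Qed.

Lemma integral_dyadic (c r : nat -> R) : (forall j, 0 <= c j) -> (forall j, 0 <= r j) ->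
  (\int[mu]_z \sum_(0 <= j <oo) (c j * \1_[set x : V | (`|x| <= r j)%R] z)%:E =
   \sum_(0 <= j <oo) (c j * (2 * r j) ^+ N)%:E)%E.
Proof.
move=> c0 r0; rewrite integral_nneseries//; last 2 first.
- move=> j; apply/measurable_EFinP; apply: measurable_funM => //.
  by apply: measurable_indic; exact: measurable_norm_le.
- by move=> j z _; rewrite lee_fin mulr_ge0// indicE.
apply: eq_eseriesr => j _; under eq_integral do rewrite EFinM.
have mj := measurable_norm_le (r j).
have mI : measurable_fun setT (fun z : V => (\1_[set x : V | (`|x| <= r j)%R] z : R)%:E).
  by apply/measurable_EFinP; exact: measurable_indic.
have c0j : (0 <= (c j)%:E)%E by rewrite lee_fin.
rewrite ge0_integralZl//.
by rewrite integral_indic// setIT EFinM -mu_norm_le.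
Qed.

Lemma pow2D x y : (2 : R) `^ (x + y) = 2 `^ x * 2 `^ y.
Proof. by rewrite powRD// pnatr_eq0 implybT. Qed.

Lemma le_nneseries_term (u : nat -> \bar R) j : (forall i, 0 <= u i)%E ->
  (u j <= \sum_(0 <= i <oo) u i)%E.
Proof.
move=> u0; apply: le_trans (nneseries_lim_ge j.+1 _); last by move=> *; exact: u0.
by rewrite big_nat_recr//= leeDr// sume_ge0.
Qed.

(** Dyadic decomposition: the weight is bounded by a combination of indicators of
    the boxes of radius 2^-j and 2^(j+1), whose integrals form geometric series of
    ratio 2^(s-a) and 2^-s. *)
Lemma integral_weight_lty a s : 0 < s < a -> a <= 1 -> (\int[mu]_z (weight a s z)%:E < +oo)%E.
Proof.
move=> /andP[s0 sa] a1.
pose a' := a - s.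
have a'0 : 0 < a' by rewrite /a'; lra.
(* c j and d j bound the weight on the shells 2^-(j+1) < |z| <= 2^-j and
   2^j < |z| <= 2^(j+1), contained in the boxes of radius r j and t j. *)
pose c j := (2 : R) `^ (j.+1%:R * (N%:R - a')).
pose r j := (2 : R) `^ (- j%:R).
pose d j := (2 : R) `^ (- (j%:R * (N%:R + s))).
pose t j := (2 : R) `^ (j.+1%:R).
have P0 x : 0 < (2 : R) `^ x by rewrite powR_gt0.
have c0 j : 0 <= c j by exact: powR_ge0.
have d0 j : 0 <= d j by exact: powR_ge0.
have r0 j : 0 <= r j by exact: powR_ge0.
have t0 j : 0 <= t j by exact: powR_ge0.
have P1 x : 0 < x -> 1 < (2 : R) `^ x.
  move=> x0; rewrite -[X in X < _](_ : (1 : R) `^ x = 1); last by rewrite powR1.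
  by rewrite gt0_ltr_powR ?nnegrE// ltr1n.
have NaE : 0 < N%:R - a' by rewrite /a' -natr1; have := ler0n R n; lra.
have xN x : ((2 : R) `^ x) ^+ N = 2 `^ (x * N%:R) by rewrite powRrM powR_mulrn// ltW.
apply: (@le_lt_trans _ _ (\int[mu]_z ((\sum_(0 <= j <oo) (c j * \1_[set x : V | (`|x| <= r j)%R] z)%:E) +
  \sum_(0 <= j <oo) (d j * \1_[set x : V | (`|x| <= t j)%R] z)%:E))%E).
  apply: le_int => z; first by rewrite lee_fin weight_ge0.
  have S1 j : (0 <= (c j * \1_[set x : V | (`|x| <= r j)%R] z)%:E)%E.
    by rewrite lee_fin mulr_ge0// indicE.
  have S2 j : (0 <= (d j * \1_[set x : V | (`|x| <= t j)%R] z)%:E)%E.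
    by rewrite lee_fin mulr_ge0// indicE.
  have [z00|z0] := eqVneq z 0.
    have -> : weight a s z = 0.
      by rewrite z00 /weight normr0 [X in _ / X]powR0 ?gt_eqF ?addr_gt0// invr0 mulr0.
    by apply: adde_ge0; apply: nneseries_ge0 => j _ _; [exact: S1|exact: S2].
  have z1 : 0 < `|z| by rewrite normr_gt0.
  have big x : exists j : nat, x < (2 : R) `^ j.+1%:R.
    pose j := Num.Def.archi_bound `|x|; exists j.
    apply: (le_lt_trans (ler_norm x)); apply: (lt_trans (archi_boundP (normr_ge0 x))).
    rewrite powR_mulrn// -natrX ltr_nat; exact: (leq_trans (ltnSn j) (ltnW (ltn_expl _ _))).
  have exj : exists j : nat, (2 : R) `^ (- j.+1%:R) < `|z| /\ (`|z| <= 1 -> `|z| <= 2 `^ (- j%:R)).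
    have ex : exists j : nat, (2 : R) `^ (- j.+1%:R) < `|z|.
      have [j xj] := big `|z|^-1; exists j.
      by rewrite powRN invf_plt ?posrE.
    case: (ex_minnP ex) => j jz jmin; exists j; split => //.
    case: j jz jmin => [|j] jz jmin z1'; first by rewrite oppr0 powRr0.
    by rewrite leNgt; apply/negP => /jmin; rewrite ltnn.
  have exk : 1 < `|z| -> exists j : nat, (2 : R) `^ j%:R < `|z| <= 2 `^ j.+1%:R.
    move=> z1'; have ex : exists j : nat, `|z| <= (2 : R) `^ j.+1%:R.
      by have [j /ltW xj] := big `|z|; exists j.
    case: (ex_minnP ex) => j jz jmin; exists j; rewrite jz andbT.
    case: j jz jmin => [|j] jz jmin; first by rewrite powRr0.
    by rewrite ltNge; apply/negP => /jmin; rewrite ltnn.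
  have [zle|zgt] := leP `|z| 1.
    have [j [jz /(_ zle) zj]] := exj.
    apply: (@le_trans _ _ (\sum_(0 <= j <oo) (c j * \1_[set x : V | (`|x| <= r j)%R] z)%:E)%E); last first.
      by rewrite leeDl// nneseries_ge0.
    apply: le_trans (le_nneseries_term j S1).
    rewrite indicE mem_set//= mulr1 lee_fin /weight.
    rewrite (min_idPr zle) -powRB; last by rewrite (gt_eqF z1) implybT.
    have -> : c j = (2 `^ (- j.+1%:R)) `^ (a - (N%:R + s)).
      by rewrite -powRrM /c /a'; congr powR; ring.
    have -> : a - (N%:R + s) = - (N%:R - a') by rewrite /a'; ring.
    rewrite !(powRN _ (N%:R - a')) lef_pV2 ?posrE ?powR_gt0 ?P0//.
    by rewrite ge0_ler_powR ?nnegrE ?(ltW NaE) ?(ltW (P0 _)) ?(ltW jz).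
  have [j /andP[jz zj]] := exk zgt.
  apply: (@le_trans _ _ (\sum_(0 <= j <oo) (d j * \1_[set x : V | (`|x| <= t j)%R] z)%:E)%E); last first.
    by rewrite leeDr// nneseries_ge0.
  apply: le_trans (le_nneseries_term j S2).
  rewrite indicE mem_set//= mulr1 lee_fin /weight (min_idPl (ltW zgt)) powR1 mul1r /d powRN.
  rewrite lef_pV2 ?posrE ?powR_gt0 ?P0// powRrM.
  rewrite ge0_ler_powR ?nnegrE ?(ltW (P0 _)) ?(ltW jz)//.
  by rewrite addr_ge0// ltW.
have mS (e f : nat -> R) : (forall j, 0 <= e j) ->
  measurable_fun setT (fun z => \sum_(0 <= j <oo) (e j * \1_[set x : V | (`|x| <= f j)%R] z)%:E)%E.
  move=> e0; apply: ge0_emeasurable_sum => [j z _ _|j _]; first by rewrite lee_fin mulr_ge0// indicE.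
  apply/measurable_EFinP; apply: measurable_funM => //.
  by apply: measurable_indic; exact: measurable_norm_le.
have S0 (e f : nat -> R) (z : V) : (forall j, 0 <= e j) ->
  (0 <= \sum_(0 <= j <oo) (e j * \1_[set x : V | (`|x| <= f j)%R] z)%:E)%E.
  by move=> e0; apply: nneseries_ge0 => j _ _; rewrite lee_fin mulr_ge0// indicE.
rewrite ge0_integralD//; [|by move=> z _; exact: S0|exact: mS|by move=> z _; exact: S0|exact: mS].
rewrite !integral_dyadic// lte_add_pinfty//.
  rewrite (eq_eseriesr (g := fun j => (2 `^ (2 * N%:R - a') * (2 `^ (- a')) ^+ j)%:E)).
    apply: nneseries_geometric; first exact: ltW.
    by rewrite P0 /= powRN invf_lt1 ?P0 ?P1.
  move=> j _; congr EFin.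
  by rewrite /c /r -[X in X * _ `^ _](powRr1 (ler0n R 2)) -pow2D xN -powR_mulrn// -powRrM -!pow2D -!natr1; congr powR; ring.
rewrite (eq_eseriesr (g := fun j => (2 `^ (2 * N%:R) * (2 `^ (- s)) ^+ j)%:E)).
  apply: nneseries_geometric; first exact: ltW.
  by rewrite P0 /= powRN invf_lt1 ?P0 ?P1.
move=> j _; congr EFin.
by rewrite /d /t -[X in X * _ `^ _](powRr1 (ler0n R 2)) -pow2D xN -powR_mulrn// -powRrM -!pow2D -!natr1; congr powR; ring.
Qed.
End weight.

(** * Decreasing sequences of convex sets in L^1 *)

Section limits.
Variable R : realType.
Implicit Types (u : nat -> \bar R) (b : \bar R).
Local Open Scope ereal_scope.

Lemma limn_esup_le u b n0 : (forall m, (n0 <= m)%N -> u m <= b) -> limn_esup u <= b.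
Proof.
move=> h; rewrite limn_esup_lim; apply: lime_le; first exact: is_cvg_esups.
exists n0 => // k /= n0k; apply: ge_ereal_sup => _ [m /= km <-].
by apply: h; exact: leq_trans km.
Qed.

Lemma le_limn_einf u b n0 : (forall m, (n0 <= m)%N -> b <= u m) -> b <= limn_einf u.
Proof.
move=> h; rewrite limn_einf_lim; apply: lime_ge; first exact: is_cvg_einfs.
exists n0 => // k /= n0k; apply: le_ereal_inf_tmp => _ [m /= km <-].
by apply: h; exact: leq_trans km.
Qed.

Lemma limn_einf_le u b : (forall e : R, (0 < e)%R -> exists n0, forall m, (n0 <= m)%N -> u m <= b + e%:E) ->
  limn_einf u <= b.
Proof.
move=> h; apply/lee_addgt0Pr => e e0.
have [n0 hn0] := h _ e0; apply: le_trans (limn_einf_sup _) _; exact: limn_esup_le hn0.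
Qed.

Lemma half_pow_small (c r : R) : (0 < r)%R ->
  exists j0, forall j, (j0 <= j)%N -> (c * 2^-1 ^+ j <= r)%R.
Proof.
move=> r0; have /cvgrPdist_le /(_ r r0) : (geometric c 2^-1 : R^nat) @ \oo --> (0 : R)%R.
  by apply: cvg_geometric; rewrite ger0_norm// invf_lt1// ltr1n.
move=> [j0 _ h]; exists j0 => j /h /=; rewrite sub0r normrN; apply: le_trans.
exact: ler_norm.
Qed.

Lemma lt_ereal_real (x : R) (y : \bar R) : x%:E < y -> exists2 z : R, (x < z)%R & z%:E < y.
Proof.
case: y => [y| |]; last by rewrite ltNge leNye.
  by rewrite lte_fin => xy; exists ((x + y) / 2)%R; rewrite ?lte_fin; lra.
by move=> _; exists (x + 1)%R; rewrite ?ltrDl// ltry.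
Qed.

Lemma ereal_sup_approx (S : set (\bar R)) (e : R) : S !=set0 -> ereal_sup S \is a fin_num -> (0 < e)%R ->
  exists2 x, S x & ereal_sup S < x + e%:E.
Proof.
move=> S0 fS e0; have [x Sx hx] := ub_ereal_sup_adherent e0 fS.
exists x => //; move: hx; rewrite lteBlDr//.
Qed.
End limits.

Section L1.
Context d (T : measurableType d) (R : realType) (m : {measure set T -> \bar R}).
Variable Om : set T.
Hypothesis mOm : measurable Om.
Implicit Types f g : T -> R.
Local Open Scope ereal_scope.

(** The relaxation of indicators of subsets of Om to a convex set. *)
Definition density f := [/\ measurable_fun setT f, (forall x, (0 <= f x <= 1)%R) &
  forall x, ~ Om x -> f x = 0%R].

Definition dist1 f g : \bar R := \int[m]_x (`|f x - g x|)%:E.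

Lemma dist1_ge0 f g : 0 <= dist1 f g.
Proof. by apply: integral_ge0 => x _; rewrite lee_fin. Qed.

Lemma measurable_dist f g : measurable_fun setT f -> measurable_fun setT g ->
  measurable_fun setT (fun x => (`|f x - g x|)%:E).
Proof.
by move=> mf mg; apply/measurable_EFinP; apply: measurableT_comp => //; exact: measurable_funB.
Qed.

(** The limit is the pointwise upper limit, so that it is a density without any
    exceptional null set; the distance to it is at most the tail of the series of
    the successive differences, infinite or not. *)
Lemma dist1_telescope (f : nat -> T -> R) : (forall j, density (f j)) ->
  exists2 g, density g &
    forall j, dist1 (f j) g <= \sum_(j <= i <oo) dist1 (f i.+1) (f i).
Proof.
move=> df.
pose L (x : T) := limn_esup (fun j => (f j x)%:E).
have L01 x : 0 <= L x <= 1.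
  apply/andP; split.
    apply: (@le_trans _ _ (limn_einf (fun j => (f j x)%:E))); last exact: limn_einf_sup.
    by apply: (@le_limn_einf _ _ _ 0) => k _; rewrite lee_fin; have [_ /(_ x)/andP[]] := df k.
  by apply: (@limn_esup_le _ _ _ 0) => k _; rewrite lee_fin; have [_ /(_ x)/andP[]] := df k.
have Lfin x : L x \is a fin_num.
  have /andP[L0 L1] := L01 x; rewrite ge0_fin_numE//; exact: le_lt_trans L1 (ltry _).
exists (fun x => fine (L x)).
  split.
  - apply: measurableT_comp => //; apply: measurable_fun_limn_esup => j.
    by apply/measurable_EFinP; have [] := df j.
  - by move=> x; rewrite -!lee_fin fineK.
  - move=> x Ox; rewrite (_ : L x = 0)//.
    apply/eqP; rewrite eq_le; apply/andP; split; last by have /andP[] := L01 x.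
    by apply: (@limn_esup_le _ _ _ 0) => k _; have [_ _ ->] := df k.
move=> j.
have step x : (`|f j x - fine (L x)|)%:E <= \sum_(j <= i <oo) (`|f i.+1 x - f i x|)%:E.
  set S := (X in _ <= X).
  have Sm k : (j <= k)%N -> (`|f k x - f j x|)%:E <= S.
    move=> jk; apply: (@le_trans _ _ (\sum_(j <= i < k) (`|f i.+1 x - f i x|)%:E)).
      rewrite -(@telescope_sumr _ j k (fun i => f i x) jk) sumEFin lee_fin.
      exact: ler_norm_sum.
    by apply: nneseries_lim_ge => i _ _; rewrite lee_fin.
  have [->|Sfin] := eqVneq S +oo; first by rewrite leey.
  have S0 : 0 <= S by apply: nneseries_ge0 => i _ _; rewrite lee_fin.
  have fS : S \is a fin_num by rewrite ge0_fin_numE// lt_neqAle Sfin leey.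
  have Sr k : (j <= k)%N -> (`|f k x - f j x| <= fine S)%R.
    by move=> /Sm; rewrite -lee_fin fineK.
  rewrite -(fineK fS) lee_fin ler_distlC -!lee_fin fineK//; apply/andP; split.
    apply: (@le_trans _ _ (limn_einf (fun j => (f j x)%:E))); last exact: limn_einf_sup.
    apply: (@le_limn_einf _ _ _ j) => k /Sr; rewrite lee_fin ler_norml => /andP[]; lra.
  apply: (@limn_esup_le _ _ _ j) => k /Sr; rewrite lee_fin ler_norml => /andP[]; lra.
rewrite /dist1; apply: (@le_trans _ _ (\int[m]_x \sum_(j <= i <oo) (`|f i.+1 x - f i x|)%:E)).
  by apply: le_int => // x; rewrite lee_fin.
have E (u : nat -> \bar R) : (forall i, 0 <= u i) -> \sum_(j <= i <oo) u i = \sum_(0 <= i <oo) u (i + j)%N.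
  by move=> u0; rewrite -nneseries_addn.
under eq_integral do rewrite E//.
rewrite integral_nneseries//; last first.
  by move=> i; apply: measurable_dist; have [] := df (i.+1 + j)%N => //; have [] := df (i + j)%N.
by rewrite (E (fun i => dist1 (f i.+1) (f i)))// => i; exact: dist1_ge0.
Qed.

Definition sqnorm f : \bar R := \int[m]_x (f x ^+ 2)%:E.

Definition midpoint f g : T -> R := (fun x => (f x + g x) / 2)%R.

Lemma measurable_midpoint f g : measurable_fun setT f -> measurable_fun setT g ->
  measurable_fun setT (midpoint f g).
Proof. by move=> mf mg; apply: measurable_funM => //; exact: measurable_funD. Qed.

Lemma parallelogram f g : measurable_fun setT f -> measurable_fun setT g ->
  sqnorm (fun x => f x - g x)%R + 4%:E * sqnorm (midpoint f g) =
  2%:E * sqnorm f + 2%:E * sqnorm g.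
Proof.
move=> mf mg.
have msq (h : T -> R) : measurable_fun setT h -> measurable_fun setT (fun x => (h x ^+ 2)%:E).
  by move=> mh; apply/measurable_EFinP; exact: measurable_funX.
have mB : measurable_fun setT (fun x => f x - g x)%R by exact: measurable_funB.
have mM := measurable_midpoint mf mg.
have sq0 (h : T -> R) x : 0 <= (h x ^+ 2)%:E by rewrite lee_fin sqr_ge0.
have scale (c : R) (h : T -> R) : (0 <= c)%R -> measurable_fun setT h ->
    c%:E * sqnorm h = \int[m]_x (c * h x ^+ 2)%:E.
  move=> c0 mh; rewrite /sqnorm -(ge0_integralZl m measurableT (msq h mh)) //.
have mscale (c : R) (h : T -> R) : measurable_fun setT h -> measurable_fun setT (fun x => (c * h x ^+ 2)%:E).
  by move=> mh; apply/measurable_EFinP; apply: measurable_funM => //; exact: measurable_funX.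
have sc0 (c : R) (h : T -> R) x : (0 <= c)%R -> 0 <= (c * h x ^+ 2)%:E.
  by move=> c0; rewrite lee_fin mulr_ge0// sqr_ge0.
have sc4 (h : T -> R) x : 0 <= (4 * h x ^+ 2)%:E by exact: sc0.
have sc2 (h : T -> R) x : 0 <= (2 * h x ^+ 2)%:E by exact: sc0.
rewrite !scale// /sqnorm.
rewrite -(ge0_integralD m measurableT (fun x _ => sq0 _ x) (msq _ mB) (fun x _ => sc4 _ x) (mscale _ _ mM)).
rewrite -(ge0_integralD m measurableT (fun x _ => sc2 _ x) (mscale _ _ mf) (fun x _ => sc2 _ x) (mscale _ _ mg)).
by apply: eq_integral => x _; rewrite -!EFinD /midpoint; congr EFin; field.
Qed.

(** On Om, |a| <= t + a^2 / t: this passes from L^2 to L^1 without square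
    roots. *)
Lemma dist1_le_sqnorm f g (t : R) : density f -> density g -> (0 < t)%R ->
  dist1 f g <= t%:E * m Om + t^-1%:E * sqnorm (fun x => f x - g x)%R.
Proof.
move=> [mf f01 fOm] [mg g01 gOm] t0.
have mB : measurable_fun setT (fun x => f x - g x)%R by exact: measurable_funB.
have mI : measurable_fun setT (fun x => (\1_Om x : R)%:E).
  by apply/measurable_EFinP; exact: measurable_indic.
have mS : measurable_fun setT (fun x => ((f x - g x) ^+ 2)%:E).
  by apply/measurable_EFinP; exact: measurable_funX.
have I0 x : 0 <= (\1_Om x : R)%:E by rewrite lee_fin indicE.
have S0 x : 0 <= ((f x - g x) ^+ 2)%:E by rewrite lee_fin sqr_ge0.
have tE : 0 <= t%:E by rewrite lee_fin ltW.
have tE' : 0 <= t^-1%:E by rewrite lee_fin invr_ge0 ltW.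
have -> : m Om = \int[m]_x (\1_Om x : R)%:E by rewrite integral_indic// setIT.
rewrite /sqnorm -(ge0_integralZl m measurableT mI)// -(ge0_integralZl m measurableT mS)//.
rewrite -(ge0_integralD m measurableT) //.
- apply: le_int => x; first by rewrite lee_fin.
  rewrite -!EFinM -EFinD lee_fin indicE; have [Ox|/negP] := boolP (x \in Om); last first.
    by rewrite inE => Ox; rewrite fOm// gOm// subrr normr0 mulr0 add0r mulr_ge0 ?sqr_ge0// invr_ge0 ltW.
  rewrite mulr1 -real_normK ?num_real//; set a := `|_|%R.
  have : (0 <= t^-1 * (t - a) ^+ 2 + a)%R by rewrite addr_ge0 ?normr_ge0// mulr_ge0 ?sqr_ge0// invr_ge0 ltW.
  have -> : (t^-1 * (t - a) ^+ 2 + a = t + t^-1 * a ^+ 2 - a)%R by field; rewrite gt_eqF.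
  by rewrite subr_ge0.
- by move=> x _; rewrite mule_ge0.
- by apply: emeasurable_funM => //; exact: measurable_cst.
- by move=> x _; rewrite mule_ge0.
- by apply: emeasurable_funM => //; exact: measurable_cst.
Qed.

(** Let D be the supremum over k of the infimum of the squared L^2 norm on C k.
    If f_j in C (K j) is almost minimal, then so is f_(j+1), and the midpoint of
    both lies in C (K j), thus has squared norm at least D - 4^-j.  The
    parallelogram identity bounds the squared distance of f_j to f_(j+1) by
    8 4^-j, hence the L^1 distance by a multiple of 2^-j, and the sequence
    converges.  The limit lies in every C k since the C k are closed and
    decreasing. *)
Lemma nested_convex (C : nat -> (T -> R) -> Prop) : m Om < +oo ->
  (forall k f, C k f -> density f) -> (forall k, exists f, C k f) ->
  (forall k f, C k.+1 f -> C k f) ->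
  (forall k f g, C k f -> C k g -> C k (midpoint f g)) ->
  (forall k (f : nat -> T -> R) g, (forall j, C k (f j)) -> density g ->
     (forall e : R, (0 < e)%R -> exists j0, forall j, (j0 <= j)%N -> dist1 (f j) g <= e%:E) -> C k g) ->
  exists g, density g /\ forall k, C k g.
Proof.
move=> Omoo Cd Cn CS Cmid Ccl.
have Cle k l f : (k <= l)%N -> C l f -> C k f.
  elim: l => [|l IHl]; first by rewrite leqn0 => /eqP ->.
  by rewrite leq_eqVlt => /orP[/eqP -> //|/IHl h /CS /h].
pose e k := ereal_inf [set sqnorm f | f in C k].
have sq0 f : 0 <= sqnorm f by apply: integral_ge0 => x _; rewrite lee_fin sqr_ge0.
have sqOm f : density f -> sqnorm f <= m Om.
  move=> [mf f01 fOm]; rewrite -[Om]setIT -integral_indic//; apply: le_int => x.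
    by rewrite lee_fin sqr_ge0.
  rewrite lee_fin indicE; have [Ox|/negP] := boolP (x \in Om); last first.
    by rewrite inE => /fOm ->; rewrite expr0n.
  by have /andP[? ?] := f01 x; rewrite expr2 mulr_ile1.
pose D := ereal_sup (range e).
have eOm k : e k <= m Om.
  have [f Cf] := Cn k; apply: (@le_trans _ _ (sqnorm f)); last by apply: sqOm; exact: Cd Cf.
  by apply: ereal_inf_lbound; exists f.
have e0 k : 0 <= e k by apply: le_ereal_inf_tmp => _ [f _ <-].
have D0 : 0 <= D by apply: le_trans (e0 0%N) _; apply: ereal_sup_ubound; exists 0%N.
have DOm : D <= m Om by apply: ge_ereal_sup => _ [k _ <-].
have fD : D \is a fin_num by rewrite ge0_fin_numE//; exact: le_lt_trans Omoo.
have fOmm : m Om \is a fin_num by rewrite ge0_fin_numE.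
pose t (j : nat) : R := (4^-1 ^+ j)%R.
have t0 j : (0 < t j)%R by rewrite exprn_gt0.
have /choice[k0 hk0] j : exists k, D < e k + (t j)%:E.
  have /ereal_sup_approx /(_ fD (t0 j)) : range e !=set0 by exists (e 0%N); exists 0%N.
  by move=> [_ [k _ <-] h]; exists k.
(* An increasing choice of indices, with K j >= k0 j and K j >= j. *)
pose K j := (\sum_(i < j.+1) (k0 i).+1)%N.
have Kmon : {homo K : i j / (i <= j)%N}.
  apply: homo_leq => // [|i]; first exact: leq_trans.
  by rewrite /K [X in (_ <= X)%N]big_ord_recr /= leq_addr.
have Kk0 j : (k0 j <= K j)%N.
  by rewrite /K big_ord_recr/= (leq_trans _ (leq_addl _ _)).
have Kj j : (j <= K j)%N.
  elim: j => // j IH; rewrite /K big_ord_recr/= -/(K j).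
  by rewrite addnS ltnS (leq_trans IH)// leq_addr.
have emon k l : (k <= l)%N -> e k <= e l.
  by move=> kl; apply: le_ereal_inf => _ [f Cf <-]; exists f => //; exact: Cle kl _.
have eK j : D < e (K j) + (t j)%:E.
  by apply: lt_le_trans (hk0 j) _; rewrite leeD2r// emon.
have /choice[f hf] j : exists f, C (K j) f /\ sqnorm f < D + (t j)%:E.
  have fe : e (K j) \is a fin_num by rewrite ge0_fin_numE//; exact: le_lt_trans (eOm _) Omoo.
  have [_ [g Cg <-] hg] := lb_ereal_inf_adherent (t0 j) fe.
  exists g; split => //; apply: lt_le_trans hg _; rewrite leeD2r//.
  by apply: ereal_sup_ubound; exists (K j).
have df j : density (f j) by have [h _] := hf j; exact: Cd h.
have fsq j : sqnorm (f j) \is a fin_num.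
  by rewrite ge0_fin_numE//; exact: le_lt_trans (sqOm _ (df j)) Omoo.
have step j : dist1 (f j.+1) (f j) <= ((fine (m Om) + 8) * 2^-1 ^+ j)%:E.
  have dj := df j; have dj1 := df j.+1.
  have Cm : C (K j) (midpoint (f j.+1) (f j)).
    apply: Cmid; last by have [] := hf j.
    by apply: Cle (proj1 (hf j.+1)); exact: Kmon.
  have fm : sqnorm (midpoint (f j.+1) (f j)) \is a fin_num.
    by rewrite ge0_fin_numE//; exact: le_lt_trans (sqOm _ (Cd _ _ Cm)) Omoo.
  have Em : D < sqnorm (midpoint (f j.+1) (f j)) + (t j)%:E.
    apply: lt_le_trans (eK j) _; rewrite leeD2r//.
    by apply: ereal_inf_lbound; exists (midpoint (f j.+1) (f j)).
  have [mj _ _] := dj; have [mj1 _ _] := dj1.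
  have P := parallelogram mj1 mj.
  have [_ h1] := hf j; have [_ h2] := hf j.+1.
  (* With t = 2^-j the squared distance 8 4^-j costs 8 2^-j. *)
  have h := @dist1_le_sqnorm _ _ (2^-1 ^+ j)%R dj1 dj (exprn_gt0 _ _).
  apply: le_trans (h _) _ => //.
  have fd : sqnorm (fun x => f j.+1 x - f j x)%R \is a fin_num.
    rewrite ge0_fin_numE//.
    apply: (@le_lt_trans _ _ (2%:E * sqnorm (f j.+1) + 2%:E * sqnorm (f j))).
      by rewrite -P leeDl// mule_ge0.
    by rewrite lte_add_pinfty// lte_mul_pinfty// ltey_eq fsq.
  move: P h1 h2 Em.
  rewrite -(fineK fd) -(fineK fm) -(fineK (fsq j)) -(fineK (fsq j.+1)) -(fineK fD) -(fineK fOmm).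
  rewrite -!EFinM -!EFinD => -[P]; rewrite !lte_fin !lee_fin /= => h1 h2 Em.
  have tj : t j.+1 = (t j / 4)%R by rewrite /t exprS mulrC.
  have tq : t j = (2^-1 ^+ j * 2^-1 ^+ j)%R.
    by rewrite /t -exprMn; congr (_ ^+ _)%R; field.
  have q0 : (0 < (2^-1 : R) ^+ j)%R by rewrite exprn_gt0.
  set q := (2^-1 ^+ j)%R in q0 tq *.
  set X := fine (sqnorm (fun x => f j.+1 x - f j x)%R) in P *.
  have X8 : (X <= 8 * t j)%R by have := t0 j; rewrite tj in h2; lra.
  have : (q^-1 * X <= q^-1 * (8 * t j))%R by rewrite ler_pM2l// invr_gt0.
  have -> : (q^-1 * (8 * t j) = 8 * q)%R by rewrite tq; field; rewrite gt_eqF.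
  by move=> h8; lra.
have [g dg hg] := dist1_telescope df.
exists g; split => // k.
apply: (Ccl k (fun j => f (j + k)%N)) => // [j|r r0].
  have [h _] := hf (j + k)%N; apply: Cle h.
  by apply: leq_trans (Kj _); rewrite leq_addl.
have A0 : (0 <= fine (m Om) + 8)%R by rewrite addr_ge0// fine_ge0.
have tailE j : dist1 (f j) g <= ((fine (m Om) + 8) * 2 * 2^-1 ^+ j)%:E.
  apply: le_trans (hg j) _; apply: lime_le.
    by apply: is_cvg_nneseries => i _ _; exact: dist1_ge0.
  apply: nearW => k'.
  apply: (@le_trans _ _ (\sum_(j <= i < k') ((fine (m Om) + 8) * 2^-1 ^+ i)%:E)).
    by apply: lee_sum => i _.
  rewrite sumEFin lee_fin -mulr_sumr -mulrA ler_wpM2l//.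
  have [jk|kj] := leqP j k'; last by rewrite big_geq 1?ltnW// mulr_ge0// exprn_ge0.
  have -> : (\sum_(j <= i < k') 2^-1 ^+ i = 2 * 2^-1 ^+ j - 2 * 2^-1 ^+ k' :> R)%R.
    rewrite -(subnKC jk); elim: (k' - j)%N => [|l IHl]; first by rewrite addn0 big_geq// subrr.
    by rewrite addnS big_nat_recr ?leq_addr//= IHl exprS; field.
  by rewrite lerBlDr lerDl mulr_ge0// exprn_ge0.
have [j0 hj0] := half_pow_small ((fine (m Om) + 8) * 2) r0.
exists j0 => j jj0; apply: le_trans (tailE _) _; rewrite lee_fin hj0//.
by rewrite (leq_trans jj0)// leq_addr.
Qed.
End L1.

(** * Limits of energies and an isoperimetric inequality *)

Section energy_limits.
Variables (R : realType) (N : nat).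
Local Notation mu := (@lebesgue_rV R N).
Local Notation V := 'rV[R]_N.
Implicit Types (f g : V -> R) (K : V -> R).
Local Open Scope ereal_scope.

Lemma le_limn_einf_add (u : nat -> \bar R) b :
  (forall e : R, (0 < e)%R -> exists n0, forall m, (n0 <= m)%N -> b <= u m + e%:E) ->
  b <= limn_einf u.
Proof.
move=> h; apply/lee_addgt0Pr => e e0; have [n0 hn0] := h _ e0.
rewrite addeC -limn_einf_shift//; apply: (@le_limn_einf _ _ _ n0) => k /hn0.
by rewrite addeC.
Qed.

Lemma measurable_increment_integrand f k : measurable_fun setT f ->
  measurable_fun setT (fun y : V => (`|f (y + k)%R - f y|)%:E).
Proof.
move=> mf; apply/measurable_EFinP; apply: measurableT_comp => //; apply: measurable_funB => //.
exact: measurable_translate.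
Qed.

Lemma measurable_energy_integrand K f : measurable_fun setT K -> measurable_fun setT f ->
  measurable_fun setT (fun k => (K k)%:E * increment f k).
Proof.
move=> mK mf; apply: emeasurable_funM; first exact/measurable_EFinP.
exact: measurable_increment.
Qed.

Lemma increment_midpoint f g k : measurable_fun setT f -> measurable_fun setT g ->
  2%:E * increment (midpoint f g) k <= increment f k + increment g k.
Proof.
move=> mf mg.
have mm := measurable_midpoint mf mg.
have m1 := measurable_increment_integrand k mf.
have m2 := measurable_increment_integrand k mg.
have m3 := measurable_increment_integrand k mm.
rewrite /increment -(ge0_integralZl mu measurableT m3)//.
rewrite -(ge0_integralD mu measurableT _ m1 _ m2)//.
apply: le_int => y; first by rewrite mule_ge0.
rewrite -EFinM -EFinD lee_fin /midpoint.
have -> : ((f (y + k) + g (y + k)) / 2 - (f y + g y) / 2 = 2^-1 * ((f (y + k) - f y) + (g (y + k) - g y)))%R by field.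
rewrite normrM ger0_norm// mulrA divff// mul1r; exact: ler_normD.
Qed.

Lemma energy_midpoint K f g : (forall k, (0 <= K k)%R) -> measurable_fun setT K ->
  measurable_fun setT f -> measurable_fun setT g ->
  2%:E * energy K (midpoint f g) <= energy K f + energy K g.
Proof.
move=> K0 mK mf mg.
have mm := measurable_midpoint mf mg.
have e0 h k : 0 <= (K k)%:E * increment h k by rewrite mule_ge0 ?lee_fin ?increment_ge0.
have mE h : measurable_fun setT h -> measurable_fun setT (fun k => (K k)%:E * increment h k).
  exact: measurable_energy_integrand.
rewrite /energy -(ge0_integralZl mu measurableT (mE _ mm))//.
rewrite -(ge0_integralD mu measurableT _ (mE _ mf) _ (mE _ mg))//.
apply: le_int => k; first by rewrite mule_ge0.
rewrite muleCA -ge0_muleDr ?increment_ge0//.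
by rewrite lee_wpmul2l ?lee_fin// increment_midpoint.
Qed.

Lemma increment_dist f g k : measurable_fun setT f -> measurable_fun setT g ->
  increment g k <= increment f k + 2%:E * dist1 mu f g.
Proof.
move=> mf mg.
have m1 := measurable_increment_integrand k mf.
have md := measurable_dist mf mg.
have mdk : measurable_fun setT (fun y : V => (`|f (y + k)%R - g (y + k)%R|)%:E).
  apply/measurable_EFinP; apply: (@measurable_translate R N _ _ (fun x => `|f x - g x|%R)) => //.
  by apply: measurableT_comp => //; exact: measurable_funB.
have -> : 2%:E * dist1 mu f g = dist1 mu f g + dist1 mu f g by rewrite -mule2n -mule_natl.
rewrite {1}/dist1 -(ge0_integral_shift k (f := fun x => (`|f x - g x|)%:E))//.
rewrite /increment /dist1 -(ge0_integralD mu measurableT _ mdk _ md)//.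
rewrite -(ge0_integralD mu measurableT _ m1)//; last exact: emeasurable_funD.
  apply: le_int => // y; rewrite -!EFinD lee_fin.
  have -> : (g (y + k) - g y = (f (y + k) - f y) - ((f (y + k) - g (y + k)) - (f y - g y)))%R by ring.
  by rewrite (le_trans (ler_normB _ _))// lerD2l ler_normB.
by move=> x _; exact: adde_ge0.
Qed.

Definition cvg1 (f : nat -> V -> R) g :=
  forall e : R, (0 < e)%R -> exists j0, forall j, (j0 <= j)%N -> dist1 mu (f j) g <= e%:E.

(** At each step k the increments converge, since they change by at most twice
    the L^1 distance; Fatou concludes. *)
Lemma energy_lsc K (f : nat -> V -> R) g : (forall k, (0 <= K k)%R) -> measurable_fun setT K ->
  (forall j, measurable_fun setT (f j)) -> measurable_fun setT g -> cvg1 f g ->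
  energy K g <= limn_einf (fun j => energy K (f j)).
Proof.
move=> K0 mK mf mg fg.
apply: le_trans (@fatou _ _ R mu setT measurableT (fun j k => (K k)%:E * increment (f j) k) _ _).
- apply: le_int => k; first by rewrite mule_ge0 ?increment_ge0 ?lee_fin.
  apply: le_limn_einf_add => e e0.
  have c0 : (0 < K k * 2 + 1)%R by rewrite ltr_wpDl// mulr_ge0.
  have [j0 hj0] := fg (e / (K k * 2 + 1))%R (divr_gt0 e0 c0).
  exists j0 => j /hj0 h.
  apply: (@le_trans _ _ ((K k)%:E * (increment (f j) k + 2%:E * dist1 mu (f j) g))).
    by rewrite lee_wpmul2l ?lee_fin// increment_dist.
  rewrite ge0_muleDr ?increment_ge0 ?mule_ge0 ?dist1_ge0// leeD2l//.
  rewrite muleA -EFinM; apply: (@le_trans _ _ ((K k * 2)%:E * (e / (K k * 2 + 1))%:E)).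
    by rewrite lee_wpmul2l// lee_fin mulr_ge0.
  rewrite -EFinM lee_fin mulrCA ler_piMr ?(ltW e0)// ler_pdivrMr// mul1r; lra.
- by move=> j; exact: measurable_energy_integrand.
- by move=> j k _; rewrite mule_ge0 ?increment_ge0 ?lee_fin.
Qed.

Lemma integral_le_dist1 f g : measurable_fun setT f -> measurable_fun setT g ->
  (forall x, (0 <= f x)%R) -> (forall x, (0 <= g x)%R) ->
  \int[mu]_x (f x)%:E <= \int[mu]_x (g x)%:E + dist1 mu f g.
Proof.
move=> mf mg f0 g0.
have md := measurable_dist mf mg.
rewrite /dist1 -(ge0_integralD mu measurableT _ _ _ md)//; first last.
- exact/measurable_EFinP.
- by move=> x _; rewrite lee_fin.
apply: le_int => x; first by rewrite lee_fin.
by rewrite -EFinD lee_fin addrC -lerBlDr ler_norm.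
Qed.

(** For k in B, the increment of 1_E is at least |E| - |E inter (E - k)|, and the
    integral over k of |E inter (E - k)| is |E|^2.  Hence
    energy K 1_E >= kappa |E| (|B| - |E|), written additively. *)
Lemma mu_isoperimetric K (E B : set V) (kappa : R) :
  (0 <= kappa)%R -> (forall k, (0 <= K k)%R) -> measurable_fun setT K ->
  measurable E -> measurable B -> (forall k, B k -> (kappa <= K k)%R) ->
  kappa%:E * mu E * mu B <= energy K \1_E + kappa%:E * mu E * mu E.
Proof.
move=> k0 K0 mK mE mB KB.
have mi : measurable_fun setT (\1_E : V -> R) by exact: measurable_indic.
have miE : measurable_fun setT (fun y : V => (\1_E y : R)%:E) by exact/measurable_EFinP.
have iE0 (A : set V) y : 0 <= (\1_A y : R)%:E by rewrite lee_fin indicE.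
have muE (A : set V) : measurable A -> mu A = \int[mu]_y (\1_A y : R)%:E.
  by move=> mA; rewrite integral_indic// setIT.
have mJ : measurable_fun setT (fun z : V * V => (\1_E z.2 * \1_E (z.2 + z.1)%R : R)%:E).
  apply/measurable_EFinP; apply: measurable_funM; first exact: (measurableT_comp mi).
  exact: measurable_translate.
have J0 (z : V * V) : 0 <= (\1_E z.2 * \1_E (z.2 + z.1)%R : R)%:E.
  by rewrite lee_fin mulr_ge0// indicE.
pose J k := \int[mu]_y (\1_E y * \1_E (y + k)%R : R)%:E.
have mJk : measurable_fun setT J.
  exact: (@measurable_fun_fubini_tonelli_F _ _ _ _ R mu _ mJ J0).
have J0' k : 0 <= J k by apply: integral_ge0 => y _; exact: (J0 (k, y)).
have IJ : \int[mu]_k J k = mu E * mu E.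
  rewrite (fubini_tonelli _ mJ J0) /=.
  transitivity (\int[mu]_y (mu E * (\1_E y : R)%:E)); last first.
    by rewrite ge0_integralZl// -muE.
  apply: eq_integral => y _; under eq_integral do rewrite EFinM.
  have mt : measurable_fun setT (fun k : V => (\1_E (y + k)%R : R)%:E).
    apply/measurable_EFinP; exact: measurable_translate.
  rewrite ge0_integralZl// muleC; congr (_ * _).
  rewrite (muE E mE) -(ge0_integral_shift y (f := fun x => (\1_E x : R)%:E))//.
  by apply: eq_integral => x _; rewrite addrC.
have pt k : mu E <= increment \1_E k + J k.
  have mJ1 : measurable_fun setT (fun y : V => (\1_E y * \1_E (y + k)%R : R)%:E).
    exact: (measurableT_comp mJ (pair1_measurable k)).
  have mI1 := measurable_increment_integrand k mi.
  rewrite (muE E mE) /increment -(ge0_integralD mu measurableT _ mI1 _ mJ1)//.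
    apply: le_int => // y; rewrite -EFinD lee_fin !indicE.
    by case: (y \in E); case: (_ \in E); rewrite ?subrr ?subr0 ?sub0r ?normrN ?normr0 ?normr1 ?mulr0 ?mulr1 ?mul0r ?add0r ?addr0.
rewrite -[X in _ + X]muleA -IJ -(ge0_integralZl mu measurableT mJk)//.
have mKJ : measurable_fun setT (fun k => kappa%:E * J k).
  by apply: emeasurable_funM.
rewrite /energy -(ge0_integralD mu measurableT _ (measurable_energy_integrand mK mi) _ mKJ)//; last 2 first.
- by move=> k _; rewrite mule_ge0 ?increment_ge0 ?lee_fin.
- by move=> k _; rewrite mule_ge0.
have miB : measurable_fun setT (fun y : V => (\1_B y : R)%:E).
  by apply/measurable_EFinP; exact: measurable_indic.
rewrite (muE B mB) -ge0_integralZl//; last by rewrite mule_ge0.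
apply: le_int => k; first by rewrite !mule_ge0.
rewrite indicE; have [kB|_] := boolP (k \in B); last first.
  by rewrite mule0 adde_ge0 ?mule_ge0 ?increment_ge0 ?lee_fin.
rewrite mule1; apply: (@le_trans _ _ (kappa%:E * (increment \1_E k + J k))).
  by rewrite lee_wpmul2l ?lee_fin.
rewrite ge0_muleDr ?increment_ge0// leeD2r// lee_wpmul2r ?increment_ge0// lee_fin.
by apply: KB; rewrite inE in kB.
Qed.
End energy_limits.

(** * Monotonicity of the truncated kernels in p *)

Section trunc.
Variables (R : realType) (n : nat).
Local Notation N := n.+1.
Local Notation V := 'rV[R]_N.
Implicit Types (s p q : R) (z : V).

(** Where k_p >= 1 the truncation is active and the exponent N + s p becomes
    N / p + s; elsewhere the kernel is k_p itself.  Both powers decrease with p in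
    their region, and the regions do not depend on p. *)
Lemma trunc_kernel_near s p z : 0 < s -> 1 <= p -> 0 < enorm z <= 1 ->
  trunc_kernel s p z = enorm z `^ (- (N%:R / p + s)).
Proof.
move=> s0 p1 /andP[e0 e1].
have p0 : 0 < p by lra.
have Nsp : 0 < N%:R + s * p by rewrite addr_gt0// mulr_gt0.
rewrite /trunc_kernel (_ : Num.min 1 _ = 1); last first.
  apply/min_idPl; rewrite /frac_kernel invf_ge1 ?powR_gt0//.
  by rewrite -[X in _ <= X](powRr0 (enorm z)) ger_powR ?e0// ltW.
rewrite powR1 mulr1 /frac_kernel -powRN -powRrM; congr powR; field.
by rewrite gt_eqF.
Qed.

Lemma trunc_kernel_far s p z : 0 < s -> 1 <= p -> 1 <= enorm z ->
  trunc_kernel s p z = enorm z `^ (- (N%:R + s * p)).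
Proof.
move=> s0 p1 e1.
have p0 : 0 < p by lra.
have Nsp : 0 < N%:R + s * p by rewrite addr_gt0// mulr_gt0.
have e0 : 0 < enorm z by exact: lt_le_trans e1.
have f1 : frac_kernel s p z <= 1.
  rewrite /frac_kernel invf_le1 ?powR_gt0//.
  by rewrite -[X in X <= _](powRr0 (enorm z)) ler_powR// ltW.
rewrite /trunc_kernel (min_idPr f1) -powRD; last first.
  by rewrite /frac_kernel invr_eq0 powR_eq0 negb_and (gt_eqF e0)/= implybT.
by rewrite addrC subrK powRr1 ?frac_kernel_ge0// /frac_kernel powRN.
Qed.

Lemma frac_kernel0 s p z : 0 < s -> 1 <= p -> enorm z = 0 -> frac_kernel s p z = 0.
Proof.
move=> s0 p1 e0; rewrite /frac_kernel e0 powR0 ?invr0// gt_eqF// addr_gt0// mulr_gt0//; lra.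
Qed.

Lemma trunc_kernel0 s p z : 0 < s -> 1 <= p -> enorm z = 0 -> trunc_kernel s p z = 0.
Proof.
move=> s0 p1 e0; rewrite /trunc_kernel frac_kernel0// powR0 ?mul0r// invr_eq0 gt_eqF//; lra.
Qed.

Lemma trunc_kernel_mono s p q z : 0 < s -> 1 <= p -> p <= q ->
  trunc_kernel s q z <= trunc_kernel s p z.
Proof.
move=> s0 p1 pq.
have q1 : 1 <= q by lra.
have e0 : 0 <= enorm z by exact: sqrtr_ge0.
have [ez|ez] := eqVneq (enorm z) 0; first by rewrite !trunc_kernel0.
have e1 : 0 < enorm z by rewrite lt_neqAle eq_sym ez.
have [le1|/ltW ge1] := leP (enorm z) 1.
  rewrite !trunc_kernel_near ?e1// ger_powR ?e1// lerN2 lerD2r ler_wpM2l//.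
  by rewrite lef_pV2 ?posrE//; lra.
rewrite !trunc_kernel_far// ler_powR// lerN2 lerD2l ler_wpM2l//; lra.
Qed.

Lemma trunc_kernel1 s z : 0 < s -> trunc_kernel s 1 z = frac_kernel s 1 z.
Proof.
move=> s0; rewrite /trunc_kernel invr1 subrr powRr0 mulr1 powRr1//.
exact: frac_kernel_ge0.
Qed.

Lemma cvg_powR_exponent (a : R) (u : nat -> R) (l : R) : 0 < a ->
  u @ \oo --> l -> (a `^ (u k)) @[k --> \oo] --> a `^ l.
Proof.
move=> a0 ul; rewrite /powR gt_eqF//.
apply: (@cvg_comp _ _ _ (fun k => u k * ln a) expR _ (nbhs (l * ln a))); last exact: continuous_expR.
exact: cvgMl.
Qed.

Lemma cvg_trunc_kernel s (p : nat -> R) z : 0 < s -> (forall k, 1 <= p k) ->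
  p @ \oo --> (1 : R) -> (trunc_kernel s (p k) z) @[k --> \oo] --> frac_kernel s 1 z.
Proof.
move=> s0 p1 pl.
have e0 : 0 <= enorm z by exact: sqrtr_ge0.
rewrite -trunc_kernel1//.
have [ez|ez] := eqVneq (enorm z) 0.
  rewrite trunc_kernel0//; under eq_fun do rewrite trunc_kernel0//.
  exact: cvg_cst.
have e1 : 0 < enorm z by rewrite lt_neqAle eq_sym ez.
have [le1|/ltW ge1] := leP (enorm z) 1.
  rewrite trunc_kernel_near ?e1//; under eq_fun do rewrite trunc_kernel_near ?e1//.
  apply: cvg_powR_exponent => //; apply: cvgN; apply: cvgD; last exact: cvg_cst.
  by apply: cvgMr; apply: cvgV.
rewrite trunc_kernel_far//; under eq_fun do rewrite trunc_kernel_far//.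
apply: cvg_powR_exponent => //; apply: cvgN; apply: cvgD; first exact: cvg_cst.
exact: cvgMr.
Qed.

(** Monotone convergence along the kernels increasing to [frac_kernel s 1]. *)
Lemma energy_frac_le s (p : nat -> R) (f : V -> R) (b : \bar R) : 0 < s ->
  (forall k, 1 <= p k) -> {homo p : i j / (i <= j)%N >-> j <= i} -> p @ \oo --> (1 : R) ->
  measurable_fun setT f ->
  (forall k, energy (trunc_kernel s (p k)) f <= b)%E -> (energy (frac_kernel s 1) f <= b)%E.
Proof.
move=> s0 p1 pd pl mf H.
apply: (@le_trans _ _ (limn (fun k => energy (trunc_kernel s (p k)) f))); last first.
  apply: lime_le; last exact: nearW.
  apply: ereal_nondecreasing_is_cvgn => i j ij.
  by apply: le_energy => k; [exact: trunc_kernel_ge0|exact: trunc_kernel_mono (pd _ _ ij)].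
rewrite /energy -monotone_convergence//.
- apply: le_int => k; first by rewrite mule_ge0 ?increment_ge0 ?lee_fin ?frac_kernel_ge0.
  have mn : {homo (fun j => ((trunc_kernel s (p j) k)%:E * increment f k)%E) : i j / (i <= j)%N >-> (i <= j)%E}.
    move=> i j ij; rewrite lee_wpmul2r ?increment_ge0// lee_fin.
    exact: trunc_kernel_mono (pd _ _ ij).
  have [K0|Kn0] := eqVneq (frac_kernel s 1 k) 0.
    rewrite K0 mul0e; apply: lime_ge; first exact: ereal_nondecreasing_is_cvgn.
    by apply: nearW => j; rewrite mule_ge0 ?increment_ge0 ?lee_fin ?trunc_kernel_ge0.
  have cK : ((trunc_kernel s (p j) k)%:E * increment f k @[j --> \oo] --> (frac_kernel s 1 k)%:E * increment f k)%E.
    apply: cvgeM.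
    - by rewrite /mule_def /=; case: (increment f k).
    - by apply/fine_cvgP; split; [exact: nearW|exact: cvg_trunc_kernel].
    - exact: cvg_cst.
  by rewrite (cvg_lim _ cK).
- by move=> k; apply: measurable_energy_integrand => //; exact: measurable_trunc_kernel.
- by move=> j k _; rewrite mule_ge0 ?increment_ge0 ?lee_fin ?trunc_kernel_ge0.
- move=> k _ i j ij; rewrite lee_wpmul2r ?increment_ge0// lee_fin.
  exact: trunc_kernel_mono (pd _ _ ij).
Qed.
End trunc.

(** * The Cheeger inequality for the truncated kernels *)

Section lower_bound.
Variables (R : realType) (n : nat).
Local Notation N := n.+1.
Local Notation mu := (@lebesgue_rV R N).
Local Notation V := 'rV[R]_N.
Implicit Types (s p q M : R) (z : V) (Om E : set V).

Lemma mu0_set1 : mu [set z : V | `|z| <= 0] = 0%E.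
Proof. by rewrite mu_norm_le// mulr0 expr0n. Qed.

(** On the ball of radius r the kernel is at least about r^-(N/p + s), and the
    product of this with the measure of the ball, of order r^N, tends to infinity
    as r tends to 0 when N/p + s > N. *)
Lemma trunc_kernel_singular s p M : 0 < s -> 1 <= p -> N%:R < N%:R / p + s -> 0 <= M ->
  exists (kappa b : R), exists B : set V,
   [/\ 0 < kappa, M < kappa * b, measurable B, mu B = b%:E &
     forall z, B z -> kappa <= trunc_kernel s p z].
Proof.
move=> s0 p1 sing M0.
set beta := N%:R / p + s in sing.
have N0 : 0 < N%:R :> R by rewrite ltr0n.
pose Q := (M + 1) * (N%:R / 2) ^+ N + 1.
have Q1 : 1 <= Q by rewrite /Q lerDr mulr_ge0 ?exprn_ge0 ?divr_ge0 ?addr_ge0.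
have Q0 : 0 < Q by exact: lt_le_trans Q1.
pose rho := Q `^ (- (beta - N%:R)^-1).
have bN : 0 < beta - N%:R by rewrite subr_gt0.
have rho0 : 0 < rho by rewrite powR_gt0.
have rho1 : rho <= 1.
  by rewrite /rho -[X in _ <= X](powRr0 Q) ler_powR// oppr_le0 invr_ge0 ltW.
have rhoQ : rho `^ (- (beta - N%:R)) = Q.
  by rewrite /rho -powRrM mulrNN mulVf ?gt_eqF// powRr1// ltW.
pose r := rho / N%:R.
have r0 : 0 < r by rewrite divr_gt0.
exists (rho `^ (- beta)), ((2 * r) ^+ N).
(* The origin, where the kernel vanishes by convention, is removed. *)
exists ([set z | `|z| <= r] `\` [set z : V | `|z| <= 0]); split.
- by rewrite powR_gt0.
- have -> : rho `^ (- beta) * (2 * r) ^+ N = Q * (2 / N%:R) ^+ N.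
    rewrite -rhoQ (_ : 2 * r = rho * (2 / N%:R)); last by rewrite /r mulrC -!mulrA (mulrC _ 2).
    rewrite exprMn mulrA; congr (_ * _).
    rewrite -powR_mulrn ?ltW// -powRD; first by congr powR; ring.
    by rewrite (gt_eqF rho0) implybT.
  have E : (N%:R / 2) ^+ N * (2 / N%:R) ^+ N = 1 :> R.
    by rewrite -exprMn (_ : _ * _ = 1) ?expr1n//; field; rewrite gt_eqF.
  rewrite /Q mulrDl -mulrA E mulr1 mul1r -addrA ltrDl addr_gt0// exprn_gt0// divr_gt0//.
- by apply: measurableD; exact: measurable_norm_le.
- rewrite -mu_norm_le ?(ltW r0)//.
  have m0 : measurable [set z : V | `|z| <= 0] by exact: measurable_norm_le.
  have mr : measurable [set z : V | `|z| <= r] by exact: measurable_norm_le.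
  have roo : (mu [set z : V | (`|z| <= r)%R] < +oo)%E by rewrite mu_norm_le ?(ltW r0)// ltry.
  have m00 : mu ([set z : V | (`|z| <= r)%R] `&` [set z : V | (`|z| <= 0)%R]) = 0%E.
    apply/eqP; rewrite eq_le; apply/andP; split; last exact: measure_ge0.
    by rewrite -mu0_set1; apply: le_measure; rewrite ?inE//; exact: measurableI.
  transitivity (mu [set z : V | (`|z| <= r)%R] -
      mu ([set z : V | (`|z| <= r)%R] `&` [set z : V | (`|z| <= 0)%R]))%E.
    exact: measureD.
  by rewrite m00 sube0.
- move=> z [/= zr /negP]; rewrite -ltNge => z0.
  have e0 : 0 < enorm z by exact: lt_le_trans (norm_le_enorm z).
  have er : enorm z <= rho.
    apply: le_trans (enorm_le_norm z) _; apply: (@le_trans _ _ (N%:R * r)).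
      by rewrite ler_wpM2l// ltW.
    by rewrite /r mulrCA divff ?mulr1// gt_eqF.
  have e1 : enorm z <= 1 by exact: le_trans rho1.
  rewrite trunc_kernel_near ?e0// !powRN lef_pV2 ?posrE ?powR_gt0//.
  have b0 : 0 <= beta by rewrite (le_trans (ltW N0))// ltW.
  by rewrite ge0_ler_powR ?nnegrE ?(ltW e0) ?(ltW rho0).
Qed.

Lemma cheeger_le Om s M E : (M%:E <= cheeger Om s)%E -> 0 <= M ->
  measurable E -> E `<=` Om -> (mu E < +oo)%E ->
  (M%:E * mu E <= energy (frac_kernel s 1) \1_E)%E.
Proof.
move=> MOm M0 mE EOm Eoo.
have [->|E0] := eqVneq (mu E) 0%E.
  by rewrite mule0 energy_ge0// => k; exact: frac_kernel_ge0.
have Egt0 : (0 < mu E)%E by rewrite lt_neqAle eq_sym E0 measure_ge0.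
have fE : mu E \is a fin_num by rewrite ge0_fin_numE.
have : (M%:E <= s_perimeter s E / mu E)%E.
  apply: le_trans MOm _; apply: ereal_inf_lbound; exists E => //.
have f0 : (0 < fine (mu E))%R by rewrite fine_gt0// Egt0.
by rewrite s_perimeterE// -(fineK fE) inver gt_eqF// lee_pdivlMr.
Qed.

(** If this fails, then it fails for a sequence P k decreasing to 1, each time for
    a set E k.  The indicators of the E k show that the sets C k below are not
    empty, and [nested_convex] provides a common element f.  Then
    M' int f <= energy (frac_kernel s 1) f <= M int f for some M' > M, by [coarea]
    and [energy_frac_le], although int f > 0. *)
Lemma trunc_cheeger Om s M : measurable Om -> (mu Om < +oo)%E -> 0 < s -> 0 <= M ->
  (M%:E < cheeger Om s)%E ->
  exists2 p0, 1 < p0 & forall p E, 1 <= p <= p0 -> measurable E -> E `<=` Om ->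
    (M%:E * mu E <= energy (trunc_kernel s p) \1_E)%E.
Proof.
move=> mOm Omoo s0 M0 MOm.
apply: contrapT => /forall2NP H.
have N0 : 0 < N%:R :> R by rewrite ltr0n.
(* With P 0 = 1 + s/N, all the P k satisfy N / P k + s > N, as N/p + s > N is
   p < N / (N - s) when s < N, and 1 + s/N < N / (N - s). *)
pose delta := s / N%:R.
have d0 : 0 < delta by rewrite divr_gt0.
pose P (k : nat) := 1 + delta / k.+1%:R.
have P1 k : 1 < P k by rewrite /P ltrDl divr_gt0.
have P1' k : 1 <= P k by exact: ltW.
have Pd : {homo P : i j / (i <= j)%N >-> j <= i}.
  move=> i j ij; rewrite /P lerD2l ler_wpM2l ?(ltW d0)// lef_pV2 ?posrE// ler_nat ltnS//.
have Pl : P @ \oo --> (1 : R).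
  rewrite -[X in _ --> X]addr0; apply: cvgD; first exact: cvg_cst.
  rewrite -(mulr0 delta); apply: cvgMr; exact: cvg_harmonic.
have sing : N%:R < N%:R / P 0%N + s.
  have P00 : 0 < P 0%N by exact: lt_le_trans (P1' _).
  have P0E : P 0%N = 1 + delta by rewrite /P divr1.
  have Nd : N%:R * delta = s by rewrite /delta mulrCA divff ?mulr1// gt_eqF.
  have sd : 0 < s * delta by rewrite mulr_gt0.
  by rewrite -(ltr_pM2r P00) mulrDl divfK ?gt_eqF// P0E !mulrDr !mulr1 Nd ltrD2l ltrDl.
have [kappa [b [B [k0 Mkb mB muB HB]]]] := trunc_kernel_singular s0 (P1' 0%N) sing M0.
have /choice[E hE] k : exists E, [/\ measurable E, E `<=` Om &
    (energy (trunc_kernel s (P k)) \1_E < M%:E * mu E)%E].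
  have [|Hk] := H (P k); first by rewrite P1.
  apply: contrapT => Hn; refine (Hk _).
  move=> p F /andP[p1 pk] mF FOm.
  rewrite leNgt; apply/negP => hlt; apply: Hn; exists F; split; [exact: mF|exact: FOm|].
  apply: le_lt_trans hlt; apply: le_energy => z; first exact: trunc_kernel_ge0.
  exact: trunc_kernel_mono.
(* From kappa |E| (b - |E|) <= energy 1_E < M |E|. *)
pose c := b - M / kappa.
have c0 : 0 < c by rewrite subr_gt0 ltr_pdivrMr// mulrC.
have Efin k : mu (E k) \is a fin_num.
  have [mE EOm _] := hE k; rewrite ge0_fin_numE//; apply: le_lt_trans Omoo.
  by apply: le_measure => //; rewrite inE.
have Ec k : (c%:E <= mu (E k))%E.
  have [mE EOm hlt] := hE k.
  have T0 z := trunc_kernel_ge0 s (P k) z.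
  have := mu_isoperimetric (ltW k0) T0 (measurable_trunc_kernel s (P k)) mE mB
    (fun z Bz => le_trans (HB z Bz) (trunc_kernel_mono z s0 (P1' k) (Pd _ _ (leq0n k)))).
  move=> /le_lt_trans /(_ (lte_leD _ hlt (lexx _))) => /(_ ltac:(by rewrite !fin_numM)).
  rewrite -(fineK (Efin k)) muB -!EFinM -EFinD lte_fin lee_fin.
  set e := fine (mu (E k)) => h.
  have e0 : 0 < e.
    rewrite lt_neqAle fine_ge0 ?measure_ge0// andbT; apply/eqP => e0.
    by move: h; rewrite -e0 !mulr0 !mul0r addr0 ltxx.
  have : kappa * b < M + kappa * e.
    rewrite -(ltr_pM2r e0) mulrDl; move: h; rewrite -!mulrA (mulrC e b); exact.
  rewrite /c lerBlDr => h2; apply/ltW.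
  rewrite -(ltr_pM2l k0) mulrDr (_ : kappa * (M / kappa) = M)//; first by rewrite addrC.
  by field; rewrite gt_eqF.
pose C k (f : V -> R) := [/\ density Om f,
   (energy (trunc_kernel s (P k)) f <= M%:E * \int[mu]_x (f x)%:E)%E &
   (c%:E <= \int[mu]_x (f x)%:E)%E].
have mT k : measurable_fun setT (trunc_kernel s (P k) : V -> R) by exact: measurable_trunc_kernel.
have T0 k (z : V) : 0 <= trunc_kernel s (P k) z by exact: trunc_kernel_ge0.
have mE (f : V -> R) : measurable_fun setT f -> measurable_fun setT (fun x => (f x)%:E).
  by move=> mf; exact/measurable_EFinP.
have [f [[mf f01 fOm] Cf]] : exists f, density Om f /\ forall k, C k f.
  apply: (@nested_convex _ _ R mu Om mOm C Omoo).
  - by move=> k f [].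
  - move=> k; exists \1_(E k); have [mEk EOm hlt] := hE k; split.
    + split; first exact: measurable_indic.
        by move=> x; rewrite indicE; case: (_ \in _); rewrite ?lexx ?ler01.
      move=> x Ox; rewrite indicE memNset// => Ex; exact/Ox/EOm.
    + by rewrite integral_indic// setIT; exact: ltW.
    + by rewrite integral_indic// setIT; exact: Ec.
  - move=> k f [df h1 h2]; split; [exact: df| |exact: h2]; apply: le_trans h1.
    apply: le_energy => z; first exact: T0.
    exact: trunc_kernel_mono (Pd _ _ (leqnSn k)).
  - move=> k f g [[mf f01 fOm] f1 f2] [[mg g01 gOm] g1 g2].
    have mm := measurable_midpoint mf mg.
    have m01 x : 0 <= midpoint f g x <= 1.
      have /andP[a1 a2] := f01 x; have /andP[b1 b2] := g01 x.
      by rewrite /midpoint; apply/andP; split; lra.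
    have I2 : (2%:E * \int[mu]_x (midpoint f g x)%:E = \int[mu]_x (f x)%:E + \int[mu]_x (g x)%:E)%E.
      rewrite -(ge0_integralZl mu measurableT (mE _ mm))//; last first.
        by move=> x _; rewrite lee_fin; have /andP[] := m01 x.
      rewrite -(ge0_integralD mu measurableT _ (mE _ mf) _ (mE _ mg)).
      + by apply: eq_integral => x _; rewrite -EFinM -EFinD /midpoint; congr EFin; field.
      + by move=> x _; rewrite lee_fin; have /andP[] := f01 x.
      + by move=> x _; rewrite lee_fin; have /andP[] := g01 x.
    split.
    + by split => // x Ox; rewrite /midpoint fOm// gOm// addr0 mul0r.
    + rewrite -(@lee_pmul2l _ 2%:E)// (le_trans (energy_midpoint (T0 k) (mT k) mf mg))//.
      rewrite muleCA I2 ge0_muleDr; first exact: leeD.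
      * by apply: integral_ge0 => x _; rewrite lee_fin; have /andP[] := f01 x.
      * by apply: integral_ge0 => x _; rewrite lee_fin; have /andP[] := g01 x.
    + rewrite -(@lee_pmul2l _ 2%:E)// I2 (_ : 2%:E * c%:E = c%:E + c%:E)%E; first exact: leeD.
      by rewrite -EFinM -EFinD; congr EFin; ring.
  - move=> k f g Cf dg fg.
    have [mg g01 gOm] := dg.
    have mf j : measurable_fun setT (f j) by have [[]] := Cf j.
    have f0 j x : 0 <= f j x by have [[_ /(_ x)/andP[] ]] := Cf j.
    have g0 x : 0 <= g x by have /andP[] := g01 x.
    split; [exact: dg| |].
    + apply: le_trans (energy_lsc (T0 k) (mT k) mf mg fg) _.
      apply: limn_einf_le => e e0.
      have M10 : 0 < M + 1 by rewrite ltr_wpDl.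
      have [j0 hj0] := fg (e / (M + 1)) (divr_gt0 e0 M10).
      exists j0 => j /hj0 h; have [_ h1 _] := Cf j.
      apply: (le_trans h1).
      have h2 := integral_le_dist1 (mf j) mg (f0 j) g0.
      apply: (@le_trans _ _ (M%:E * (\int[mu]_x (g x)%:E + dist1 mu (f j) g))%E).
        by rewrite lee_wpmul2l ?lee_fin.
      have Ig0 : (0 <= \int[mu]_x (g x)%:E)%E by apply: integral_ge0 => x _; rewrite lee_fin.
      rewrite ge0_muleDr ?dist1_ge0//.
      rewrite leeD2l//; apply: (@le_trans _ _ (M%:E * (e / (M + 1))%:E)%E).
        by rewrite lee_wpmul2l ?lee_fin.
      rewrite -EFinM lee_fin mulrCA ler_piMr ?(ltW e0)// ler_pdivrMr// mul1r; lra.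
    + apply/lee_addgt0Pr => e e0; have [j0 hj0] := fg e e0.
      have [_ _ h2] := Cf j0; apply: le_trans h2 _.
      apply: le_trans (integral_le_dist1 (mf j0) mg (f0 j0) g0) _.
      by rewrite leeD2l// hj0.
have f0 x : 0 <= f x by have /andP[] := f01 x.
have En : (energy (frac_kernel s 1) f <= M%:E * \int[mu]_x (f x)%:E)%E.
  by apply: (energy_frac_le s0 P1' Pd Pl mf) => k; have [] := Cf k.
have [M' MM' /ltW M'Om] := lt_ereal_real MOm.
have M'0 : 0 <= M' by rewrite (le_trans M0)// ltW.
have mK : measurable_fun setT (frac_kernel s 1 : V -> R) by exact: measurable_frac_kernel.
have If : (\int[mu]_x (f x)%:E \is a fin_num)%E.
  have If0 : (0 <= \int[mu]_x (f x)%:E)%E by apply: integral_ge0 => x _; rewrite lee_fin.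
  rewrite ge0_fin_numE//; apply: le_lt_trans Omoo.
  rewrite -[Om]setIT -integral_indic//; apply: le_int => x; first by rewrite lee_fin.
  rewrite lee_fin indicE; have [Ox|/negP] := boolP (x \in Om).
    by have /andP[] := f01 x.
  by rewrite inE => /fOm ->.
have := coarea M'0 (fun z => frac_kernel_ge0 s 1 z) mK mf f0 fOm.
have Hc F : measurable F -> F `<=` Om -> (M'%:E * mu F <= energy (frac_kernel s 1) \1_F)%E.
  move=> mF FOm; apply: (cheeger_le M'Om) => //; apply: le_lt_trans Omoo.
  by apply: le_measure => //; rewrite inE.
move=> /(_ Hc) /le_trans /(_ En).
have [_ _ cf] := Cf 0%N; move: cf.
rewrite -(fineK If) -!EFinM !lee_fin => cf; rewrite ler_pM2r; first by rewrite leNgt MM'.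
exact: lt_le_trans cf.
Qed.
End lower_bound.

(** * Smooth bump functions on the line *)

Section quadratic_remainder.
Variables (R : realType) (V : normedModType R).

(** A quadratic bound on the remainder gives the derivative; in this form the
    hypothesis integrates against any integrable function. *)
Lemma is_derive_quad (f : V -> R) (x v : V) (d C : R) :
  (forall h : R, `|f (h *: v + x) - f x - h * d| <= C * h ^+ 2) -> is_derive x v f d.
Proof.
move=> H.
have cv : h^-1 *: (f (h *: v + x) - f x) @[h --> 0^'] --> d.
  apply/cvgrPdist_le => e e0.
  have C0 : 0 < `|C| + 1 by rewrite ltr_wpDl.
  near=> h.
  have hn0 : h != 0 by near: h; exact: nbhs_dnbhs_neq.
  have he : `|h| <= e / (`|C| + 1).
    by near: h; apply: dnbhs0_le; rewrite divr_gt0.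
  have -> : d - h^-1 *: (f (h *: v + x) - f x) = - h^-1 * (f (h *: v + x) - f x - h * d).
    by rewrite [_ *: _]/GRing.scale /=; field.
  rewrite normrM normrN normfV ler_pdivrMl ?normr_gt0//.
  apply: le_trans (H h) _.
  apply: (@le_trans _ _ ((`|C| + 1) * h ^+ 2)).
    by rewrite ler_wpM2r ?sqr_ge0// (le_trans (ler_norm C))// lerDl.
  rewrite -[h ^+ 2]ger0_norm ?sqr_ge0// normrX expr2 mulrCA ler_wpM2l// mulrC.
  by rewrite -ler_pdivlMr.
by split; [apply/cvg_ex; exists d|exact: cvg_lim].
Unshelve. all: by end_near. Qed.
End quadratic_remainder.

Section flat.
Variable R : realType.
Implicit Types (P : {poly R}) (t x : R).

Lemma expr_le_expR (k : nat) x : 0 <= x -> x ^+ k <= k%:R ^+ k * expR x.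
Proof.
move=> x0; case: k => [|k].
  by rewrite !expr0 mul1r (le_trans _ (expR_ge1Dx x))// lerDl.
have k0 : 0 < k.+1%:R :> R by [].
have -> : expR x = expR (x / k.+1%:R) ^+ k.+1.
  by rewrite -expRM_natl mulrC divfK// gt_eqF.
rewrite -exprMn lerXn2r ?nnegrE ?mulr_ge0 ?expR_ge0//.
rewrite -ler_pdivrMl// mulrC (le_trans _ (expR_ge1Dx _))// lerDr//.
Qed.

Lemma poly_le_expR P (k : nat) : exists C, forall x, 0 <= x -> `|P.[x]| * x ^+ k <= C * expR x.
Proof.
elim/poly_ind: P k => [|P c IH] k.
  by exists 0 => x _; rewrite horner0 normr0 !mul0r.
have [C hC] := IH k.+1.
exists (C + `|c| * k%:R ^+ k) => x x0; rewrite hornerMXaddC mulrDl.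
apply: (@le_trans _ _ (`|P.[x]| * x ^+ k.+1 + `|c| * x ^+ k)).
  rewrite exprS mulrA -mulrDl ler_wpM2r ?exprn_ge0// (le_trans (ler_normD _ _))//.
  by rewrite normrM (ger0_norm x0).
by rewrite lerD ?hC// -mulrA ler_wpM2l// expr_le_expR.
Qed.

(** The functions P(1/t) exp(-1/t), extended by 0 for t <= 0, are closed under
    derivation; this is how the smoothness of exp(-1/t) at 0 is obtained. *)
Definition flat P t : R := if 0 < t then P.[t^-1] * expR (- t^-1) else 0.

Lemma flat_is_derive P t : is_derive t 1 (flat P) (flat ('X^2 * (P - P^`())) t).
Proof.
have [t0|t0|t0] := ltrgtP t 0.
- have -> : flat ('X^2 * (P - P^`())) t = 0 by rewrite /flat ltNge (ltW t0).
  apply: (@near_eq_is_derive _ _ _ (cst 0)).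
  near=> z; rewrite /flat ltNge (_ : z <= 0)//.
  by apply: ltW; near: z; exact: lt_nbhsl.
- apply: (@near_eq_is_derive _ _ _ (fun t => P.[t^-1] * expR (- t^-1))).
  + near=> z; rewrite /flat (_ : 0 < z)//.
    by near: z; exact: lt_nbhsr.
  + have tn0 : t != 0 by rewrite gt_eqF.
    have dV : is_derive t 1 (fun t : R => t^-1) (- t^-2 *: 1).
      exact: (@is_deriveV R id t 1 1).
    have dP : is_derive t 1 (fun t : R => P.[t^-1]) (P^`().[t^-1] * (- t^-2 *: 1)).
      exact: (@is_derive1_comp R (horner P) (fun t : R => t^-1)).
    have dE : is_derive t 1 (fun t : R => expR (- t^-1)) (expR (- t^-1) * - (- t^-2 *: 1)).
      exact: (@is_derive1_comp R expR (fun t : R => - t^-1)).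
    apply: is_derive_eq.
    rewrite /flat t0 hornerM hornerXn hornerD hornerN.
    by rewrite /GRing.scale/=; field.
- have [C hC] := poly_le_expR P 2; rewrite t0.
  have C0 : 0 <= C.
    have := hC 0 (lexx 0); rewrite expR0 mulr1; apply: le_trans.
    by rewrite mulr_ge0// exprn_ge0.
  apply: (@is_derive_quad R R _ _ _ _ C) => h.
  rewrite [_ *: _]mulr1 addr0 /flat ltxx mulr0 !subr0.
  case: ltP => h0; last by rewrite normr0 mulr_ge0// sqr_ge0.
  have hi : 0 <= h^-1 by rewrite invr_ge0 ltW.
  have := hC _ hi; rewrite normrM (ger0_norm (expR_ge0 _)) expRN.
  rewrite -ler_pdivlMr ?exprn_gt0 ?invr_gt0// exprVn invrK => h1.
  rewrite ler_pdivrMr ?expR_gt0// mulrAC; exact: h1.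
Unshelve. all: by end_near. Qed.

(** Continuous differentiability of order m, in a form suited to induction: the
    derivative is given as a function. *)
Fixpoint Cn (m : nat) (f : R -> R) : Prop :=
  if m is m'.+1 then exists2 f', (forall t, is_derive t (1 : R) f (f' t)) & Cn m' f'
  else continuous f.

Definition Cinf f := forall m, Cn m f.

Lemma is_derive_continuous (f f' : R -> R) : (forall t, is_derive t (1 : R) f (f' t)) -> continuous f.
Proof.
move=> df t; apply: differentiable_continuous; apply/derivable1_diffP.
by have [] := df t.
Qed.

Lemma CnW m f : Cn m.+1 f -> Cn m f.
Proof.
elim: m f => [|m IH] f [f' df cf']; first exact: is_derive_continuous df.
by exists f' => //; exact: IH.
Qed.

Lemma Cn_flat m P : Cn m (flat P).
Proof.
elim: m P => [|m IH] P; first exact: is_derive_continuous (flat_is_derive P).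
by exists (flat ('X^2 * (P - P^`()))) => // t; exact: flat_is_derive.
Qed.

Lemma Cn_add m f g : Cn m f -> Cn m g -> Cn m (f \+ g).
Proof.
elim: m f g => [|m IH] f g.
  by move=> cf cg t; apply: cvgD; [exact: cf|exact: cg].
move=> [f' df cf] [g' dg cg]; exists (f' \+ g'); last exact: IH.
by move=> t; exact: is_deriveD.
Qed.

Lemma Cn_mul m f g : Cn m f -> Cn m g -> Cn m (f \* g).
Proof.
elim: m f g => [|m IH] f g.
  by move=> cf cg t; apply: cvgM; [exact: cf|exact: cg].
move=> Cf Cg; have [f' df cf] := Cf; have [g' dg cg] := Cg.
exists ((f \* g') \+ (g \* f')).
  by move=> t; exact: is_deriveM.
by apply: Cn_add; apply: IH => //; exact: CnW.
Qed.

Lemma Cn_cst m (c : R) : Cn m (cst c).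
Proof.
elim: m c => [|m IH] c; first exact: cst_continuous.
by exists (cst 0) => // t; exact: is_derive_cst.
Qed.

Lemma Cn_affine m (a b : R) f : Cn m f -> Cn m (fun t => f (a * t + b)).
Proof.
elim: m f => [|m IH] f.
  move=> cf t; apply: (@continuous_comp _ _ _ (fun t : R => a * t + b) f); last exact: cf.
  apply: cvgD; last exact: cvg_cst.
  by apply: cvgMr; exact: cvg_id.
move=> [f' df cf]; exists ((fun t => f' (a * t + b)) \* cst a).
  move=> t; apply: (@is_derive1_comp R f (fun t : R => a * t + b)).
  apply: is_derive_eq; rewrite /GRing.scale/=; ring.
by apply: Cn_mul; [exact: IH|exact: Cn_cst].
Qed.

Lemma Cinf_derivatives f : Cinf f -> exists B : nat -> R -> R,
  [/\ B 0%N = f, (forall m t, is_derive t (1 : R) (B m) (B m.+1 t)) & forall m, continuous (B m)].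
Proof.
move=> Cf; exists (fun m => derive1n m f).
have H m : Cinf (derive1n m f).
  elim: m => [|m IH]//; rewrite derive1nS => k.
  have [f' df cf] := IH k.+1; rewrite (_ : derive1 _ = f')//.
  by apply/funext => t; rewrite derive1E; exact: derive_val.
split => // [m t|m]; last exact: (H m 0%N).
have [f' df cf] := H m 1%N; rewrite derive1nS derive1E.
by apply: DeriveDef => //; have [] := df t.
Qed.

(** The product of flat 1 (t - (v - r)) and flat 1 (v + r - t), together with the
    sequence B of its derivatives; these are bounded because they are continuous
    and vanish outside a segment. *)
Lemma exists_bump (v r : R) : 0 < r -> exists B : nat -> R -> R,
  [/\ (forall m t, is_derive t (1 : R) (B m) (B m.+1 t)), (forall t, 0 <= B 0%N t),
      (forall t, 0 < B 0%N t <-> `|t - v| < r) & forall m, exists C, forall t, `|B m t| <= C].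
Proof.
move=> r0.
pose b (t : R) := flat 1 (1 * t + (r - v)) * flat 1 (- 1 * t + (r + v)).
have Cb : Cinf b by move=> m; apply: Cn_mul; apply: Cn_affine; exact: Cn_flat.
have flat0 t : 0 <= flat 1 t.
  by rewrite /flat; case: ifP => // _; rewrite hornerC mul1r expR_ge0.
have flatgt t : (0 < flat 1 t) = (0 < t).
  by rewrite /flat; case: ifP => // _; rewrite ?ltxx// hornerC mul1r expR_gt0.
have bE t : 0 < b t <-> `|t - v| < r.
  rewrite /b; split.
    rewrite lt_neqAle eq_sym mulf_eq0 negb_or => /andP[/andP[h1 h2] _].
    have : 0 < flat 1 (1 * t + (r - v)) by rewrite lt_neqAle eq_sym h1 flat0.
    have : 0 < flat 1 (- 1 * t + (r + v)) by rewrite lt_neqAle eq_sym h2 flat0.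
    rewrite !flatgt ltr_norml => ? ?; apply/andP; split; lra.
  by rewrite ltr_norml => /andP[? ?]; rewrite mulr_gt0// flatgt; lra.
have [B [B0 dB cB]] := Cinf_derivatives Cb.
exists B; split => // [t|t|m].
- by rewrite B0 mulr_ge0.
- by rewrite B0.
have Bout : forall m t, r < `|t - v| -> B m t = 0.
  elim=> [|k IH] t ht.
    rewrite B0; apply/eqP; rewrite eq_le mulr_ge0// andbT leNgt; apply/negP => /bE h.
    by have := lt_trans ht h; rewrite ltxx.
  have [_ <-] := dB k t.
  rewrite (@near_eq_derive _ _ _ _ (cst 0)); first by rewrite derive_cst.
  near=> z; apply: IH; near: z.
  apply: (@open_nbhs_nbhs _ t); split => //.
  apply: (@open_comp _ _ (fun z : R => `|z - v|) [set x | r < x]); last exact: open_gt.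
  by move=> z _; apply: cvg_norm; apply: cvgB; [exact: cvg_id|exact: cvg_cst].
have vr : v - r <= v + r by lra.
have cw : {within `[v - r, v + r], continuous (fun t => `|B m t|)}.
  apply: continuous_subspaceT => t.
  by apply: cvg_norm; exact: cB.
have [c cin cmax] := EVT_max vr cw.
exists `|B m c| => t.
have [tin|tout] := boolP (t \in `[v - r, v + r]); first exact: cmax.
rewrite Bout ?normr0//.
move: tout; rewrite in_itv/= negb_and -!ltNge => /orP[h|h].
  by rewrite distrC gtr0_norm; lra.
by rewrite gtr0_norm; lra.
Unshelve. all: by end_near. Qed.
End flat.

(** * Smoothness of convolutions *)

Section taylor.
Variable R : realType.
Implicit Types f : R -> R.

Lemma mvt_global f (f' : R -> R) a b : (forall t, is_derive t (1 : R) f (f' t)) ->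
  exists c, f b - f a = f' c * (b - a) /\ `|c - a| <= `|b - a|.
Proof.
move=> df; have cf := is_derive_continuous df.
have [ab|ba] := leP a b.
  have [c] := MVT_segment ab (fun x _ => df x) (continuous_subspaceT cf).
  rewrite in_itv/= => /andP[ac cb] E; exists c; split => //.
  by rewrite !ger0_norm ?subr_ge0// lerD2r.
have [c] := MVT_segment (ltW ba) (fun x _ => df x) (continuous_subspaceT cf).
rewrite in_itv/= => /andP[bc ca] E; exists c; split; first by rewrite -opprB E; ring.
by rewrite ![`|_ - a|]distrC !ger0_norm ?subr_ge0 ?(ltW ba)// lerD2l lerN2.
Qed.

Lemma lipschitz_of_derive f (f' : R -> R) C a b : (forall t, is_derive t (1 : R) f (f' t)) ->
  (forall t, `|f' t| <= C) -> `|f b - f a| <= C * `|b - a|.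
Proof. by move=> df fC; have [c [-> _]] := mvt_global a b df; rewrite normrM ler_wpM2r. Qed.

Lemma taylor_remainder f (f' f'' : R -> R) C t h : (forall t, is_derive t (1 : R) f (f' t)) ->
  (forall t, is_derive t (1 : R) f' (f'' t)) ->
  (forall t, `|f'' t| <= C) -> `|f (t + h) - f t - h * f' t| <= C * h ^+ 2.
Proof.
move=> df df' fC; have [c [-> hc]] := mvt_global t (t + h) df.
rewrite addrAC subrr add0r in hc *.
rewrite (mulrC h) -mulrBl normrM -[h ^+ 2]ger0_norm ?sqr_ge0// normrX expr2 mulrA ler_wpM2r//.
apply: le_trans (lipschitz_of_derive t c df' fC) _.
by rewrite ler_wpM2l// (le_trans _ (fC 0)).
Qed.
End taylor.

Section convolution.
Variables (R : realType) (n : nat).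
Local Notation N := n.+1.
Local Notation mu := (@lebesgue_rV R N).
Local Notation V := 'rV[R]_N.
Implicit Types (g rho : V -> R) (x y : V).

Definition bounded_by (C : R) rho := forall x, `|rho x| <= C.

Definition bounded_lipschitz rho :=
  exists C, bounded_by C rho /\ forall x y, `|rho x - rho y| <= C * `|x - y|.

Lemma bounded_lipschitz_cst (c : R) : bounded_lipschitz (cst c).
Proof.
exists `|c|; split => [x|x y]//=.
by rewrite subrr normr0 mulr_ge0.
Qed.

Lemma bounded_lipschitzM rho1 rho2 : bounded_lipschitz rho1 -> bounded_lipschitz rho2 ->
  bounded_lipschitz (rho1 \* rho2).
Proof.
move=> [C1 [b1 l1]] [C2 [b2 l2]].
have C10 : 0 <= C1 by rewrite (le_trans _ (b1 0)).
have C20 : 0 <= C2 by rewrite (le_trans _ (b2 0)).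
have C120 : 0 <= C1 * C2 by rewrite mulr_ge0.
exists (C1 * C2 + C1 * C2); split => [x|x y] /=.
  by rewrite normrM (@le_trans _ _ (C1 * C2))// ?lerDl// ler_pM.
have -> : rho1 x * rho2 x - rho1 y * rho2 y = rho1 x * (rho2 x - rho2 y) + (rho1 x - rho1 y) * rho2 y by ring.
rewrite (le_trans (ler_normD _ _))// !normrM mulrDl lerD//.
  by rewrite -mulrA ler_pM.
by rewrite mulrAC ler_pM.
Qed.

Lemma bounded_lipschitz_prod (I : Type) (r : seq I) (F : I -> V -> R) :
  (forall i, bounded_lipschitz (F i)) -> bounded_lipschitz (fun x => \prod_(i <- r) F i x).
Proof.
move=> H; elim: r => [|i r IH].
  by under eq_fun do rewrite big_nil; exact: bounded_lipschitz_cst.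
under eq_fun do rewrite big_cons.
exact: (bounded_lipschitzM (H i) IH).
Qed.

Lemma bounded_lipschitz_continuous rho : bounded_lipschitz rho -> continuous rho.
Proof.
move=> [C [b l]] x; have FF := nbhs_filter x.
suff : rho y @[y --> x] --> rho x by [].
apply/cvgrPdist_le => e e0.
have C0 : 0 <= C by rewrite (le_trans _ (b 0)).
have C1 : 0 < C + 1 by rewrite ltr_wpDl.
have := @nbhsx_ballx R V x _ (divr_gt0 e0 C1); apply: filterS => y.
rewrite -ball_normE /= => /ltW h.
apply: le_trans (l x y) _; apply: (@le_trans _ _ ((C + 1) * `|x - y|)).
  by rewrite ler_wpM2r// lerDl.
by rewrite mulrC -ler_pdivlMr.
Qed.

Lemma bounded_lipschitz_measurable rho : bounded_lipschitz rho -> measurable_fun setT rho.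
Proof. by move=> /bounded_lipschitz_continuous; exact: rV_continuous_measurable. Qed.

Definition convol g rho x : R := (\int[mu]_w (g w * rho (x - w)))%R.

Definition integrable_rV g := mu.-integrable setT (EFin \o g).

Lemma integrable_convolution g rho x : integrable_rV g -> bounded_lipschitz rho ->
  mu.-integrable setT (EFin \o (fun w => g w * rho (x - w))).
Proof.
move=> ig bl; have [C [b l]] := bl.
have mg : measurable_fun setT g by have /integrableP[/measurable_EFinP] := ig.
have mr : measurable_fun setT (fun w : V => rho (x - w)).
  apply: (measurableT_comp (bounded_lipschitz_measurable bl)).
  by apply: measurable_rV_add => //; exact: measurable_rV_opp.
have iC : mu.-integrable setT (fun w => (C%:E * (EFin \o g) w)%E) by exact: integrableZl.
apply: le_integrable iC => //.
  by apply/measurable_EFinP; exact: measurable_funM.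
move=> w _; rewrite /= lee_fin !normrM mulrC ler_wpM2r//.
by rewrite (le_trans (b _))// ler_norm.
Qed.

Definition abs_mass g : R := (\int[mu]_w `|g w|)%R.

Lemma weighted_integral_le g (D : V -> R) (F C : R) :
  integrable_rV g -> mu.-integrable setT (EFin \o (fun w => g w * D w)) ->
  F = (\int[mu]_w (g w * D w))%R -> (forall w, `|D w| <= C) ->
  `|F| <= C * abs_mass g.
Proof.
move=> ig ic -> DC.
have ia : mu.-integrable setT (EFin \o (fun w => `|g w|)) by exact: integrable_norm ig.
apply: le_trans (le_normr_Rintegral _ ic) _ => //.
rewrite /abs_mass -RintegralZl//; apply: le_Rintegral => //.
- exact: integrable_norm ic.
- exact: (integrableZl measurableT C ia).
- by move=> w _; rewrite normrM mulrC ler_wpM2r.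
Qed.

Lemma conv_bounded_lipschitz g rho : integrable_rV g -> bounded_lipschitz rho ->
  bounded_lipschitz (convol g rho).
Proof.
move=> ig bl; have [C [b l]] := bl; exists (C * abs_mass g); split => [x|x y].
  by apply: (weighted_integral_le ig (integrable_convolution x ig bl)) => // w.
rewrite mulrAC; apply: (@weighted_integral_le g (fun w => rho (x - w) - rho (y - w)) _ _ ig) => //.
- have := integrableB measurableT (integrable_convolution x ig bl) (integrable_convolution y ig bl).
  by apply: eq_integrable => // w _ /=; rewrite -EFinB mulrBr.
- rewrite -RintegralB//; try exact: integrable_convolution.
  by apply: eq_Rintegral => w _; rewrite mulrBr.
- by move=> w; rewrite (le_trans (l _ _))// opprB addrA subrK.
Qed.

(** Integrating the quadratic bound on the remainder of rho against g avoids any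
    theorem on derivation under the integral sign. *)
Lemma conv_is_derive g rho rho' (v : V) x : integrable_rV g -> bounded_lipschitz rho ->
  bounded_lipschitz rho' ->
  (exists C, forall x h, `|rho (h *: v + x) - rho x - h * rho' x| <= C * h ^+ 2) ->
  is_derive x v (convol g rho) (convol g rho' x).
Proof.
move=> ig bl bl' [C hC]; apply: (@is_derive_quad R V _ _ _ _ (C * abs_mass g)) => h.
rewrite mulrAC.
have i1 := integrable_convolution (h *: v + x) ig bl.
have i2 := integrable_convolution x ig bl.
have i3 := integrable_convolution x ig bl'.
have i3h : mu.-integrable setT (EFin \o (fun w => h * (g w * rho' (x - w)))).
  exact: (integrableZl measurableT h i3).
have i12 : mu.-integrable setT (EFin \o (fun w => g w * rho (h *: v + x - w) - g w * rho (x - w))).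
  exact: (integrableB measurableT i1 i2).
have i123 : mu.-integrable setT (EFin \o (fun w => g w * rho (h *: v + x - w) - g w * rho (x - w) - h * (g w * rho' (x - w)))).
  exact: (integrableB measurableT i12 i3h).
apply: (@weighted_integral_le g (fun w => rho (h *: v + (x - w)) - rho (x - w) - h * rho' (x - w)) _ _ ig) => //.
- by apply: eq_integrable i123 => // w _ /=; rewrite addrA; congr EFin; ring.
- rewrite /convol -RintegralZl// -RintegralB// -RintegralB//.
  by apply: eq_Rintegral => w _; rewrite addrA; ring.
Qed.
End convolution.

(** Products of one-dimensional smooth functions are stable under partial
    derivatives: deriving in direction i shifts the i-th order a i by one.  So all
    the iterated derivatives of a convolution with such a product are of the same
    form. *)
Section product_kernel.
Variables (R : realType) (n : nat).
Local Notation N := n.+1.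
Local Notation V := 'rV[R]_N.
Variable B : 'I_N -> nat -> R -> R.
Hypothesis dB : forall j m t, is_derive t (1 : R) (B j m) (B j m.+1 t).
Hypothesis bB : forall j m, exists C, forall t, `|B j m t| <= C.
Implicit Types (a : 'I_N -> nat) (x : V).

Definition prodB a x : R := \prod_j B j (a j) (x ord0 j).

Definition incr_at a (i : 'I_N) : 'I_N -> nat := fun j => (a j + (j == i))%N.

Lemma factor_bounded_lipschitz j m : bounded_lipschitz (fun x : V => B j m (x ord0 j)).
Proof.
have [C hC] := bB j m; have [C' hC'] := bB j m.+1.
have C0 : 0 <= C by rewrite (le_trans _ (hC 0)).
have C'0 : 0 <= C' by rewrite (le_trans _ (hC' 0)).
exists (C + C'); split => [x|x y].
  by rewrite (le_trans (hC _))// lerDl.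
apply: le_trans (lipschitz_of_derive _ _ (dB j m) hC') _.
apply: ler_pM => //; first by rewrite lerDr.
by have := le_coord_norm (x - y) j; rewrite !mxE.
Qed.

Lemma prodB_bounded_lipschitz a : bounded_lipschitz (prodB a).
Proof. by apply: bounded_lipschitz_prod => j; exact: factor_bounded_lipschitz. Qed.

Lemma prodB_taylor a i : exists C, forall x h,
  `|prodB a (h *: delta_mx ord0 i + x) - prodB a x - h * prodB (incr_at a i) x| <= C * h ^+ 2.
Proof.
have [C2 hC2] := bB i (a i).+2.
have C20 : 0 <= C2 by rewrite (le_trans _ (hC2 0)).
have [D [bD _]] : bounded_lipschitz (fun x => \prod_(j <- [seq j <- index_enum 'I_N | j != i]) B j (a j) (x ord0 j)).
  by apply: bounded_lipschitz_prod => j; exact: factor_bounded_lipschitz.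
exists (C2 * D) => x h.
pose P := \prod_(j <- [seq j <- index_enum 'I_N | j != i]) B j (a j) (x ord0 j).
have PE (f : 'I_N -> R) : (forall j, j != i -> f j = B j (a j) (x ord0 j)) ->
    \prod_j f j = f i * P.
  move=> fE; rewrite (bigD1 i)//=; congr (_ * _).
  by rewrite /P big_filter; apply: eq_bigr => j ji; exact: fE.
rewrite /prodB !PE.
- rewrite /incr_at eqxx addn1 !mxE !eqxx mulr1.
  have -> : B i (a i) (h + x ord0 i) * P - B i (a i) (x ord0 i) * P - h * (B i (a i).+1 (x ord0 i) * P)
     = (B i (a i) (x ord0 i + h) - B i (a i) (x ord0 i) - h * B i (a i).+1 (x ord0 i)) * P.
    by rewrite (addrC h); ring.
  rewrite normrM mulrAC ler_pM//; first exact: (taylor_remainder _ _ (dB i (a i)) (dB i (a i).+1) hC2).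
  exact: bD.
- by move=> j ji; rewrite /incr_at (negbTE ji) addn0.
- by [].
- by move=> j ji; rewrite !mxE (negbTE ji) andbF mulr0 add0r.
Qed.

Lemma iter_partial_conv g a l : integrable_rV g ->
  exists a', iter_partial l (convol g (prodB a)) = convol g (prodB a').
Proof.
move=> ig; elim: l => [|i l [a' IH]]; first by exists a.
exists (incr_at a' i); rewrite /= IH; apply/funext => x.
have := conv_is_derive x ig (prodB_bounded_lipschitz a') (prodB_bounded_lipschitz (incr_at a' i)) (prodB_taylor a' i).
by case.
Qed.

Lemma smooth_conv g a : integrable_rV g -> smooth (convol g (prodB a)).
Proof.
move=> ig l; have [a' ->] := iter_partial_conv a l ig; split.
  apply: bounded_lipschitz_continuous; apply: conv_bounded_lipschitz => //.
  exact: prodB_bounded_lipschitz.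
move=> x i.
have := conv_is_derive x ig (prodB_bounded_lipschitz a') (prodB_bounded_lipschitz (incr_at a' i)) (prodB_taylor a' i).
by case.
Qed.
End product_kernel.

Section smooth_linear.
Variables (R : realType) (n : nat).
Local Notation V := 'rV[R]_n.+1.
Implicit Types f g : V -> R.

Lemma iter_partialD f g l : smooth f -> smooth g ->
  iter_partial l (f \+ g) = iter_partial l f \+ iter_partial l g.
Proof.
move=> sf sg; elim: l => //= i l ->; apply/funext => x.
by rewrite deriveD//; [have [_] := sf l|have [_] := sg l].
Qed.

Lemma smoothD f g : smooth f -> smooth g -> smooth (f \+ g).
Proof.
move=> sf sg l; rewrite iter_partialD//; have [cf df] := sf l; have [cg dg] := sg l; split.
  by move=> x; exact: (continuousD (cf x) (cg x)).
by move=> x i; apply: derivableD.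
Qed.

Lemma iter_partialZ (c : R) f l : smooth f ->
  iter_partial l (c \*: f) = c \*: iter_partial l f.
Proof.
move=> sf; elim: l => //= i l ->; apply/funext => x.
by rewrite deriveZ//; have [_] := sf l.
Qed.

Lemma smoothZ (c : R) f : smooth f -> smooth (c \*: f).
Proof.
move=> sf l; rewrite iter_partialZ//; have [cf df] := sf l; split.
  by move=> x; apply: (@continuousZl_tmp R R^o V (iter_partial l f) c x); exact: cf.
by move=> x i; apply: derivableZ.
Qed.

Lemma smooth0 : smooth (cst 0 : V -> R).
Proof.
have E l : iter_partial l (cst 0 : V -> R) = cst 0.
  by elim: l => //= i l ->; apply/funext => x; rewrite derive_cst.
move=> l; rewrite E; split; first exact: cst_continuous.
by move=> x i; exact: derivable_cst.
Qed.

Lemma smooth_sum (I : Type) (r : seq I) (F : I -> V -> R) : (forall i, smooth (F i)) ->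
  smooth (fun x => \sum_(i <- r) F i x).
Proof.
move=> sF; elim: r => [|i r IH].
  by under eq_fun do rewrite big_nil; exact: smooth0.
by under eq_fun do rewrite big_cons; exact: smoothD.
Qed.
End smooth_linear.

(** * Inward translations near a Lipschitz boundary *)

Section geometry.
Variables (R : realType) (n : nat).
Local Notation N := n.+1.
Local Notation V := 'rV[R]_N.
Implicit Types (Om : set V) (x y w v : V).

(** A whole ball of arbitrarily short vectors translates the part of Om lying in A
    into Om, so that one can mollify without leaving Om. *)
Definition inward Om (A : set V) := forall delta : R, 0 < delta ->
  exists v (eps : R), [/\ 0 < eps, (forall w, `|w - v| < eps -> `|w| < delta) &
    forall y w, Om y -> A y -> `|w - v| < eps -> Om (y + w)].

Lemma mulmx_norm_le m p (Q : 'M[R]_(m, p)) : exists2 c, 0 <= c &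
  forall w : 'rV[R]_m, `|w *m Q| <= c * `|w|.
Proof.
exists (\sum_i \sum_j `|Q i j|) => [|w]; first by apply: sumr_ge0 => i _; exact: sumr_ge0.
rewrite (mx_normE (w *m Q)).
apply/bigmax_leP; split => [|[i j] _ /=].
  by rewrite mulr_ge0//; apply: sumr_ge0 => i _; exact: sumr_ge0.
rewrite mxE (le_trans (ler_norm_sum _ _ _))// mulr_suml; apply: ler_sum => k _.
rewrite normrM mulrC; apply: ler_pM => //.
  by rewrite (bigD1 j)//= lerDl sumr_ge0.
rewrite (mx_normE w).
exact: (@le_bigmax _ _ _ 0 (fun ij : 'I_1 * 'I_m => `|w ij.1 ij.2|) (i, k)).
Qed.

Lemma col'_norm_le (w : V) : `|col' ord_max w| <= `|w|.
Proof.
rewrite (mx_normE (col' ord_max w)).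
apply/bigmax_leP; split => // -[i j] _ /=; rewrite mxE.
rewrite (mx_normE w).
exact: (@le_bigmax _ _ _ 0 (fun ij : 'I_1 * 'I_N => `|w ij.1 ij.2|) (i, lift ord_max j)).
Qed.

Lemma near_ball_rV (P : V -> Prop) x : (\forall y \near x, P y) ->
  exists2 r : R, 0 < r & forall y, `|y - x| < r -> P y.
Proof.
move=> /nbhs_ballP[r /= r0 h]; exists r => // y yx; apply: h.
by rewrite -ball_normE /= distrC.
Qed.

Lemma inward_interior Om x : open Om -> Om x -> exists2 r : R, 0 < r &
  inward Om [set y | `|y - x| < r].
Proof.
move=> oOm Ox; have /near_ball_rV[r r0 h] := open_nbhs_nbhs (conj oOm Ox).
have r20 : 0 < r / 2 by rewrite divr_gt0.
exists (r / 2) => // d d0; exists 0, (Num.min d (r / 2)); split.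
- by rewrite lt_min d0.
- by move=> w; rewrite subr0 lt_min => /andP[].
- move=> y w _ /= yx; rewrite subr0 lt_min => /andP[_ wr]; apply: h.
  rewrite addrAC (le_lt_trans (ler_normD _ _))//; lra.
Qed.

(** In the orthonormal coordinates Q, Om is the strict epigraph of gamma near x.
    Moving up by t along the last axis e and perturbing by u raises the last
    coordinate by at least t - c |u| and the value of gamma by at most k c |u|, so
    the perturbations with (k + 1) c |u| < t keep the point in the epigraph. *)
Lemma inward_boundary Om x (Q : 'M[R]_N) (gamma : 'rV[R]_n -> R) :
  Q *m Q^T = 1%:M -> lipschitz gamma ->
  (\forall y \near x, Om y <-> gamma (col' ord_max (y *m Q)) < (y *m Q) ord0 ord_max) ->
  exists2 r : R, 0 < r & inward Om [set y | `|y - x| < r].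
Proof.
move=> QQ lg /near_ball_rV[r r0 h].
have [k k0 hk] : exists2 k : R, 0 <= k & forall a b, `|gamma a - gamma b| <= k * `|a - b|.
  have [M [Mr /(_ (`|M| + 1))]] := lg.
  rewrite (le_lt_trans (ler_norm M)) ?ltrDl// => /(_ isT) hM.
  exists (`|M| + 1); first by rewrite addr_ge0.
  by move=> a b; exact: (hM (a, b)).
have [c c0 hc] := mulmx_norm_le Q.
have r20 : 0 < r / 2 by rewrite divr_gt0.
exists (r / 2) => // d d0.
pose e : V := delta_mx ord0 ord_max *m Q^T.
have eQ : e *m Q = delta_mx ord0 ord_max by rewrite /e -mulmxA (mulmx1C QQ) mulmx1.
pose m := Num.min d (r / 2).
have m0 : 0 < m by rewrite lt_min d0.
have K0 : 0 <= (k + 1) * c by rewrite mulr_ge0// addr_ge0.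
have e0 : 0 <= `|e| by [].
pose t := m / (`|e| + 1).
have t0 : 0 < t by rewrite divr_gt0// ltr_wpDl.
pose eps := t / ((k + 1) * c + 1).
have K1 : 0 < (k + 1) * c + 1 by rewrite ltr_wpDl.
have eps0 : 0 < eps by rewrite divr_gt0.
have epst : eps <= t by rewrite ler_pdivrMr// ler_peMr ?(ltW t0)// lerDr.
have hw w : `|w - t *: e| < eps -> `|w| < m.
  move=> hw; rewrite -(subrK (t *: e) w) (le_lt_trans (ler_normD _ _))//.
  apply: (@lt_le_trans _ _ (t + t * `|e|)).
    by rewrite normrZ (gtr0_norm t0) ltrD2r (lt_le_trans hw).
  rewrite -[X in X + _]mulr1 -mulrDr addrC /t addrC divfK// gt_eqF// ltr_wpDl//.
exists (t *: e), eps; split => //.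
  by move=> w /hw; rewrite lt_min => /andP[].
move=> y w Oy /= yx ww; have := hw _ ww; rewrite lt_min => /andP[_ wr].
have y1 : `|y - x| < r by lra.
have y2 : `|y + w - x| < r by rewrite addrAC (le_lt_trans (ler_normD _ _))//; lra.
apply/(h _ y2); have {}Oy := (h _ y1).1 Oy.
pose u := w - t *: e.
have wE : (y + w) *m Q = y *m Q + t *: delta_mx ord0 ord_max + u *m Q.
  by rewrite -eQ scalemxAl -!mulmxDl /u; congr (_ *m Q); rewrite -addrA; congr (_ + _); rewrite addrC subrK.
have uQ : `|u *m Q| <= c * `|u| by exact: hc.
have cE : col' ord_max ((y + w) *m Q) = col' ord_max (y *m Q) + col' ord_max (u *m Q).
  rewrite wE; apply/rowP => j; rewrite !mxE /= (_ : (lift ord_max j == ord_max) = false); last first.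
    by rewrite eq_sym (negbTE (neq_lift _ _)).
  by rewrite mulr0 addr0.
have g1 := hk (col' ord_max ((y + w) *m Q)) (col' ord_max (y *m Q)).
rewrite cE addrAC subrr add0r -cE in g1.
have g2 : `|col' ord_max (u *m Q)| <= c * `|u| by exact: le_trans (col'_norm_le _) uQ.
have g3 : `|gamma (col' ord_max ((y + w) *m Q)) - gamma (col' ord_max (y *m Q))| <= k * (c * `|u|).
  by apply: le_trans g1 _; rewrite ler_wpM2l.
have lE : ((y + w) *m Q) ord0 ord_max = (y *m Q) ord0 ord_max + t + (u *m Q) ord0 ord_max.
  by rewrite wE !mxE !eqxx mulr1.
have l1 : `|(u *m Q) ord0 ord_max| <= c * `|u| by apply: le_trans uQ; exact: le_coord_norm.
rewrite lE.
have uu : (k + 1) * c * `|u| <= t.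
  apply: (@le_trans _ _ (((k + 1) * c + 1) * `|u|)).
    by rewrite ler_wpM2r// lerDl.
  by rewrite mulrC -ler_pdivlMr// ltW.
move: g3 l1; rewrite !ler_norml => /andP[_ g3] /andP[l1 _].
have E : (k + 1) * c * `|u| = k * (c * `|u|) + c * `|u| by ring.
rewrite E in uu; lra.
Qed.

Lemma inward_closure Om x : open Om -> lipschitz_boundary Om -> closure Om x ->
  exists2 r : R, 0 < r & inward Om [set y | `|y - x| < r].
Proof.
move=> oOm lOm cx; have [Ox|nOx] := pselect (Om x); first exact: inward_interior.
have /lOm[Q [gamma [QQ lg hg]]] : (closure Om `\` interior Om) x.
  by split => // /interior_subset.
exact: (inward_boundary QQ lg hg).
Qed.
End geometry.

(** * A partition of unity with inward pieces *)

Section partition.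
Variables (R : realType) (n : nat).
Local Notation N := n.+1.
Local Notation V := 'rV[R]_N.
Implicit Types (Om : set V) (x y w v : V).

Lemma inwardW Om (A B : set V) : A `<=` B -> inward Om B -> inward Om A.
Proof.
move=> AB iB d d0; have [v [e [e0 h1 h2]]] := iB d d0; exists v, e; split => // y w Oy Ay.
exact: h2 (AB _ Ay).
Qed.

Definition tent x (r : R) y : R := Num.min 1 (Num.max 0 (2 - 2 / r * `|y - x|)).

Lemma clamp_dist (a b : R) :
  `|Num.min 1 (Num.max 0 a) - Num.min 1 (Num.max 0 b)| <= `|a - b|.
Proof.
wlog ab : a b / a <= b => [hw|].
  by have [|/ltW] := leP a b; [exact: hw|rewrite distrC (distrC a); exact: hw].
rewrite distrC (distrC a) ger0_norm ?subr_ge0 ?ger0_norm ?subr_ge0//; last first.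
  by rewrite le_min !ge_min lexx/= ge_max !le_max lexx ab !orbT.
by have [a0|a0] := leP 0 a; have [b0|b0] := leP 0 b; have [a1|a1] := leP 1 a;
  have [b1|b1] := leP 1 b; rewrite ?(min_idPr ler01); lra.
Qed.

Lemma tent_bounded_lipschitz x (r : R) : 0 < r -> bounded_lipschitz (tent x r).
Proof.
move=> r0; have r20 : 0 <= 2 / r by rewrite divr_ge0// ltW.
exists (1 + 2 / r); split => [y|y z].
  rewrite ger0_norm ?le_min ?ler01 ?le_max ?lexx//.
  by rewrite (@le_trans _ _ 1)// ?ge_min ?lexx// lerDl.
apply: le_trans (clamp_dist _ _) _.
have -> : 2 - 2 / r * `|y - x| - (2 - 2 / r * `|z - x|) = 2 / r * (`|z - x| - `|y - x|) by ring.
rewrite normrM (ger0_norm r20) ler_pM// ?lerDr//.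
apply: le_trans (ler_dist_dist _ _) _.
by rewrite opprB addrA subrK distrC.
Qed.

Lemma tent01 x r y : 0 <= tent x r y <= 1.
Proof. by rewrite /tent le_min ler01 le_max lexx ge_min lexx. Qed.

Lemma tent_support x r y : 0 < r -> tent x r y != 0 -> `|y - x| < r.
Proof.
move=> r0 tn0; rewrite ltNge; apply/negP => h; move/eqP: tn0; apply; rewrite /tent.
have h0 : 2 - 2 / r * `|y - x| <= 0.
  by rewrite subr_le0 mulrAC ler_pdivlMr// ler_wpM2l.
by rewrite (max_idPl h0) (min_idPr ler01).
Qed.

Lemma tent1 x r y : 0 < r -> `|y - x| < r / 2 -> tent x r y = 1.
Proof.
move=> r0 h; rewrite /tent; apply/min_idPl; rewrite le_max; apply/orP; right.
rewrite lerBrDr -lerBrDl mulrAC ler_pdivrMr//; lra.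
Qed.

(** The usual way to make a partition of unity out of cut-off functions without
    division: the sum is 1 as soon as one of the chi_i equals 1. *)
Lemma telescope_prod (chi : nat -> V -> R) m x :
  \sum_(i < m) chi i x * \prod_(j < i) (1 - chi j x) = 1 - \prod_(j < m) (1 - chi j x).
Proof.
elim: m => [|m IH]; first by rewrite !big_ord0 subrr.
rewrite big_ord_recr /= IH [in RHS]big_ord_recr /=; ring.
Qed.

(** Compactness of the closure of Om.  The balls of half the radius already cover
    Om, which leaves room for the tents. *)
Lemma inward_cover Om : open Om -> bounded_set Om -> lipschitz_boundary Om ->
  exists m (c : nat -> V) (r : nat -> R), [/\ forall i, 0 < r i,
    (forall i, (i < m)%N -> inward Om [set y | `|y - c i| < r i]) &
    forall y, Om y -> exists2 i, (i < m)%N & `|y - c i| < r i / 2].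
Proof.
move=> oOm bOm lOm.
have cK : compact (closure Om).
  apply: bounded_closed_compact; last exact: closed_closure.
  have [M [Mr hM]] := bOm; exists M; split => // M' MM' y cy.
  have hc : closed [set z : V | `|z| <= M'].
    apply: (@closed_comp _ _ (fun z : V => `|z|) [set x : R | x <= M']); last exact: closed_le.
    by move=> z _; exact: norm_continuous.
  move: y cy; rewrite -/(_ `<=` _) closureE; apply: smallest_sub => // y Oy.
  exact: hM MM' _ Oy.
have /choice[r hr] x : exists r : R, 0 < r /\ (closure Om x -> inward Om [set y | `|y - x| < r]).
  have [cx|ncx] := pselect (closure Om x); last by exists 1.
  by have [r r0 h] := inward_closure oOm lOm cx; exists r.
move: cK; rewrite compact_cover => /(_ V (closure Om) (fun x => [set y | `|y - x| < r x / 2])).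
case.
- move=> x _.
  have -> : [set y | `|y - x| < r x / 2] = ball x (r x / 2).
    by apply/seteqP; split => y; rewrite -ball_normE /= distrC.
  by apply: ball_open; rewrite divr_gt0//; exact: (hr x).1.
- move=> x cx; exists x => //=; rewrite subrr normr0 divr_gt0//; exact: (hr x).1.
move=> D DO cov; pose s : seq V := finmap.enum_fset D.
exists (size s), (fun i => nth 0 s i), (fun i => r (nth 0 s i)); split => [i|i im|y Oy].
- exact: (hr _).1.
- by apply: (hr _).2; have := DO (nth 0 s i) (mem_nth 0 im); rewrite inE.
- have [x xD yx] := cov y (subset_closure Oy).
  by exists (index x s); [rewrite index_mem|rewrite nth_index].
Qed.

(** The last function collects what the tents leave: it vanishes on Om, so that it
    is trivially inward, and the sum is 1 on the whole space. *)
Lemma partition_of_unity Om : open Om -> bounded_set Om -> lipschitz_boundary Om ->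
  exists m (eta : nat -> V -> R), [/\ forall i, bounded_lipschitz (eta i),
    forall i x, 0 <= eta i x <= 1, forall x, \sum_(i < m) eta i x = 1 &
    forall i, (i < m)%N -> inward Om [set y | eta i y != 0]].
Proof.
move=> oOm bOm lOm; have [m [c [r [r0 ir cov]]]] := inward_cover oOm bOm lOm.
(* The m-th cut-off is the constant 1. *)
pose chi i := if (i < m)%N then tent (c i) (r i) else cst 1.
have chi01 i x : 0 <= chi i x <= 1.
  by rewrite /chi; case: ifP => _; rewrite ?tent01// ler01 lexx.
have BLchi i : bounded_lipschitz (chi i).
  by rewrite /chi; case: ifP => _; [exact: tent_bounded_lipschitz|exact: bounded_lipschitz_cst].
have BL1 i : bounded_lipschitz (fun x => 1 - chi i x).
  have [C [b l]] := BLchi i; exists (C + 1); split => [x|x y].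
    by rewrite (le_trans (ler_normB _ _))// normr1 addrC lerD2r.
  have -> : 1 - chi i x - (1 - chi i y) = - (chi i x - chi i y) by ring.
  by rewrite normrN (le_trans (l x y))// ler_wpM2r// lerDl.
pose eta i x := chi i x * \prod_(j < i) (1 - chi j x).
have P01 i x : 0 <= \prod_(j < i) (1 - chi j x) <= 1.
  elim: i => [|i /andP[h0 h1]]; first by rewrite big_ord0 ler01 lexx.
  have /andP[c0 c1] := chi01 i x.
  rewrite big_ord_recr/= mulr_ge0 ?subr_ge0//= mulr_ile1 ?subr_ge0//; lra.
exists m.+1, eta; split => [i|i x|x|i im].
- apply: bounded_lipschitzM => //.
  exact: (@bounded_lipschitz_prod _ _ _ (index_enum 'I_i) (fun j x => 1 - chi j x)).
- have /andP[c0 c1] := chi01 i x; have /andP[p0 p1] := P01 i x.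
  by rewrite /eta mulr_ge0//= mulr_ile1.
- rewrite /eta telescope_prod big_ord_recr/= {2}/chi ltnn subrr mulr0 subr0//.
- move: im; rewrite ltnS leq_eqVlt => /predU1P[->|im].
    move=> d d0; exists 0, d; split => // [w|y w Oy /= ]; first by rewrite subr0.
    have [j jm yj] := cov y Oy.
    rewrite /eta (bigD1 (Ordinal jm))//= {2}/chi jm tent1// subrr mul0r mulr0 eqxx//.
  apply: inwardW (ir i im) => y /=; rewrite /eta /chi im mulf_eq0 negb_or => /andP[h _].
  exact: tent_support h.
Qed.
End partition.

(** * The modulus of continuity in L^1 of functions of finite energy *)

Section holder.
Variables (R : realType) (n : nat).
Local Notation N := n.+1.
Local Notation mu := (@lebesgue_rV R N).
Local Notation V := 'rV[R]_N.
Implicit Types (f : V -> R) (h k : V) (s : R).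
Local Open Scope ereal_scope.

Lemma indic_norm_le (r : R) (z : V) :
  (\1_[set z : V | (`|z| <= r)%R] z : R) = (if (`|z| <= r)%R then 1 else 0)%R.
Proof. by rewrite indicE; case: ifPn => h; [rewrite mem_set|rewrite memNset//; exact/negP]. Qed.

Lemma increment0 f : increment f 0%R = 0.
Proof. by rewrite /increment; under eq_integral do rewrite addr0 subrr normr0; rewrite integral0. Qed.

Lemma increment_triangle f h k : measurable_fun setT f ->
  increment f h <= increment f k + increment f (h - k)%R.
Proof.
move=> mf; have m1 := measurable_increment_integrand k mf.
have m2 := measurable_increment_integrand (h - k)%R mf.
rewrite {3}/increment -(ge0_integral_shift k (f := fun y => (`|f (y + (h - k))%R - f y|)%:E))//.
have m3 : measurable_fun setT (fun y : V => (`|f (y + k + (h - k))%R - f (y + k)%R|)%:E).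
  exact: (measurableT_comp m2 (measurable_rV_add (@measurable_id _ _ _) (measurable_cst k))).
rewrite /increment -(ge0_integralD mu measurableT _ m1 _ m3)//.
apply: le_int => // y; rewrite -EFinD lee_fin.
have -> : (f (y + h) - f y = (f (y + k) - f y) + (f (y + k + (h - k)) - f (y + k)))%R.
  have -> : (y + k + (h - k) = y + h)%R by rewrite -addrA (addrCA k) subrr addr0.
  ring.
exact: ler_normD.
Qed.

Lemma increment_le_energy f s h (r : R) : (0 < s)%R -> (0 < r)%R -> (`|h| <= r)%R ->
  increment f h <= ((N%:R * r) `^ (N%:R + s) * frac_kernel s 1 h)%:E * increment f h.
Proof.
move=> s0 r0 hr; have [->|h0] := eqVneq h 0%R; first by rewrite increment0 mule0.
have e0 : (0 < enorm h)%R by apply: lt_le_trans (norm_le_enorm h); rewrite normr_gt0.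
have Ns : (0 <= N%:R + s)%R by rewrite addr_ge0// ltW.
rewrite -[X in X <= _]mul1e lee_wpmul2r ?increment_ge0// lee_fin.
rewrite /frac_kernel mulr1 ler_pdivlMr ?powR_gt0// mul1r.
have Nr : (0 <= N%:R * r)%R by rewrite mulr_ge0// ltW.
rewrite ge0_ler_powR ?nnegrE ?(ltW e0)// (le_trans (enorm_le_norm h))//.
by rewrite ler_wpM2l.
Qed.

(** Average increment f h <= increment f k + increment f (h - k) over |k| <= |h|.
    Such k and h - k have norm at most 2 |h|, where the kernel is at least a
    multiple of |h|^-(N + s), so both averages are at most a multiple of
    |h|^-N |h|^(N + s) times the energy. *)
Lemma increment_holder s : (0 < s)%R -> exists2 C : R, (0 <= C)%R &
  forall f h, measurable_fun setT f ->
    increment f h <= (C * `|h| `^ s)%:E * energy (frac_kernel s 1) f.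
Proof.
move=> s0; exists (2 * (2 `^ s * N%:R `^ (N%:R + s)))%R; first by rewrite !mulr_ge0 ?powR_ge0.
move=> f h mf.
have K0 z : (0 <= frac_kernel s 1 z :> R)%R by exact: frac_kernel_ge0.
have [->|h0] := eqVneq h 0%R.
  by rewrite increment0 mule_ge0 ?energy_ge0// lee_fin mulr_ge0 ?powR_ge0// !mulr_ge0 ?powR_ge0.
pose r := `|h|%R; have r0 : (0 < r)%R by rewrite normr_gt0.
have r20 : (0 < 2 * r)%R by rewrite mulr_gt0.
pose I (z : V) : R := \1_[set z : V | (`|z| <= r)%R] z.
have mI : measurable_fun setT (EFin \o I).
  by apply/measurable_EFinP; apply: measurable_indic; exact: measurable_norm_le.
have I0 z : 0 <= (I z)%:E by rewrite lee_fin /I indicE.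
have IE z : I z = (if (`|z| <= r)%R then 1 else 0)%R.
  exact: indic_norm_le.
have muI : \int[mu]_z (I z)%:E = ((2 * r) ^+ N)%:E.
  have mS := @measurable_norm_le R n r.
  by rewrite /I integral_indic// setIT; exact: mu_norm_le (ltW r0).
have minc := measurable_increment mf.
have inc0 z := increment_ge0 f z.
pose c := ((N%:R * (2 * r)) `^ (N%:R + s))%R.
have c0 : (0 <= c)%R by exact: powR_ge0.
have m1 : measurable_fun setT (fun k => (I k)%:E * increment f k) by exact: emeasurable_funM.
have mhk : measurable_fun setT (fun k : V => (h - k)%R).
  by apply: measurable_rV_add => //; exact: measurable_rV_opp.
have m2 : measurable_fun setT (fun k => (I k)%:E * increment f (h - k)%R).
  by apply: emeasurable_funM => //; exact: (measurableT_comp minc mhk).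
have A1 : \int[mu]_k ((I k)%:E * increment f k) <= c%:E * energy (frac_kernel s 1) f.
  have mE := measurable_energy_integrand (measurable_frac_kernel s 1) mf.
  rewrite -(ge0_integralZl mu measurableT mE)//; last by move=> k _; rewrite mule_ge0 ?lee_fin.
  apply: le_int => k; first by rewrite mule_ge0.
  rewrite IE; case: ifPn => kr; last by rewrite mul0e !mule_ge0 ?lee_fin.
  rewrite mul1e muleA -EFinM; apply: increment_le_energy => //.
  by rewrite (le_trans kr)// ler_peMl ?(ltW r0)// ler1n.
have A2 : \int[mu]_k ((I k)%:E * increment f (h - k)%R) <= c%:E * energy (frac_kernel s 1) f.
  have mE := measurable_energy_integrand (measurable_frac_kernel s 1) mf.
  rewrite -(ge0_integral_reflect h) //; last by move=> k; rewrite mule_ge0.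
  rewrite -(ge0_integralZl mu measurableT mE)//; last by move=> k _; rewrite mule_ge0 ?lee_fin.
  apply: le_int => k; first by rewrite mule_ge0.
  rewrite IE subKr; case: ifPn => kr; last by rewrite mul0e !mule_ge0 ?lee_fin.
  rewrite mul1e muleA -EFinM; apply: increment_le_energy => //.
  rewrite -(subKr h k) (le_trans (ler_normB _ _))//; rewrite /r in kr *; lra.
have A : ((2 * r) ^+ N)%:E * increment f h <= (2 * c)%:E * energy (frac_kernel s 1) f.
  rewrite -muI -ge0_integralZr//.
  apply: (@le_trans _ _ (\int[mu]_k ((I k)%:E * increment f k + (I k)%:E * increment f (h - k)%R))).
    apply: le_int => k; first by rewrite mule_ge0.
    by rewrite -ge0_muleDr// lee_wpmul2l// increment_triangle.
  rewrite (ge0_integralD mu measurableT _ m1 _ m2)//; try by move=> k _; rewrite mule_ge0.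
  have -> : (2 * c)%:E = c%:E + c%:E by rewrite -EFinD; congr EFin; ring.
  by rewrite ge0_muleDl ?lee_fin// leeD.
have p0 : (0 < (2 * r) ^+ N)%R by rewrite exprn_gt0.
rewrite -(@lee_pmul2l _ ((2 * r) ^+ N)%:E)// (le_trans A)// muleA -EFinM.
rewrite lee_wpmul2r ?energy_ge0// lee_fin /c.
have -> : ((N%:R * (2 * r)) `^ (N%:R + s) = N%:R `^ (N%:R + s) * ((2 * r) ^+ N * (2 `^ s * r `^ s)))%R.
  rewrite powRM ?(ltW r20)//; congr (_ * _)%R.
  rewrite powRD; last by rewrite (gt_eqF r20) implybT.
  by rewrite powR_mulrn ?(ltW r20)// powRM ?(ltW r0).
rewrite le_eqVlt; apply/orP; left; apply/eqP; rewrite /r; ring.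
Qed.
End holder.

(** * Mollifiers *)

Section mollifier.
Variables (R : realType) (n : nat).
Local Notation N := n.+1.
Local Notation mu := (@lebesgue_rV R N).
Local Notation V := 'rV[R]_N.

Lemma integrable_bounded_support (f : V -> R) (C r : R) : measurable_fun setT f ->
  0 <= r -> (forall x, `|f x| <= C) -> (forall x, r < `|x| -> f x = 0) -> integrable_rV f.
Proof.
move=> mf r0 fC fr; apply/integrableP; split; first exact/measurable_EFinP.
have C0 : 0 <= C by rewrite (le_trans _ (fC 0)).
have mS := @measurable_norm_le R n r.
apply: (@le_lt_trans _ _ (\int[mu]_x (C%:E * (\1_[set z : V | (`|z| <= r)%R] x : R)%:E))%E).
  apply: le_int => x //; rewrite /= -EFinM lee_fin indic_norm_le.
  by case: (leP `|x| r) => [_|/fr ->]; rewrite ?mulr1 ?fC// normr0 mulr0.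
have mI : measurable_fun setT (fun x => (\1_[set z : V | (`|z| <= r)%R] x : R)%:E).
  by apply/measurable_EFinP; exact: measurable_indic.
rewrite (ge0_integralZl mu measurableT mI) ?lee_fin//.
have -> : (\int[mu]_x (\1_[set z : V | (`|z| <= r)%R] x : R)%:E = ((2 * r) ^+ N)%:E)%E.
  by rewrite integral_indic// setIT; exact: mu_norm_le.
by rewrite -EFinM ltry.
Qed.

(** The support lies near v rather than near 0: convolution translates by v while
    smoothing at the scale eps. *)
Definition mollifier (v : V) (eps : R) (rho : V -> R) :=
  [/\ bounded_lipschitz rho, (forall x, 0 <= rho x), (\int[mu]_x (rho x)%:E = 1)%E,
    (forall x, rho x != 0 -> `|x - v| < eps) &
    forall g, integrable_rV g -> smooth (convol g rho)].

Lemma exists_mollifier (v : V) (eps : R) : 0 < eps -> exists rho, mollifier v eps rho.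
Proof.
move=> e0.
have /choice[B hB] (j : 'I_N) := exists_bump (v ord0 j) e0.
have dB j m t : is_derive t (1 : R) (B j m) (B j m.+1 t) by have [h _ _ _] := hB j.
have bB j m : exists C, forall t, `|B j m t| <= C by have [_ _ _ h] := hB j.
pose rho0 := prodB B (fun=> 0%N).
have bl0 : bounded_lipschitz rho0 by exact: prodB_bounded_lipschitz.
have [C [bC lC]] := bl0.
have rho0_ge0 x : 0 <= rho0 x by apply: prodr_ge0 => j _; have [_ h _ _] := hB j.
have rho0_supp x : rho0 x != 0 -> `|x - v| < eps.
  move=> h.
  have hj j : `|x ord0 j - v ord0 j| < eps.
    have [_ h0 h1 _] := hB j; apply/h1; rewrite lt_neqAle h0 andbT eq_sym.
    by move: h; rewrite /rho0 /prodB prodf_seq_neq0 => /allP /(_ j); rewrite mem_index_enum => /(_ isT).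
  rewrite (mx_normE (x - v)).
  by apply/bigmax_ltP; split => // -[i j] _ /=; rewrite (ord1 i) !mxE.
have rho0v : 0 < rho0 v.
  apply: prodr_gt0 => j _; have [_ _ h1 _] := hB j; apply/h1.
  by rewrite subrr normr0.
have mrho := bounded_lipschitz_measurable bl0.
have i0 : integrable_rV rho0.
  apply: (@integrable_bounded_support _ C (`|v| + eps)) => //; first by rewrite addr_ge0// ltW.
  move=> x hx; apply/eqP; apply: contraTT hx => /rho0_supp hx; rewrite -leNgt.
  by rewrite -(subrK v x) (le_trans (ler_normD _ _))// addrC lerD2l ltW.
have mrhoE : measurable_fun setT (EFin \o rho0) by exact/measurable_EFinP.
have I0 : (0 <= \int[mu]_x (rho0 x)%:E)%E by apply: integral_ge0 => x _; rewrite lee_fin.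
have Ifin : (\int[mu]_x (rho0 x)%:E \is a fin_num)%E by exact: integrable_fin_num i0.
have Ipos : (0 < \int[mu]_x (rho0 x)%:E)%E.
  have C1 : 0 < C + 1 by rewrite ltr_wpDl// (le_trans _ (bC 0)).
  pose r := rho0 v / 2 / (C + 1); have r0 : 0 < r by rewrite !divr_gt0.
  pose S := [set z : V | `|z| <= r].
  have mS : measurable S by exact: measurable_norm_le.
  have mI : measurable_fun setT (fun x => (\1_S x : R)%:E).
    by apply/measurable_EFinP; exact: measurable_indic.
  have muS : mu S = ((2 * r) ^+ N)%:E by exact: mu_norm_le (ltW r0).
  have : (0 < (rho0 v / 2)%:E * mu S)%E.
    by rewrite muS -EFinM lte_fin mulr_gt0 ?divr_gt0// exprn_gt0// mulr_gt0.
  move=> /lt_le_trans; apply.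
  rewrite -(ge0_integral_shift v) //.
  have -> : (mu S = \int[mu]_x (\1_S x : R)%:E)%E by rewrite integral_indic// setIT.
  have rv0 : (0 <= (rho0 v / 2)%:E)%E by rewrite lee_fin divr_ge0// ltW.
  rewrite -(ge0_integralZl mu measurableT mI)//.
  apply: le_int => x; first by rewrite -EFinM lee_fin mulr_ge0 ?divr_ge0 ?indicE// ltW.
  rewrite -EFinM lee_fin indic_norm_le; case: (leP `|x| r) => [xr|_]; last by rewrite mulr0.
  rewrite mulr1; have := lC (x + v) v; rewrite addrK => h.
  have h2 : C * `|x| <= rho0 v / 2.
    apply: (@le_trans _ _ ((C + 1) * r)); last by rewrite /r mulrC divfK// gt_eqF.
    by rewrite ler_pM// ?(le_trans _ (bC 0))// lerDl.
  have := le_trans h h2; rewrite ler_norml => /andP[? _]; lra.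
pose c := (fine (\int[mu]_x (rho0 x)%:E))^-1.
have f0 : 0 < fine (\int[mu]_x (rho0 x)%:E) by rewrite fine_gt0// Ipos ltey_eq Ifin.
have c0 : 0 < c by rewrite invr_gt0.
exists (cst c \* rho0); split.
- by apply: bounded_lipschitzM => //; exact: bounded_lipschitz_cst.
- by move=> x; rewrite /= mulr_ge0// ltW.
- under eq_integral do rewrite /= EFinM.
  rewrite (ge0_integralZl mu measurableT mrhoE) ?lee_fin ?(ltW c0)//.
    by rewrite -(fineK Ifin) -EFinM mulVf// gt_eqF.
  by move=> x _; rewrite /= lee_fin.
- by move=> x; rewrite mulf_eq0 negb_or => /andP[_]; exact: rho0_supp.
- move=> g ig; rewrite (_ : convol g _ = c \*: convol g rho0).
    by apply: smoothZ; exact: smooth_conv.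
  apply/funext => x; rewrite /convol /= -[RHS](RintegralZl c measurableT (integrable_convolution x ig bl0)).
  by apply: eq_Rintegral => w _; rewrite mulrCA.
Qed.
End mollifier.

(** * Mollification of one piece *)

Section one_piece.
Variables (R : realType) (n : nat).
Local Notation N := n.+1.
Local Notation mu := (@lebesgue_rV R N).
Local Notation V := 'rV[R]_N.
Implicit Types (f g eta rho : V -> R) (k y z w : V).

Lemma convolE g rho x : integrable_rV g -> bounded_lipschitz rho ->
  (convol g rho x)%:E = (\int[mu]_w (g w * rho (x - w))%:E)%E.
Proof.
move=> ig bl; rewrite /convol /Rintegral fineK//.
exact: integrable_fin_num (integrable_convolution x ig bl).
Qed.

Lemma Rintegral_norm_le (F : V -> R) : mu.-integrable setT (EFin \o F) ->
  ((`|(\int[mu]_w F w)%R|)%:E <= \int[mu]_w (`|F w|)%:E)%E.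
Proof.
move=> iF; have ia := integrable_norm iF.
apply: (@le_trans _ _ ((\int[mu]_w `|F w|)%R)%:E); first by rewrite lee_fin le_normr_Rintegral.
by rewrite /Rintegral fineK//; exact: integrable_fin_num ia.
Qed.

Lemma integrable_shift g k : integrable_rV g -> integrable_rV (fun w => g (w + k)).
Proof.
move=> /integrableP[/measurable_EFinP mg ig]; apply/integrableP; split.
  by apply/measurable_EFinP; exact: measurable_translate.
apply: le_lt_trans ig; rewrite -(ge0_integral_shift k (f := fun x => (`|(g x)%:E|)%E))//.
by apply: measurableT_comp => //; exact/measurable_EFinP.
Qed.

Lemma measurable_reflect f y : measurable_fun setT f -> measurable_fun setT (fun w => f (y - w)).
Proof.
move=> mf; apply: (measurableT_comp mf).
by apply: measurable_rV_add => //; exact: measurable_rV_opp.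
Qed.

Lemma measurable_diff d (T : measurableType d) f (a b : T -> V) : measurable_fun setT f ->
  measurable_fun setT a -> measurable_fun setT b -> measurable_fun setT (fun t => f (a t - b t)).
Proof.
move=> mf ma mb; apply: (measurableT_comp mf).
by apply: measurable_rV_add => //; exact: measurable_rV_opp.
Qed.

(** By the product rule for differences, the increment of eta f is eta(. + k)
    times the increment of f, plus this term. *)
Definition commutator eta f k w : R := f w * (eta (w + k) - eta w).

Section piece.
Variables (eta f rho : V -> R).
Hypothesis bl_eta : bounded_lipschitz eta.
Hypothesis eta0 : forall x, 0 <= eta x.
Hypothesis mf : measurable_fun setT f.
Hypothesis f0 : forall x, 0 <= f x.
Hypothesis if_ : integrable_rV f.
Hypothesis bl_rho : bounded_lipschitz rho.
Hypothesis rho0 : forall x, 0 <= rho x.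
Hypothesis rho1 : (\int[mu]_x (rho x)%:E = 1)%E.

Let g x := eta x * f x.

Let meta : measurable_fun setT eta. Proof. exact: bounded_lipschitz_measurable. Qed.
Let mrho : measurable_fun setT rho. Proof. exact: bounded_lipschitz_measurable. Qed.

Lemma integrable_piece : integrable_rV g.
Proof.
have [C [b _]] := bl_eta.
have iC : mu.-integrable setT (fun w => (C%:E * (EFin \o f) w)%E) by exact: integrableZl.
apply: le_integrable iC => //; first by apply/measurable_EFinP; exact: measurable_funM.
by move=> w _; rewrite /= lee_fin /g !normrM ler_wpM2r// (le_trans (b w))// ler_norm.
Qed.

Lemma integral_rho_reflect y : (\int[mu]_w (rho (y - w))%:E = 1)%E.
Proof.
rewrite (ge0_integral_reflect y (f := fun x => (rho x)%:E))//; exact/measurable_EFinP.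
Qed.

(** The commutator is subtracted at y, not at w: subtracted terms cancel after
    summation over a partition of unity, and what remains of the commutator is its
    oscillation at the scale of the mollifier. *)
Lemma piece_increment_le k y :
  ((`|convol g rho (y + k) - convol g rho y - commutator eta f k y|)%:E <=
   \int[mu]_w (eta (w + k) * `|f (w + k) - f w| * rho (y - w))%:E +
   \int[mu]_w (`|commutator eta f k w - commutator eta f k y| * rho (y - w))%:E)%E.
Proof.
pose h := commutator eta f k.
have ig := integrable_piece.
have irho : mu.-integrable setT (EFin \o (fun w => rho (y - w))).
  apply/integrableP; split; first by apply/measurable_EFinP; exact: measurable_reflect.
  under eq_integral => w _ do rewrite /= ger0_norm//.
  by rewrite integral_rho_reflect ltry.
have E1 : convol g rho (y + k) = (\int[mu]_w (g (w + k) * rho (y - w)))%R.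
  rewrite /convol /Rintegral; congr fine.
  rewrite -(ge0_integral_shift k (f := fun w => (g w * rho (y + k - w))%:E)).
  - apply: eq_integral => w _.
    by have -> : y + k - (w + k) = y - w by rewrite opprD addrACA subrr addr0.
  - apply/measurable_EFinP; apply: measurable_funM; first exact: measurable_funM.
    exact: measurable_reflect.
  - by move=> w; rewrite lee_fin /g !mulr_ge0.
have i1 := integrable_convolution y (integrable_shift k ig) bl_rho.
have i2 := integrable_convolution y ig bl_rho.
have i3 : mu.-integrable setT (EFin \o (fun w => h y * rho (y - w))).
  exact: (integrableZl measurableT (h y) irho).
have i12 : mu.-integrable setT (EFin \o (fun w => g (w + k) * rho (y - w) - g w * rho (y - w))).
  exact: (integrableB measurableT i1 i2).
have i123 : mu.-integrable setT (EFin \o (fun w => g (w + k) * rho (y - w) - g w * rho (y - w) - h y * rho (y - w))).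
  exact: (integrableB measurableT i12 i3).
have -> : convol g rho (y + k) - convol g rho y - h y =
   (\int[mu]_w (g (w + k) * rho (y - w) - g w * rho (y - w) - h y * rho (y - w)))%R.
  rewrite E1 /convol (RintegralB measurableT i12 i3) (RintegralB measurableT i1 i2).
  congr (_ - _); rewrite (RintegralZl _ measurableT irho).
  by rewrite /Rintegral integral_rho_reflect /= mulr1.
apply: le_trans (Rintegral_norm_le i123) _.
have mh : measurable_fun setT h.
  by apply: measurable_funM => //; apply: measurable_funB => //; exact: measurable_translate.
rewrite -(ge0_integralD mu measurableT).
- apply: le_int => w; first by rewrite lee_fin.
  rewrite -EFinD lee_fin -mulrDl.
  have -> : g (w + k) * rho (y - w) - g w * rho (y - w) - h y * rho (y - w) =
     (eta (w + k) * (f (w + k) - f w) + (h w - h y)) * rho (y - w).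
    by rewrite /g /h /commutator; ring.
  rewrite normrM (ger0_norm (rho0 _)) ler_wpM2r// (le_trans (ler_normD _ _))//.
  by rewrite lerD2r normrM ger0_norm.
- by move=> w _; rewrite lee_fin !mulr_ge0.
- apply/measurable_EFinP; apply: measurable_funM; last exact: measurable_reflect.
  apply: measurable_funM; first exact: measurable_translate.
  by apply: measurableT_comp => //; apply: measurable_funB => //; exact: measurable_translate.
- by move=> w _; rewrite lee_fin !mulr_ge0.
- apply/measurable_EFinP; apply: measurable_funM; last exact: measurable_reflect.
  by apply: measurableT_comp => //; exact: measurable_funB.
Qed.

Lemma piece_main_term k :
  (\int[mu]_y \int[mu]_w (eta (w + k) * `|f (w + k) - f w| * rho (y - w))%:E =
   \int[mu]_w (eta (w + k) * `|f (w + k) - f w|)%:E)%E.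
Proof.
have mA : measurable_fun setT (fun w => eta (w + k) * `|f (w + k) - f w|).
  apply: measurable_funM; first exact: measurable_translate.
  by apply: measurableT_comp => //; apply: measurable_funB => //; exact: measurable_translate.
have A0 w : 0 <= eta (w + k) * `|f (w + k) - f w| by rewrite mulr_ge0.
rewrite (fubini_tonelli (fun z : V * V => (eta (z.2 + k) * `|f (z.2 + k) - f z.2| * rho (z.1 - z.2))%:E)) /=.
- apply: eq_integral => w _; under eq_integral do rewrite EFinM.
  have mr : measurable_fun setT (fun y : V => (rho (y - w))%:E).
    by apply/measurable_EFinP; exact: measurable_diff.
  rewrite (ge0_integralZl mu measurableT mr); [|by move=> y _; rewrite lee_fin|by rewrite lee_fin].
  rewrite (ge0_integral_shift (- w) (f := fun x => (rho x)%:E))//; first by rewrite rho1 mule1.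
  exact/measurable_EFinP.
- apply/measurable_EFinP; apply: measurable_funM; last exact: measurable_diff.
  exact: (measurableT_comp mA).
- by move=> z; rewrite lee_fin mulr_ge0.
Qed.

Lemma piece_error_term k (delta : R) (T : \bar R) : (0 <= T)%E ->
  (forall z, rho z != 0 -> `|z| < delta) ->
  (forall z, `|z| < delta -> (increment (commutator eta f k) z <= T)%E) ->
  (\int[mu]_y \int[mu]_w (`|commutator eta f k w - commutator eta f k y| * rho (y - w))%:E <= T)%E.
Proof.
move=> T0 supp HT; pose h := commutator eta f k.
have mh : measurable_fun setT h.
  by apply: measurable_funM => //; apply: measurable_funB => //; exact: measurable_translate.
rewrite (integral_doubleE (G := fun z : V * V => (`|h z.1 - h z.2| * rho (z.2 - z.1))%:E)) /=; last first.
- by move=> z; rewrite lee_fin mulr_ge0.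
- apply/measurable_EFinP; apply: measurable_funM; last exact: measurable_diff.
  by apply: measurableT_comp => //; apply: measurable_funB; exact: (measurableT_comp mh).
apply: (@le_trans _ _ (\int[mu]_z ((rho (- z))%:E * T))%E).
  apply: le_int => z; first by apply: integral_ge0 => y _; rewrite lee_fin mulr_ge0.
  rewrite (_ : (\int[mu]_y _)%E = ((rho (- z))%:E * increment h z)%E); last first.
    rewrite -ge0_integralZl//; last 2 first.
    - exact: measurable_increment_integrand.
    - by rewrite lee_fin.
    apply: eq_integral => y _; rewrite -EFinM mulrC.
    by have -> : y - (y + z) = - z by rewrite opprD addrA subrr add0r.
  have [->|rz] := eqVneq (rho (- z)) 0; first by rewrite !mul0e.
  rewrite lee_wpmul2l ?lee_fin// HT//.
  by have := supp _ rz; rewrite normrN.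
have mr : measurable_fun setT (fun z : V => (rho (- z))%:E).
  by apply/measurable_EFinP; apply: (measurableT_comp mrho); exact: measurable_rV_opp.
rewrite ge0_integralZr//; last by move=> z _; rewrite lee_fin.
rewrite (_ : (\int[mu]_z (rho (- z))%:E)%E = 1%E) ?mul1e//.
by under eq_integral do rewrite -sub0r; exact: integral_rho_reflect.
Qed.

Lemma piece_mass : (\int[mu]_x (convol g rho x)%:E = \int[mu]_x (g x)%:E)%E.
Proof.
have ig := integrable_piece.
have mg : measurable_fun setT g by exact: measurable_funM.
have g0 x : 0 <= g x by rewrite /g mulr_ge0.
under eq_integral do rewrite convolE//.
rewrite (fubini_tonelli (fun z : V * V => (g z.2 * rho (z.1 - z.2))%:E)) /=.
- apply: eq_integral => w _; under eq_integral do rewrite EFinM.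
  have mr : measurable_fun setT (fun y : V => (rho (y - w))%:E).
    by apply/measurable_EFinP; exact: measurable_diff.
  rewrite (ge0_integralZl mu measurableT mr); [|by move=> y _; rewrite lee_fin|by rewrite lee_fin].
  rewrite (ge0_integral_shift (- w) (f := fun x => (rho x)%:E))//; first by rewrite rho1 mule1.
  exact/measurable_EFinP.
- apply/measurable_EFinP; apply: measurable_funM; last exact: measurable_diff.
  exact: (measurableT_comp mg).
- by move=> z; rewrite lee_fin mulr_ge0.
Qed.
End piece.

(** The increment of f D, where D = eta(. + k) - eta, is at most the increment of f
    times sup |D| <= 2 C min(1, |k|), plus the integral of f times the increment
    of D.  The latter is both at most 4 C min(1, |k|) and at most 4 C delta;
    interpolating with exponents a and theta keeps the factor min(1, |k|)^a, which
    makes the kernel integrable when a > s, and a positive power of delta, which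
    makes the error small. *)
Lemma commutator_increment (eta f : V -> R) (C delta theta a : R) k z :
  bounded_lipschitz eta -> (forall x, `|eta x| <= C) ->
  (forall x y, `|eta x - eta y| <= C * `|x - y|) ->
  measurable_fun setT f -> (forall x, 0 <= f x) ->
  0 < theta -> 0 < a -> theta + a = 1 -> `|z| <= delta ->
  (increment (commutator eta f k) z <=
    (2 * C * Num.min 1 `|k| `^ a)%:E * increment f z +
    (4 * C * delta `^ theta * Num.min 1 `|k| `^ a)%:E * \int[mu]_y (f y)%:E)%E.
Proof.
move=> bl b l mf f0 th0 a0 tha zd.
have C0 : 0 <= C by rewrite (le_trans _ (b 0)).
pose m := Num.min 1 `|k|.
have m0 : 0 <= m by rewrite le_min ler01 normr_ge0.
have m1 : m <= 1 by rewrite ge_min lexx.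
have d0 : 0 <= delta by apply: le_trans zd.
pose D x := eta (x + k) - eta x.
have Dm x : `|D x| <= 2 * C * m.
  rewrite /m; case: (leP 1 `|k|) => k1.
    by rewrite mulr1 (le_trans (ler_normB _ _))// mulr_natl mulr2n lerD.
  apply: le_trans (l _ _) _; rewrite addrAC subrr add0r ler_wpM2r//.
  by rewrite mulr_natl mulr2n lerDl.
have interp (t p q : R) : 0 <= t -> t <= p -> t <= q -> t <= p `^ theta * q `^ a.
  move=> t0 tp tq; have p0 := le_trans t0 tp; have q0 := le_trans t0 tq.
  rewrite -[X in X <= _](powRr1 t0) -tha.
  have [->|tn0] := eqVneq t 0; first by rewrite powR0 ?mulr_ge0 ?powR_ge0// tha oner_eq0.
  rewrite powRD; last by rewrite tn0 implybT.
  by rewrite ler_pM ?powR_ge0// ge0_ler_powR ?nnegrE// ltW.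
have ma : m <= m `^ a.
  have [->|mn0] := eqVneq m 0; first exact: powR_ge0.
  by rewrite ger1_powR ?m1 ?lt_neqAle ?m0 ?andbT 1?eq_sym//; lra.
have D2 x : `|D (x + z) - D x| <= 4 * C * (delta `^ theta * m `^ a).
  have h1 : `|D (x + z) - D x| <= 4 * C * m.
    rewrite (le_trans (ler_normB _ _))//; have := Dm x; have := Dm (x + z); lra.
  have h2 : `|D (x + z) - D x| <= 4 * C * delta.
    have -> : D (x + z) - D x = (eta (x + k + z) - eta (x + k)) - (eta (x + z) - eta x).
      by rewrite /D (addrAC x z k); ring.
    rewrite (le_trans (ler_normB _ _))//.
    have h a' : `|eta (a' + z) - eta a'| <= C * delta.
      by rewrite (le_trans (l _ _))// addrAC subrr add0r ler_wpM2l.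
    have := h (x + k); have := h x; have Cd : 0 <= C * delta by rewrite mulr_ge0.
    lra.
  have [C00|Cn0] := eqVneq C 0; first by rewrite C00 mulr0 !mul0r in h1 *.
  have C4 : 0 < 4 * C by rewrite mulr_gt0// lt_neqAle eq_sym Cn0.
  rewrite mulrC -ler_pdivrMr//; apply: interp.
  - by rewrite divr_ge0// ltW.
  - by rewrite ler_pdivrMr// mulrC.
  - by rewrite ler_pdivrMr// mulrC.
have mfE : measurable_fun setT (fun y => (f y)%:E) by exact/measurable_EFinP.
have fE0 (y : V) (_ : setT y) : (0 <= (f y)%:E)%E by rewrite lee_fin.
have minc := measurable_increment_integrand z mf.
have c1 : (0 <= (2 * C * m `^ a)%:E)%E by rewrite lee_fin !mulr_ge0 ?powR_ge0.
have c2 : (0 <= (4 * C * delta `^ theta * m `^ a)%:E)%E by rewrite lee_fin !mulr_ge0 ?powR_ge0.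
rewrite -/m /increment -(ge0_integralZl mu measurableT minc)// -(ge0_integralZl mu measurableT mfE fE0)//.
rewrite -(ge0_integralD mu measurableT)//.
- apply: le_int => y; first by rewrite lee_fin.
  rewrite -!EFinM -EFinD lee_fin /commutator -/(D y) -/(D (y + z)).
  have -> : f (y + z) * D (y + z) - f y * D y =
    (f (y + z) - f y) * D (y + z) + f y * (D (y + z) - D y) by ring.
  rewrite (le_trans (ler_normD _ _))// !normrM lerD//.
    rewrite mulrC ler_wpM2r// (le_trans (Dm _))// ler_wpM2l// mulr_ge0//.
  by rewrite (ger0_norm (f0 y)) mulrC ler_wpM2r// (le_trans (D2 _))// !mulrA.
- by move=> y _; rewrite mule_ge0.
- by apply: emeasurable_funM => //; exact: measurable_cst.
- by move=> y _; rewrite mule_ge0// lee_fin.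
- by apply: emeasurable_funM => //; exact: measurable_cst.
Qed.
End one_piece.

(** * Mollification of all the pieces and approximation by test functions *)

Section mollified_sum.
Variables (R : realType) (n : nat).
Local Notation N := n.+1.
Local Notation mu := (@lebesgue_rV R N).
Local Notation V := 'rV[R]_N.
Variables (m : nat) (eta rho : nat -> V -> R) (f : V -> R).
Hypothesis bl_eta : forall i, bounded_lipschitz (eta i).
Hypothesis eta0 : forall i x, 0 <= eta i x.
Hypothesis eta1 : forall x, \sum_(i < m) eta i x = 1.
Hypothesis mf : measurable_fun setT f.
Hypothesis f0 : forall x, 0 <= f x.
Hypothesis if_ : integrable_rV f.
Hypothesis bl_rho : forall i, bounded_lipschitz (rho i).
Hypothesis rho0 : forall i x, 0 <= rho i x.
Hypothesis rho1 : forall i, (\int[mu]_x (rho i x)%:E = 1)%E.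

Definition mollified (x : V) : R := \sum_(i < m) convol (fun x => eta i x * f x) (rho i) x.

(** Since the eta_i sum to 1, the commutators sum to 0 and may be inserted in each
    piece; the main terms then recombine to the increment of f. *)
Lemma mollified_increment_le k (delta : R) (T : nat -> \bar R) :
  (forall i, 0 <= T i)%E ->
  (forall i z, rho i z != 0 -> `|z| < delta) ->
  (forall i z, `|z| < delta -> (increment (commutator (eta i) f k) z <= T i)%E) ->
  (increment mollified k <= increment f k + \sum_(i < m) T i)%E.
Proof.
move=> T0 supp HT.
pose A i y := (\int[mu]_w (eta i (w + k) * `|f (w + k) - f w| * rho i (y - w))%:E)%E.
pose B i y := (\int[mu]_w (`|commutator (eta i) f k w - commutator (eta i) f k y| * rho i (y - w))%:E)%E.
have meta i := bounded_lipschitz_measurable (bl_eta i).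
have mrho i := bounded_lipschitz_measurable (bl_rho i).
have mc i : measurable_fun setT (commutator (eta i) f k).
  by apply: measurable_funM => //; apply: measurable_funB => //; exact: measurable_translate.
have mD i : measurable_fun setT (fun w : V => eta i (w + k) * `|f (w + k) - f w|).
  apply: measurable_funM; first exact: measurable_translate.
  by apply: measurableT_comp => //; apply: measurable_funB => //; exact: measurable_translate.
have A0 i y : (0 <= A i y)%E.
  by apply: integral_ge0 => w _; rewrite lee_fin !mulr_ge0.
have B0 i y : (0 <= B i y)%E.
  by apply: integral_ge0 => w _; rewrite lee_fin mulr_ge0.
have mA i : measurable_fun setT (A i).
  apply: (@measurable_fun_fubini_tonelli_F _ _ _ _ R mu
    (fun z : V * V => (eta i (z.2 + k) * `|f (z.2 + k) - f z.2| * rho i (z.1 - z.2))%:E)).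
    apply/measurable_EFinP; apply: measurable_funM; last exact: measurable_diff.
    exact: (measurableT_comp (mD i)).
  by move=> z; rewrite lee_fin !mulr_ge0.
have mB i : measurable_fun setT (B i).
  apply: (@measurable_fun_fubini_tonelli_F _ _ _ _ R mu
    (fun z : V * V => (`|commutator (eta i) f k z.2 - commutator (eta i) f k z.1| * rho i (z.1 - z.2))%:E)).
    apply/measurable_EFinP; apply: measurable_funM; last exact: measurable_diff.
    by apply: measurableT_comp => //; apply: measurable_funB; exact: (measurableT_comp (mc i)).
  by move=> z; rewrite lee_fin mulr_ge0.
apply: (@le_trans _ _ (\int[mu]_y (\sum_(i < m) (A i y + B i y)))%E).
  apply: le_int => y; first by rewrite lee_fin.
  have -> : mollified (y + k) - mollified y = \sum_(i < m)
     (convol (fun x => eta i x * f x) (rho i) (y + k) - convol (fun x => eta i x * f x) (rho i) y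
      - commutator (eta i) f k y).
    rewrite /mollified !sumrB /commutator -mulr_sumr sumrB !eta1 subrr mulr0 subr0//.
  apply: (@le_trans _ _ (\sum_(i < m) (`|convol (fun x => eta i x * f x) (rho i) (y + k) - convol (fun x => eta i x * f x) (rho i) y
      - commutator (eta i) f k y|)%:E)%E).
    by rewrite sumEFin lee_fin ler_norm_sum.
  by apply: lee_sum => i _; exact: piece_increment_le.
rewrite ge0_integral_sum//; last 2 first.
- by move=> i; exact: emeasurable_funD.
- by move=> i y _; rewrite adde_ge0.
under eq_bigr => i _ do rewrite ge0_integralD//.
rewrite big_split /=; apply: leeD; last first.
  by apply: lee_sum => i _; exact: (piece_error_term (bl_eta i) mf (bl_rho i) (rho0 i) (rho1 i) (T0 i) (supp i) (HT i)).
under eq_bigr => i _ do rewrite /A piece_main_term//.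
rewrite -ge0_integral_sum//; last 2 first.
- by move=> i; apply/measurable_EFinP; exact: mD.
- by move=> i y _; rewrite lee_fin mulr_ge0.
apply: le_int => y; first by apply: sume_ge0 => i _; rewrite lee_fin mulr_ge0.
by rewrite sumEFin -mulr_suml eta1 mul1r.
Qed.

Lemma mollified_mass : (\int[mu]_x (mollified x)%:E = \int[mu]_x (f x)%:E)%E.
Proof.
have meta i := bounded_lipschitz_measurable (bl_eta i).
have ip i := integrable_piece (bl_eta i) mf if_.
have c0 i x : 0 <= convol (fun x => eta i x * f x) (rho i) x.
  by apply: Rintegral_ge0 => w _; rewrite !mulr_ge0.
under eq_integral do rewrite /mollified -sumEFin.
rewrite ge0_integral_sum//; last 2 first.
- move=> i; apply/measurable_EFinP; apply: bounded_lipschitz_measurable.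
  exact: conv_bounded_lipschitz.
- by move=> i x _; rewrite lee_fin.
under eq_bigr => i _ do rewrite piece_mass//.
rewrite -ge0_integral_sum//; last 2 first.
- by move=> i; apply/measurable_EFinP; exact: measurable_funM.
- by move=> i x _; rewrite lee_fin mulr_ge0.
by apply: eq_integral => x _; rewrite sumEFin -mulr_suml eta1 mul1r.
Qed.

Lemma mollified_ge0 x : 0 <= mollified x.
Proof.
by apply: sumr_ge0 => i _; apply: Rintegral_ge0 => w _; rewrite !mulr_ge0.
Qed.

Lemma mollified_bounded_lipschitz : bounded_lipschitz mollified.
Proof.
have H (s : seq 'I_m) : bounded_lipschitz
    (fun x => \sum_(i <- s) convol (fun x => eta i x * f x) (rho i) x).
  elim: s => [|i s IH].
    by under eq_fun do rewrite big_nil; exact: bounded_lipschitz_cst.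
  under eq_fun do rewrite big_cons.
  have [C1 [b1 l1]] := IH.
  have [C2 [b2 l2]] := conv_bounded_lipschitz (integrable_piece (bl_eta i) mf if_) (bl_rho i).
  exists (C2 + C1); split => [x|x y].
    by rewrite (le_trans (ler_normD _ _))// lerD.
  by rewrite opprD addrACA (le_trans (ler_normD _ _))// mulrDl lerD.
exact: H.
Qed.
End mollified_sum.

Section test_functions.
Variables (R : realType) (n : nat).
Local Notation N := n.+1.
Local Notation mu := (@lebesgue_rV R N).
Local Notation V := 'rV[R]_N.
Implicit Types (Om : set V) (f : V -> R).

Lemma bounded_mu_lty Om : measurable Om -> bounded_set Om -> (mu Om < +oo)%E.
Proof.
move=> mOm [M [Mr hM]]; have M1 : 0 <= `|M| + 1 by rewrite addr_ge0.
apply: (@le_lt_trans _ _ (mu [set z : V | `|z| <= `|M| + 1])).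
  apply: le_measure; rewrite ?inE//; first exact: measurable_norm_le.
  move=> x Ox /=; apply: (hM (`|M| + 1)) => //.
  by rewrite (le_lt_trans (ler_norm M))// ltrDl.
by rewrite mu_norm_le// ltry.
Qed.

Lemma bounded_set_compact_supp Om f : bounded_set Om -> supp f `<=` Om -> compact (supp f).
Proof.
move=> [M [Mr hM]] fO; apply: bounded_closed_compact; last exact: closed_closure.
by exists M; split => // M' MM' x /fO; exact: hM.
Qed.

Lemma supp_sum_sub Om m (F : 'I_m -> V -> R) : (forall i, supp (F i) `<=` Om) ->
  supp (fun x => \sum_(i < m) F i x) `<=` Om.
Proof.
move=> H.
apply: (@subset_trans _ (\bigcup_(i in [set: 'I_m]) supp (F i))); last by move=> x [i _]; exact: H.
rewrite /supp closureE; apply: smallest_sub.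
  by apply: closed_bigcup => [|i _]; [exact: finite_finset|exact: closed_closure].
move=> x /= sx; apply: contrapT => nx; move/eqP: sx; apply.
apply: big1 => i _; apply: contrapT => /eqP Fx; apply: nx; exists i => //.
exact: subset_closure.
Qed.

Lemma supp_convol_sub Om (g rho : V -> R) v (eps : R) : 0 < eps ->
  (forall x, rho x != 0 -> `|x - v| < eps / 2) ->
  (forall y w, g y != 0 -> `|w - v| < eps -> Om (y + w)) ->
  supp (convol g rho) `<=` Om.
Proof.
move=> e0 rv gO z cz.
have [x [/= xn0 xz]] := cz (ball z (eps / 2)) (nbhsx_ballx _ _ (divr_gt0 e0 (ltr0Sn _ 1))).
have [w [gw rw]] : exists w, g w != 0 /\ rho (x - w) != 0.
  apply: contrapT => H; move/eqP: xn0; apply; rewrite /convol /Rintegral.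
  rewrite (_ : (\int[mu]_w _)%E = 0%E)//.
  rewrite (eq_integral (cst 0%E)) ?integral0// => w _.
  have [->|gw] := eqVneq (g w) 0; first by rewrite mul0r.
  have [->|rw] := eqVneq (rho (x - w)) 0; first by rewrite mulr0.
  by exfalso; apply: H; exists w.
have -> : z = w + (z - w) by rewrite addrC subrK.
apply: gO => //.
have -> : z - w - v = (x - w - v) + (z - x) by rewrite [RHS]addrC -!addrA addKr.
rewrite (splitr eps) (le_lt_trans (ler_normD _ _))// ltrD ?rv//.
by move: xz; rewrite -ball_normE.
Qed.

Lemma exists_small_power (Q sigma e : R) : 0 <= Q -> 0 < sigma -> 0 < e ->
  exists2 delta : R, 0 < delta <= 1 & Q * delta `^ sigma <= e.
Proof.
move=> Q0 s0 e0; have Q1 : 0 < Q + 1 by rewrite ltr_wpDl.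
pose d := Num.min 1 ((e / (Q + 1)) `^ sigma^-1).
have d0 : 0 < d by rewrite lt_min ltr01 powR_gt0// divr_gt0.
exists d; first by rewrite d0 ge_min lexx.
have h : d `^ sigma <= e / (Q + 1).
  apply: (@le_trans _ _ (((e / (Q + 1)) `^ sigma^-1) `^ sigma)).
    by rewrite ge0_ler_powR ?nnegrE ?powR_ge0 ?(ltW s0) ?(ltW d0)// ge_min lexx orbT.
  by rewrite -powRrM mulVf ?gt_eqF// powRr1// divr_ge0// ltW.
apply: (@le_trans _ _ ((Q + 1) * d `^ sigma)); first by rewrite ler_wpM2r ?powR_ge0// lerDl.
by rewrite mulrC -ler_pdivlMr.
Qed.
End test_functions.

Section approximation.
Variables (R : realType) (n : nat).
Local Notation N := n.+1.
Local Notation mu := (@lebesgue_rV R N).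
Local Notation V := 'rV[R]_N.
Implicit Types (Om : set V) (f : V -> R).

Lemma density_integrable Om f : bounded_set Om -> density Om f -> integrable_rV f.
Proof.
move=> [M [Mr hM]] [mf f01 fOm].
apply: (@integrable_bounded_support _ _ f 1 (`|M| + 1)) => //.
- by move=> x; have /andP[h0 h1] := f01 x; rewrite ger0_norm.
- move=> x hx; apply: fOm => /(hM (`|M| + 1)) h; move: hx; rewrite ltNge h//.
  by rewrite (le_lt_trans (ler_norm M))// ltrDl.
Qed.

(** T k i bounds the contribution of the i-th commutator at step k: the Hoelder
    estimate makes the increments of f at scale delta at most a multiple of
    delta^s.  The integral of T against the kernel is a multiple of
    delta^sigma, where sigma = min(s, theta), and delta is chosen last. *)
Lemma test_approx Om s f (e : R) : open Om -> bounded_set Om -> lipschitz_boundary Om ->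
  0 < s < 1 -> density Om f -> (energy (frac_kernel s 1) f < +oo)%E -> 0 < e ->
  exists phi, [/\ test_function Om phi, (forall x, 0 <= phi x), bounded_lipschitz phi,
    (\int[mu]_x (phi x)%:E = \int[mu]_x (f x)%:E)%E &
    (energy (frac_kernel s 1) phi <= energy (frac_kernel s 1) f + e%:E)%E].
Proof.
move=> oOm bOm lOm /andP[s0 s1] df Eoo e0.
have [mf f01 fOm] := df.
have if_ := density_integrable bOm df.
have f0 x : 0 <= f x by have /andP[] := f01 x.
have [m [eta [bl e01 esum ein]]] := partition_of_unity oOm bOm lOm.
have eta0 i x : 0 <= eta i x by have /andP[] := e01 i x.
have /choice[C hC] i : exists C : R, (forall x, `|eta i x| <= C) /\
    (forall x y, `|eta i x - eta i y| <= C * `|x - y|).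
  by have [C [b l]] := bl i; exists C.
have C0 i : 0 <= C i by rewrite (le_trans _ ((hC i).1 0)).
have [H H0 hH] := increment_holder n s0.
(* Any theta + a = 1 with theta > 0 and a > s would do. *)
pose theta := (1 - s) / 2; pose a := (1 + s) / 2; pose sigma := Num.min s theta.
have th0 : 0 < theta by rewrite /theta divr_gt0//; lra.
have a0 : 0 < a by rewrite /a divr_gt0//; lra.
have tha : theta + a = 1 by rewrite /theta /a; lra.
have sg0 : 0 < sigma by rewrite lt_min s0.
have sa : 0 < s < a by rewrite s0 /a; lra.
have a1 : a <= 1 by rewrite /a; lra.
have K0 z : 0 <= frac_kernel s 1 z :> R by exact: frac_kernel_ge0.
have mK : measurable_fun setT (frac_kernel s 1 : V -> R) by exact: measurable_frac_kernel.
pose J := fine (\int[mu]_z (weight a s z)%:E).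
have Jfin : (\int[mu]_z (weight a s z)%:E \is a fin_num)%E.
  rewrite ge0_fin_numE; first exact: integral_weight_lty.
  by apply: integral_ge0 => z _; rewrite lee_fin weight_ge0.
have J0 : 0 <= J by apply: fine_ge0; apply: integral_ge0 => z _; rewrite lee_fin weight_ge0.
pose E0 := fine (energy (frac_kernel s 1) f).
have Efin : energy (frac_kernel s 1) f \is a fin_num by rewrite ge0_fin_numE// energy_ge0.
have E00 : 0 <= E0 by apply: fine_ge0; exact: energy_ge0.
pose F0 := fine (\int[mu]_x (f x)%:E).
have Ffin : (\int[mu]_x (f x)%:E \is a fin_num)%E by exact: integrable_fin_num if_.
have F00 : 0 <= F0 by apply: fine_ge0; apply: integral_ge0 => x _; rewrite lee_fin.
pose A := 2 * (H * E0) + 4 * F0.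
have A0 : 0 <= A by rewrite addr_ge0// !mulr_ge0.
pose Ctot := \sum_(i < m) C i.
have Ctot0 : 0 <= Ctot by apply: sumr_ge0.
have Q0 : 0 <= Ctot * A * J by rewrite !mulr_ge0.
have [delta /andP[d0 d1] hd] := exists_small_power Q0 sg0 e0.
have /choice[v hv] i : exists v, exists eps : R, [/\ 0 < eps, (forall w, `|w - v| < eps -> `|w| < delta) &
    (i < m)%N -> forall y w, Om y -> eta i y != 0 -> `|w - v| < eps -> Om (y + w)].
  case: (ltnP i m) => im; last by exists 0, delta; split => // w; rewrite subr0.
  by have [v [eps [? ? h]]] := ein i im delta d0; exists v, eps; split.
have /choice[eps heps] := hv.
have /choice[rho hrho] i : exists rho, mollifier (v i) (eps i / 2) rho.
  by apply: exists_mollifier; have [h _ _] := heps i; rewrite divr_gt0.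
have brho i : bounded_lipschitz (rho i) by have [] := hrho i.
have rho0 i x : 0 <= rho i x by have [_ h _ _ _] := hrho i; exact: h.
have rho1 i : (\int[mu]_x (rho i x)%:E = 1)%E by have [] := hrho i.
have rsupp i z : rho i z != 0 -> `|z - v i| < eps i / 2 by have [_ _ _ h _] := hrho i; exact: h.
have rdelta i z : rho i z != 0 -> `|z| < delta.
  move=> /rsupp h; have [ep h1 _] := heps i; apply: h1; apply: (lt_trans h); lra.
pose m1 (k : V) : R := Num.min 1 `|k|.
pose T (k : V) i := (C i * A * delta `^ sigma * m1 k `^ a)%:E.
have T0 k i : (0 <= T k i)%E by rewrite lee_fin !mulr_ge0 ?powR_ge0.
have suppOm : supp (mollified m eta rho f) `<=` Om.
  apply: supp_sum_sub => i; have [ep _ h] := heps i.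
  apply: (supp_convol_sub ep (rsupp i)) => y w; rewrite mulf_eq0 negb_or => /andP[ey fy].
  apply: h => //; by apply: contrapT => /fOm fy0; rewrite fy0 eqxx in fy.
exists (mollified m eta rho f); split.
- split.
  + apply: (@smooth_sum _ _ _ (index_enum 'I_m) (fun i => convol (fun x => eta i x * f x) (rho i))) => i.
    by have [_ _ _ _ h] := hrho i; apply: h; exact: integrable_piece.
  + exact: (bounded_set_compact_supp bOm).
  + exact: suppOm.
- exact: mollified_ge0.
- exact: mollified_bounded_lipschitz.
- exact: mollified_mass.
have inc k : (increment (mollified m eta rho f) k <= increment f k + \sum_(i < m) T k i)%E.
  apply: (mollified_increment_le bl eta0 esum mf f0 if_ brho rho0 rho1 (T0 k) rdelta) => i z zd.
  apply: le_trans (commutator_increment k (bl i) (hC i).1 (hC i).2 mf f0 th0 a0 tha (ltW zd)) _.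
  have zs : `|z| `^ s <= delta `^ sigma.
    apply: (@le_trans _ _ (delta `^ s)); first by rewrite ge0_ler_powR ?nnegrE ?(ltW s0) ?(ltW d0) ?(ltW zd).
    by rewrite ger_powR ?d0//= ge_min lexx.
  have ds : delta `^ theta <= delta `^ sigma by rewrite ger_powR ?d0//= ge_min lexx orbT.
  have i1 : (increment f z <= (H * E0 * delta `^ sigma)%:E)%E.
    apply: le_trans (hH f z mf) _; rewrite -(fineK Efin) -EFinM lee_fin -/E0.
    by rewrite mulrAC ler_wpM2l// mulr_ge0.
  apply: (@le_trans _ _ ((2 * C i * m1 k `^ a)%:E * (H * E0 * delta `^ sigma)%:E +
     (4 * C i * delta `^ sigma * m1 k `^ a)%:E * F0%:E)%E).
    apply: leeD; first by rewrite lee_wpmul2l// lee_fin !mulr_ge0 ?powR_ge0.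
    rewrite -(fineK Ffin) -/F0 -!EFinM lee_fin ler_wpM2r// ler_wpM2r ?powR_ge0// ler_wpM2l//.
    by rewrite mulr_ge0.
  rewrite -!EFinM -EFinD lee_fin /A le_eqVlt; apply/orP; left; apply/eqP; ring.
have sumT k : (\sum_(i < m) T k i = (Ctot * A * delta `^ sigma * m1 k `^ a)%:E)%E.
  by rewrite sumEFin -!mulr_suml.
have mw : measurable_fun setT (fun z : V => (weight a s z)%:E).
  by apply/measurable_EFinP; exact: measurable_weight.
have w0 (z : V) : setT z -> (0 <= (weight a s z)%:E)%E by rewrite lee_fin weight_ge0.
pose B := Ctot * A * delta `^ sigma.
have B0 : 0 <= B by rewrite !mulr_ge0 ?powR_ge0.
have mE := measurable_energy_integrand mK mf.
apply: (@le_trans _ _ (\int[mu]_k ((frac_kernel s 1 k)%:E * increment f k + B%:E * (weight a s k)%:E))%E).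
  apply: le_int => k; first by rewrite mule_ge0 ?lee_fin ?increment_ge0.
  apply: (@le_trans _ _ ((frac_kernel s 1 k)%:E * (increment f k + \sum_(i < m) T k i))%E).
    by rewrite lee_wpmul2l ?lee_fin.
  rewrite ge0_muleDr ?increment_ge0 ?sume_ge0// leeD2l// sumT -!EFinM lee_fin -/B.
  rewrite mulrCA ler_wpM2l// /weight mulrC -/(m1 k) ler_wpM2l ?powR_ge0//.
  exact: frac_kernel_le.
rewrite (ge0_integralD mu measurableT _ mE); last 3 first.
- by move=> k _; rewrite mule_ge0 ?lee_fin ?increment_ge0.
- by move=> k _; rewrite mule_ge0// w0.
- by apply: emeasurable_funM => //; exact: measurable_cst.
rewrite leeD2l// (ge0_integralZl mu measurableT mw w0) ?lee_fin//.
rewrite -(fineK Jfin) -EFinM lee_fin -/J; apply: le_trans hd.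
by rewrite /B mulrAC.
Qed.
End approximation.

(** * Bounds for the first eigenvalue *)

Section eigenvalue_bounds.
Variables (R : realType) (n : nat).
Local Notation N := n.+1.
Local Notation mu := (@lebesgue_rV R N).
Local Notation V := 'rV[R]_N.
Implicit Types (Om : set V) (u phi : V -> R).

Lemma lambda1_ge0 Om s p : (0 <= lambda1 Om s p)%E.
Proof. by apply: le_ereal_inf_tmp => _ [u _ <-]; exact: poweR_ge0. Qed.

Lemma Lp_norm_poweR Om p u : 0 < p -> (forall x, ~ Om x -> u x = 0) ->
  (Lp_norm Om p u = (\int[mu]_x (`|u x| `^ p)%:E) `^ p^-1)%E.
Proof.
move=> p0 uO; have E : u \_ Om = u.
  apply/funext => x; rewrite patchE; case: ifPn => // /negP.
  by rewrite inE => /uO ->.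
rewrite /Lp_norm E unlock; congr (_ `^ _)%E.
Qed.

(** For an admissible u, the coarea inequality for v = |u|^p, whose integral is 1,
    is combined with [energy_powR_le]. *)
Lemma lambda1_ge Om s p M J : 0 < s < 1 -> 1 < p -> 0 <= M ->
  (\int[mu]_z (weight ((1 + s) / 2) s z)%:E <= J%:E)%E ->
  (forall E, measurable E -> E `<=` Om -> (M%:E * mu E <= energy (trunc_kernel s p) \1_E)%E) ->
  ((M - 2 * (p - 1) * J)%:E <= lambda1 Om s p)%E.
Proof.
move=> /andP[s0 s1] p1 M0 hJ HM; have p0 : 0 < p by lra.
apply: le_ereal_inf_tmp => _ [u [[mu_ uO _] nu _] <-].
have Iu : (\int[mu]_x (`|u x| `^ p)%:E = 1)%E.
  have : ((Lp_norm Om p u) `^ p = 1)%E by rewrite nu poweR1r.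
  rewrite Lp_norm_poweR// -poweRrM mulVf ?gt_eqF// poweRe1//.
  by apply: integral_ge0 => x _; rewrite lee_fin powR_ge0.
rewrite gagliardo_poweR// EFinB leeBlDr//.
have mv : measurable_fun setT (fun x => `|u x| `^ p).
  by apply: (measurableT_comp (measurable_powR _)); exact: measurableT_comp.
have vO x : ~ Om x -> `|u x| `^ p = 0.
  by move=> /uO ->; rewrite normr0 powR0// gt_eqF.
have := coarea M0 (trunc_kernel_ge0 s p) (measurable_trunc_kernel s p) mv
  (fun x => powR_ge0 _ _) vO HM.
rewrite Iu mule1 => /le_trans; apply.
apply: le_trans (energy_powR_le s p1 mu_) _; rewrite Iu mule1 leeD2l//.
rewrite [X in (_ <= X)%E]EFinM lee_wpmul2l//; first by rewrite lee_fin mulr_ge0//; lra.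
apply: le_trans hJ; apply: le_int => z.
  by rewrite lee_fin le_min ler01 frac_kernel_ge0.
rewrite lee_fin; apply: min_frac_kernel_le => //; first exact: ltW.
have := ler0n R N; rewrite -natr1; have := ler0n R n => *; apply/andP; split; lra.
Qed.

(** With D = |phi(y + k) - phi(y)|, write D^p = D D^(p-1) and bound D^(p-1) by
    (B |k|^s)^(p-1); the power of |k| turns k_p into k_1. *)
Lemma pow_energy_test s p phi B : 0 < s -> 1 < p -> 0 <= B ->
  measurable_fun setT phi ->
  (forall x y, `|phi x - phi y| <= B * enorm (x - y) `^ s) ->
  (pow_energy s p phi <= (B `^ (p - 1))%:E * energy (frac_kernel s 1) phi)%E.
Proof.
move=> s0 p1 B0 mphi hB.
have mK : measurable_fun setT (frac_kernel s 1 : V -> R) by exact: measurable_frac_kernel.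
have mE := measurable_energy_integrand mK mphi.
rewrite /energy -(ge0_integralZl mu measurableT mE)//; last 2 first.
- by move=> k _; rewrite mule_ge0 ?increment_ge0 ?lee_fin ?frac_kernel_ge0.
- by rewrite lee_fin powR_ge0.
apply: le_int => k.
  by apply: integral_ge0 => y _; rewrite lee_fin mulr_ge0 ?powR_ge0 ?frac_kernel_ge0.
have mi := measurable_increment_integrand k mphi.
rewrite muleA -EFinM /increment -(ge0_integralZl mu measurableT mi)//; last first.
  by rewrite lee_fin mulr_ge0 ?powR_ge0 ?frac_kernel_ge0.
apply: le_int => y; first by rewrite lee_fin mulr_ge0 ?powR_ge0 ?frac_kernel_ge0.
rewrite -EFinM lee_fin.
have e0 : 0 <= enorm k by exact: sqrtr_ge0.
have [ez|ez] := eqVneq (enorm k) 0.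
  by rewrite (frac_kernel0 s0 (ltW p1) ez) (frac_kernel0 s0 (lexx 1) ez) !mulr0 mul0r.
have e1 : 0 < enorm k by rewrite lt_neqAle eq_sym ez.
set D := `|phi (y + k) - phi y|; have D0 : 0 <= D by exact: normr_ge0.
have DB : D <= B * enorm k `^ s by have := hB (y + k) y; rewrite addrAC subrr add0r.
have -> : D `^ p = D * D `^ (p - 1) by rewrite mulr_powRB1//; lra.
have -> : frac_kernel s p k = (enorm k `^ (s * (p - 1)))^-1 * frac_kernel s 1 k.
  rewrite /frac_kernel -invfM -powRD; last by rewrite ez implybT.
  by congr (_ `^ _)^-1; ring.
have h : D `^ (p - 1) <= B `^ (p - 1) * enorm k `^ (s * (p - 1)).
  rewrite powRrM -powRM ?powR_ge0// ge0_ler_powR ?nnegrE ?mulr_ge0 ?powR_ge0//; lra.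
have h2 : D `^ (p - 1) * (enorm k `^ (s * (p - 1)))^-1 <= B `^ (p - 1).
  by rewrite ler_pdivrMr// powR_gt0.
have c0 : 0 <= D * frac_kernel s 1 k by rewrite mulr_ge0 ?frac_kernel_ge0.
have := ler_wpM2l c0 h2; congr (_ <= _); ring.
Qed.

(** For |x - y| <= 1 by the Lipschitz bound, as |x - y| <= |x - y|^s; beyond, by the
    sup bound. *)
Lemma bounded_lipschitz_holder s phi : 0 < s < 1 -> bounded_lipschitz phi ->
  exists2 B, 0 < B & forall x y : V, `|phi x - phi y| <= B * enorm (x - y) `^ s.
Proof.
move=> /andP[s0 s1] [C [b l]]; have C0 : 0 <= C by rewrite (le_trans _ (b 0)).
exists (2 * C + 1) => [|x y]; first by rewrite ltr_wpDl// mulr_ge0.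
set z := x - y; have z0 : 0 <= enorm z by exact: sqrtr_ge0.
have C2 : 0 <= 2 * C + 1 by rewrite addr_ge0// mulr_ge0.
have [e1|e1] := leP 1 (enorm z).
  apply: (@le_trans _ _ ((2 * C + 1) * 1)).
    by rewrite mulr1 (le_trans (ler_normB _ _))//; have := b x; have := b y; lra.
  by rewrite ler_wpM2l// -[X in X <= _](powRr0 (enorm z)) ler_powR// ltW.
apply: (@le_trans _ _ ((2 * C + 1) * enorm z)).
  apply: le_trans (l x y) _; apply: ler_pM => //; last exact: norm_le_enorm.
  by lra.
rewrite ler_wpM2l//; have [->|ez] := eqVneq (enorm z) 0; first exact: powR_ge0.
have ez0 : 0 < enorm z <= 1 by rewrite (ltW e1) andbT lt_neqAle eq_sym ez.
by apply: ger1_powR => //; exact: ltW.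
Qed.

(** The competitor is phi divided by its L^p norm. *)
Lemma lambda1_le_test Om s p phi (S E : R) : 0 < s -> 1 < p ->
  test_function Om phi -> (forall x, 0 <= phi x) -> 0 < S ->
  (\int[mu]_x (phi x `^ p)%:E = S%:E)%E ->
  (pow_energy s p phi <= E%:E)%E ->
  (lambda1 Om s p <= (E / S)%:E)%E.
Proof.
move=> s0 p1 [sphi cphi phiO] phi0 S0 IS hE; have p0 : 0 < p by lra.
pose c := S `^ (- p^-1); have c0 : 0 < c by exact: powR_gt0.
have cp : c `^ p = S^-1 by rewrite /c -powRrM mulNr mulVf ?gt_eqF// powR_inv1// ltW.
have phiE x : ~ Om x -> phi x = 0.
  by move=> Ox; apply: contrapT => /eqP px; apply: Ox; apply: phiO; exact: subset_closure.
have mphi : measurable_fun setT phi.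
  by apply: rV_continuous_measurable; have [] := sphi [::].
pose u : V -> R := c \*: phi.
have mu_ : measurable_fun setT u by apply: measurable_funM.
have uE x : u x = c * phi x by [].
have tu : test_function Om u.
  have sE : supp u = supp phi.
    congr closure; apply/seteqP; split => x /=; rewrite uE mulf_eq0 negb_or (gt_eqF c0)//.
  by split; [exact: smoothZ|rewrite sE|rewrite sE].
have Wu : W0 Om s p u.
  split => // [x Ox|e e0]; first by rewrite uE phiE// mulr0.
  exists u => //.
  have -> : (u \- u)%R = cst 0 by apply/funext => x /=; rewrite subrr.
  rewrite Lp_norm_poweR// /gagliardo.
  rewrite (eq_integral (cst 0%E)); last first.
    move=> y _; rewrite (eq_integral (cst 0%E)) ?integral0// => x _.
    by rewrite /= subrr normr0 powR0 ?gt_eqF// mul0r.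
  rewrite integral0 (eq_integral (cst 0%E)); last first.
    by move=> y _; rewrite /= normr0 powR0 ?gt_eqF.
  by rewrite integral0 poweR0r ?invr_eq0 ?gt_eqF// adde0 lte_fin.
have Lu : (Lp_norm Om p u = 1)%E.
  rewrite Lp_norm_poweR//; last by move=> x Ox; rewrite uE phiE// mulr0.
  rewrite (_ : (\int[mu]_x _)%E = 1%E) ?poweR1r//.
  under eq_integral => x _ do rewrite uE normrM (gtr0_norm c0) (ger0_norm (phi0 x)) powRM ?(ltW c0)// cp EFinM.
  have mp : measurable_fun setT (fun x => (phi x `^ p)%:E).
    by apply/measurable_EFinP; apply: (measurableT_comp (measurable_powR _)).
  rewrite (ge0_integralZl mu measurableT mp).
  - by rewrite IS -EFinM mulVf// gt_eqF.
  - by move=> x _; rewrite lee_fin powR_ge0.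
  - by rewrite lee_fin invr_ge0 ltW.
have le1 : (lambda1 Om s p <= gagliardo s p u `^ p)%E.
  apply: ereal_inf_lbound; exists u => //; split => //.
  by apply: aeW => x; rewrite uE mulr_ge0// ltW.
apply: le_trans le1 _; rewrite gagliardo_poweR//.
apply: (@le_trans _ _ ((S^-1)%:E * pow_energy s p phi)%E); last first.
  rewrite mulrC EFinM lee_wpmul2l// lee_fin invr_ge0 ltW//.
have Si : (0 <= (S^-1)%:E)%E by rewrite lee_fin invr_ge0 ltW.
have mJ : measurable_fun setT (fun z : V * V => (`|phi (z.2 + z.1) - phi z.2| `^ p * frac_kernel s p z.1)%:E).
  by apply/measurable_EFinP; exact: measurable_pow_integrand.
have J0 (z : V * V) : (0 <= (`|phi (z.2 + z.1)%R - phi z.2| `^ p * frac_kernel s p z.1)%:E)%E.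
  by rewrite lee_fin mulr_ge0 ?powR_ge0 ?frac_kernel_ge0.
have mF := @measurable_fun_fubini_tonelli_F _ _ _ _ R mu _ mJ J0.
rewrite /pow_energy -(ge0_integralZl mu measurableT mF)//; last first.
  by move=> k _; apply: integral_ge0 => y _; exact: (J0 (k, y)).
apply: le_int => k.
  by apply: integral_ge0 => y _; rewrite lee_fin mulr_ge0 ?powR_ge0 ?frac_kernel_ge0.
rewrite -(ge0_integralZl mu measurableT (measurableT_comp mJ (pair1_measurable k)))//; last first.
  by move=> y _; exact: (J0 (k, y)).
apply: le_int => y; first by rewrite lee_fin mulr_ge0 ?powR_ge0 ?frac_kernel_ge0.
by rewrite !uE -mulrBr normrM (gtr0_norm c0) powRM ?(ltW c0)// cp -EFinM /= mulrA.
Qed.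
End eigenvalue_bounds.

(** * The limit *)

Section limit.
Variable R : realType.

Lemma cvg_ereal_bounds (T : Type) (F : set_system T) (FF : Filter F) (f : T -> \bar R) (l : \bar R) :
  (forall M : R, (M%:E < l)%E -> \forall p \near F, (M%:E <= f p)%E) ->
  (forall M : R, (l < M%:E)%E -> \forall p \near F, (f p <= M%:E)%E) ->
  f @ F --> l.
Proof.
case: l => [r| |] lo up.
- have near2 (e : R) : 0 < e -> \forall p \near F, ((r - e)%:E <= f p <= (r + e)%:E)%E.
    move=> e0; have h1 := lo (r - e) ltac:(by rewrite lte_fin ltrBlDr ltrDl).
    have h2 := up (r + e) ltac:(by rewrite lte_fin ltrDl).
    by near=> p; apply/andP; split; near: p.
  apply/fine_cvgP; split.
    have := near2 1 ltr01; apply: filterS => p /andP[h1 h2].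
    by rewrite fin_numE; case: (f p) h1 h2.
  apply/cvgrPdist_le => e e0; have := near2 e e0; apply: filterS => p /andP[] /=.
  case: (f p) => [x| |] //=; rewrite !lee_fin => h1 h2.
  by rewrite ler_norml; apply/andP; split; lra.
- by apply/cvgeyPge => A; apply: lo; rewrite ltry.
- by apply/cvgeNyPle => A; apply: up; rewrite ltNyr.
Unshelve. all: by end_near. Qed.
End limit.

Section main.
Variables (R : realType) (n : nat).
Local Notation N := n.+1.
Local Notation mu := (@lebesgue_rV R N).
Local Notation V := 'rV[R]_N.

(** An intermediate M < M' < cheeger absorbs the error term 2 (p - 1) J. *)
Lemma lambda1_lower (Om : set V) (s M : R) : open Om -> bounded_set Om -> 0 < s < 1 ->
  (M%:E < cheeger Om s)%E -> \forall p \near 1^'+, (M%:E <= lambda1 Om s p)%E.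
Proof.
move=> oOm bOm s01 MC; have /andP[s0 s1] := s01.
have mOm : measurable Om by exact: sub_sigma_algebra.
have [M0|M0] := ltP M 0.
  apply: nearW => p; apply: le_trans (lambda1_ge0 _ _ _).
  by rewrite lee_fin ltW.
have [M' MM' M'C] := lt_ereal_real MC.
have M'0 : 0 <= M' by rewrite (le_trans M0)// ltW.
have [p0 p01 HM] := trunc_cheeger mOm (bounded_mu_lty mOm bOm) s0 M'0 M'C.
pose W := (\int[mu]_z (weight ((1 + s) / 2) s z)%:E)%E.
have W0 : (0 <= W)%E by apply: integral_ge0 => z _; rewrite lee_fin weight_ge0.
have Wfin : W \is a fin_num.
  rewrite ge0_fin_numE//; apply: integral_weight_lty; last by lra.
  by rewrite s0/=; lra.
pose J := fine W; have J0 : 0 <= J by exact: fine_ge0.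
have J1 : 0 < 2 * J + 1 by lra.
pose d := (M' - M) / (2 * J + 1).
have d0 : 0 < d by rewrite divr_gt0// subr_gt0.
near=> p.
have p1 : 1 < p by near: p; exact: nbhs_right_gt.
have pp0 : p < p0 by near: p; exact: nbhs_right_lt.
have pd : p < 1 + d by near: p; apply: nbhs_right_lt; rewrite ltrDl.
have hJ : (W <= J%:E)%E by rewrite /J fineK.
apply: le_trans (lambda1_ge s01 p1 M'0 hJ _).
  rewrite lee_fin.
  have h : (p - 1) * (2 * J + 1) <= M' - M.
    by rewrite -ler_pdivlMr// lerBlDl ltW.
  have : 2 * (p - 1) * J <= (p - 1) * (2 * J + 1).
    have -> : (p - 1) * (2 * J + 1) = 2 * (p - 1) * J + (p - 1) by ring.
    by rewrite lerDl subr_ge0 ltW.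
  by lra.
by move=> E mE EOm; apply: HM => //; rewrite (ltW p1) (ltW pp0).
Unshelve. all: by end_near. Qed.

(** Some E has P_s(E) < M |E|; approximating its indicator by a test function phi of
    the same mass keeps energy phi < M int phi.  As p tends to 1 the quotient for
    phi tends to energy phi / int phi. *)
Lemma lambda1_upper (Om : set V) (s M : R) : open Om -> bounded_set Om ->
  lipschitz_boundary Om -> 0 < s < 1 ->
  (cheeger Om s < M%:E)%E -> \forall p \near 1^'+, (lambda1 Om s p <= M%:E)%E.
Proof.
move=> oOm bOm lOm s01 /ereal_inf_lt[_ [E [mE EOm E0] <-] PE]; have /andP[s0 s1] := s01.
have mOm : measurable Om by exact: sub_sigma_algebra.
have Omoo := bounded_mu_lty mOm bOm.
have Ole : (mu E <= mu Om)%E by apply: le_measure => //; rewrite inE.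
have fE : mu E \is a fin_num by rewrite ge0_fin_numE//; exact: le_lt_trans Omoo.
have fOm : mu Om \is a fin_num by rewrite ge0_fin_numE.
pose e := fine (mu E); have e0 : 0 < e by rewrite fine_gt0// E0 ltey_eq fE.
have : (energy (frac_kernel s 1) \1_E < (M * e)%:E)%E.
  move: PE; rewrite s_perimeterE// -(fineK fE) inver gt_eqF//.
  by rewrite lte_pdivrMr// EFinM.
move=> PE'.
have P0 : (0 <= energy (frac_kernel s 1) \1_E)%E by apply: energy_ge0 => k; exact: frac_kernel_ge0.
have Pfin : energy (frac_kernel s 1) \1_E \is a fin_num.
  by rewrite ge0_fin_numE//; exact: lt_trans PE' (ltry _).
pose P := fine (energy (frac_kernel s 1) \1_E).
have PM : P < M * e by rewrite -lte_fin fineK.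
have dE : density Om (\1_E : V -> R).
  split; first exact: measurable_indic.
    by move=> x; rewrite indicE; case: (_ \in _); rewrite ?lexx ?ler01.
  by move=> x Ox; rewrite indicE memNset// => Ex; exact/Ox/EOm.
pose eps := (M * e - P) / 2; have eps0 : 0 < eps by rewrite divr_gt0// subr_gt0.
have [phi [tphi phi0 bphi Iphi Ephi]] :=
  test_approx oOm bOm lOm s01 dE (lt_trans PE' (ltry _)) eps0.
have mphi := bounded_lipschitz_measurable bphi.
have {}Iphi : (\int[mu]_x (phi x)%:E = e%:E)%E.
  by rewrite Iphi integral_indic// setIT fineK.
pose P' := P + eps.
have P'M : P' < M * e by rewrite /P' /eps; lra.
have P'0 : 0 <= P' by rewrite /P' addr_ge0 ?fine_ge0// ltW.
have {}Ephi : (energy (frac_kernel s 1) phi <= P'%:E)%E.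
  by rewrite /P' EFinD fineK.
have [B B0 hB] := bounded_lipschitz_holder s01 bphi.
have [C [bC _]] := bphi.
have C0 : 0 <= C by rewrite (le_trans _ (bC 0)).
have phiO x : ~ Om x -> phi x = 0.
  move=> Ox; apply: contrapT => /eqP px; apply: Ox; have [_ _ h] := tphi.
  by apply: h; exact: subset_closure.
pose w := fine (mu Om); have w0 : 0 <= w by exact: fine_ge0.
(* G p > 0 says that the bound B^(p-1) P' of the energy is at most M times the lower
   bound e - (p - 1) |Om| of the integral of phi^p. *)
pose G p := M * (e - (p - 1) * w) - B `^ (p - 1) * P'.
have cG : G p @[p --> 1^'+] --> M * e - P'.
  apply: cvg_at_right_filter.
  have -> : M * e - P' = M * (e - (1 - 1) * w) - B `^ (1 - 1) * P'.
    by rewrite subrr mul0r subr0 powRr0 mul1r.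
  have c1 : (p - 1) @[p --> (1 : R)] --> (1 - 1 : R) by apply: cvgB; [exact: cvg_id|exact: cvg_cst].
  apply: cvgB.
    apply: cvgMr; apply: cvgB; first exact: cvg_cst.
    exact: cvgMl.
  apply: cvgMl; rewrite /powR gt_eqF//.
  apply: (@cvg_comp _ _ _ (fun p => (p - 1) * ln B) expR _ (nbhs ((1 - 1) * ln B))); last exact: continuous_expR.
  exact: cvgMl.
have M0 : 0 < M by rewrite -(pmulr_lgt0 _ e0); exact: le_lt_trans P'M.
near=> p.
have p1 : 1 < p by near: p; exact: nbhs_right_gt.
have Gp : 0 < G p by near: p; apply: (cvgr_gt _ cG); rewrite subr_gt0.
have hE : (pow_energy s p phi <= (B `^ (p - 1) * P')%:E)%E.
  apply: le_trans (pow_energy_test s0 p1 (ltW B0) mphi hB) _.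
  by rewrite EFinM lee_wpmul2l// lee_fin powR_ge0.
have mp : measurable_fun setT (fun x => phi x `^ p) by exact: (measurableT_comp (measurable_powR _)).
pose I := (\int[mu]_x (phi x `^ p)%:E)%E.
have I0 : (0 <= I)%E by apply: integral_ge0 => x _; rewrite lee_fin powR_ge0.
have mind : measurable_fun setT (fun x => (\1_Om x : R)%:E).
  by apply/measurable_EFinP; exact: measurable_indic.
have ind0 x : setT x -> (0 <= (\1_Om x : R)%:E)%E by rewrite lee_fin indicE.
have Iind : (\int[mu]_x (\1_Om x : R)%:E = mu Om)%E by rewrite integral_indic// setIT.
have Ifin : I \is a fin_num.
  rewrite ge0_fin_numE//.
  apply: (@le_lt_trans _ _ (\int[mu]_x ((C `^ p)%:E * (\1_Om x : R)%:E))%E).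
    apply: le_int => x; first by rewrite lee_fin powR_ge0.
    rewrite -EFinM lee_fin indicE; have [Ox|/negP] := boolP (x \in Om).
      rewrite mulr1 ge0_ler_powR ?nnegrE//; first by rewrite (le_trans ler01)// ltW.
      by rewrite -(ger0_norm (phi0 x)).
    by rewrite inE => /phiO ->; rewrite mulr0 powR0// gt_eqF// (lt_trans ltr01).
  rewrite (ge0_integralZl mu measurableT mind ind0) ?lee_fin ?powR_ge0// Iind.
  by rewrite -(fineK fOm) -EFinM ltry.
pose S := fine I.
(* The tangent inequality at 1 gives phi^p >= phi - (p - 1) pointwise. *)
have Sle : e - (p - 1) * w <= S.
  have fS : S%:E = I by rewrite fineK.
  have fw : w%:E = mu Om by rewrite fineK.
  rewrite lerBlDr -lee_fin EFinD EFinM fS fw -Iphi -Iind /I.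
  rewrite -(ge0_integralZl mu measurableT mind ind0); last by rewrite lee_fin subr_ge0 ltW.
  have mpE : measurable_fun setT (fun x => (phi x `^ p)%:E) by exact/measurable_EFinP.
  have p10 : 0 <= p - 1 by rewrite subr_ge0 ltW.
  rewrite -(ge0_integralD mu measurableT _ mpE).
  - apply: le_int => x; first by rewrite lee_fin.
    rewrite -EFinM -EFinD lee_fin indicE; have [Ox|/negP] := boolP (x \in Om); last first.
      by rewrite inE => /phiO ->; rewrite mulr0 addr0 powR_ge0.
    rewrite mulr1; have := powR_tangent ler01 (phi0 x) p1.
    rewrite !powR1 mul1r => h; have : 0 <= (p - 1) * phi x by rewrite mulr_ge0.
    lra.
  - by move=> x _; rewrite lee_fin powR_ge0.
  - by move=> x _; rewrite -EFinM lee_fin mulr_ge0// indicE.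
  - by apply: emeasurable_funM => //; exact: measurable_cst.
have BP0 : 0 <= B `^ (p - 1) * P' by rewrite mulr_ge0 ?powR_ge0.
have low : 0 < e - (p - 1) * w.
  rewrite -(pmulr_rgt0 _ M0); move: Gp; rewrite subr_gt0; exact: le_lt_trans.
have S0 : 0 < S by exact: lt_le_trans Sle.
have IS : I = S%:E by rewrite /S fineK.
apply: le_trans (lambda1_le_test s0 p1 tphi phi0 S0 IS hE) _.
rewrite lee_fin ler_pdivrMr//; apply: (@le_trans _ _ (M * (e - (p - 1) * w))).
  by move: Gp; rewrite subr_gt0 => /ltW.
by rewrite ler_wpM2l// ltW.
Unshelve. all: by end_near. Qed.
End main.

Theorem theorem7p1 (R : realType) (n : nat) (Omega : set 'rV[R]_n.+1) (s : R)
    (Omega_open : open Omega) (Omega_bounded : bounded_set Omega)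
    (Omega_lipschitz : lipschitz_boundary Omega) (s01 : 0 < s < 1) :
  lambda1 Omega s p @[p --> 1^'+] --> cheeger Omega s.
Proof.
apply: cvg_ereal_bounds => M hM.
- exact: lambda1_lower.
- exact: lambda1_upper.
Qed.
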